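(* Let $n\le m$ be positive integers, and let $X$ be an $n\times m$ random matrix with entries $X_{ij}=b_{ij}\xi_{ij}$, where $b_{ij}\ge 0$ are arbitrary scalars and $\xi_{ij}$ ($i\le n$, $j\le m$) are independent, symmetrically distributed real random variables with $\mathbf{E}[\xi_{ij}^{2p}]\le \mathbf{E}[g^{2p}]$ for all $i,j$ and all $p\in\mathbb{N}$, where $g\sim N(0,1)$. Let $$\sigma_1^2 := \max_{j\le m}\sum_{i\le n} b_{ij}^2,\qquad \sigma_2^2:=\max_{i\le n}\sum_{j\le m} b_{ij}^2,\qquad \sigma_*^2:=\max_{i\le n,\,j\le m} b_{ij}^2.$$ Then $$\mathbf{P}\big[\|X\|>\sigma_1+\sigma_2+\sigma_*(1+t)\big]\le 2n\,e^{-t^2/2}$$ for all $t\ge 0$.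
   Context: $\|X\|$ denotes the spectral norm (largest singular value). $\sigma_1,\sigma_2,\sigma_*$ denote the nonnegative square roots. ''Symmetrically distributed'' means that $\xi_{ij}$ and $-\xi_{ij}$ have the same law. *)

(* Defs.v *)
From HB Require Import structures.
From mathcomp Require Import all_boot all_order all_algebra.
From mathcomp Require Import all_classical all_reals all_analysis.

Set Implicit Arguments.
Unset Strict Implicit.
Unset Printing Implicit Defensive.

Import Order.TTheory GRing.Theory Num.Theory.
Import numFieldNormedType.Exports.

Local Open Scope classical_set_scope.
Local Open Scope ring_scope.

Definition mutually_independent (d : measure_display) (T : measurableType d)
    (R : realType) (P : probability T R) (I : finType)
    (X : I -> {RV P >-> R}) : Prop :=
  forall (J : {set I}) (A : I -> set R), (forall i, measurable (A i)) ->
    P (\bigcap_(i in [set` J]) (X i @^-1` A i)) =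
    (\prod_(i in J) P (X i @^-1` A i))%E.

(* Only measurable sets are compared: the values of a measure outside its
   sigma-algebra are unspecified, so equating [distribution P X] with
   [distribution P (\- X)] as functions on all sets would be too strong. *)
Definition symmetric_law (d : measure_display) (T : measurableType d)
    (R : realType) (P : probability T R) (X : {RV P >-> R}) : Prop :=
  forall A : set R, measurable A ->
    P (X @^-1` A) = P ((fun w => - X w) @^-1` A).

Definition singular_value (R : realType) (n m : nat) (A : 'M[R]_(n, m))
    (s : R) : Prop :=
  0 <= s /\ eigenvalue (A^T *m A) (s ^+ 2).

(* For 0 < m the set of singular values is finite and nonempty, so that the
   supremum is attained. *)
Definition spectral_norm (R : realType) (n m : nat) (A : 'M[R]_(n, m)) : R :=
  sup [set s | singular_value A s].

(* The maximized quantities are nonnegative, so the default value 0 has no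
   effect on the maxima for 0 < n and 0 < m. *)
Definition sigma1 (R : realType) (n m : nat) (b : 'I_n -> 'I_m -> R) : R :=
  Num.sqrt (\big[Num.max/0]_(j < m) \sum_(i < n) b i j ^+ 2).

Definition sigma2 (R : realType) (n m : nat) (b : 'I_n -> 'I_m -> R) : R :=
  Num.sqrt (\big[Num.max/0]_(i < n) \sum_(j < m) b i j ^+ 2).

Definition sigmastar (R : realType) (n m : nat) (b : 'I_n -> 'I_m -> R) : R :=
  Num.sqrt (\big[Num.max/0]_(i < n) \big[Num.max/0]_(j < m) b i j ^+ 2).

Definition weighted_matrix (R : realType) (n m : nat) (T : Type)
    (b : 'I_n -> 'I_m -> R) (xi : 'I_n -> 'I_m -> T -> R) (w : T)
    : 'M[R]_(n, m) :=
  \matrix_(i, j) (b i j * xi i j w).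

(* Main.v *)
(* With [lam = t / sigmastar], Markov's inequality applied to the even part of
   [exp (lam x)] reduces the tail bound to bounding [E tr (X X^T)^p] for all [p],
   that is, a sum over closed walks in the complete bipartite graph on rows and
   columns. By independence and symmetry only walks in which every edge has even
   multiplicity contribute, and by the moment hypothesis the mixed moment along a
   walk is at most the Gaussian one, i.e. the number of pairings of its steps that
   match equal edges. For a fixed pairing, all weights [b / sigmastar] are at most
   1, and summing over the vertices in the order of their discovery each new
   vertex costs a factor [(sigma1 / sigmastar)^2] or [(sigma2 / sigmastar)^2];
   hence the sum is at most the corresponding sum for an N x M Gaussian matrix
   [Y], with N and M the two factors rounded up. The resulting exponential series
   is bounded by [exp (t (sqrt N + sqrt M) + t^2 / 2)] through Gordon's comparison
   of [u^T Y v] with [g . u + h . v] over finite nets of unit vectors. In this last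
   step Gaussians are replaced by normalized sums of [J^2] random signs, so that
   all averages are finite sums and the comparison is made sign by sign with
   Taylor expansions, [J] tending to infinity at the end. *)

Require Import Defs.
From HB Require Import structures.
From mathcomp Require Import all_boot all_order all_algebra.
From mathcomp Require Import all_classical all_reals all_analysis.
From mathcomp Require Import measurable_realfun ring lra zify.

Set Implicit Arguments.
Unset Strict Implicit.
Unset Printing Implicit Defensive.

Import Order.TTheory GRing.Theory Num.Theory.
Import numFieldNormedType.Exports.

Local Open Scope classical_set_scope.
Local Open Scope ring_scope.

(** * Second-order Taylor bounds *)

Section Taylor.
Variable R : realType.
Implicit Types (x y t k eta : R).

(** The exact exponent rests on a cancellation. The variance of [g . u + h . v] exceeds that of
    [u^T Y v] by exactly one, which gains [lam^2 / 2] in the comparison, while the exponential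
    moments of [|g|] and [|h|] cost [lam^2 / 2] each beyond [lam * sqrt N] and [lam * sqrt M]; one
    [lam^2 / 2] remains. The dimension enters only through the [n] starting rows of the trace: walks
    are compared from one fixed row, and a single diagonal entry of [(Y Y^T)^p] is at most
    [|Y|^(2p)], so neither [N] nor [M] appears as a prefactor. The [1] in [1 + t] pays for the two
    roundings to integers, and the factor 2 comes from [cosh x >= exp x / 2]. The maximum over the
    nets is not smooth, so Taylor expansion is applied to the power [k = lam / b] of a sum of
    exponentials of parameter [b]. For a fixed number [P] of series terms the limits are taken in
    the order: walk length to infinity, then [b] to infinity, then mesh of the nets to zero; only at
    the end does [P] grow. *)

Lemma expR_series_cvg x : (\sum_(0 <= i < n) x ^+ i / i`!%:R) @[n --> \oo] --> expR x.
Proof. exact: is_cvg_series_exp_coeff. Qed.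

Lemma expR_taylor2 y : `|y| <= 1 -> `|expR y - (1 + y + y ^+ 2 / 2)| <= `|y| ^+ 3.
Proof.
move=> y1.
have cv : `|\sum_(0 <= i < n) y ^+ i / i`!%:R - (1 + y + y ^+ 2 / 2)| @[n --> \oo]
   --> `|expR y - (1 + y + y ^+ 2 / 2)|.
  by apply: cvg_norm; apply: cvgB; [exact: expR_series_cvg | exact: cvg_cst].
rewrite -(cvg_lim _ cv)//; apply: limr_le; first by apply/cvg_ex; eexists; exact: cv.
near=> n.
have n3 : (3 <= n)%N by near: n; exists 3%N.
rewrite (big_cat_nat (n := 3)) //= big_nat_recr //= big_nat_recr //= big_nat_recr //= big_geq //.
rewrite !factS fact0 expr0 expr1 add0r.
set S := \sum_(3 <= i < n) _.
have -> : 1 / (1%:R) + y / (1 * 1)%:R + y ^+ 2 / (2 * (1 * 1))%:R + S - (1 + y + y ^+ 2 / 2) = S.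
  by rewrite !muln1 !divr1; ring.
(* Since [2 ^ (j + 1) <= (3 + j)!], the tail from the third term on is dominated by [|y| ^ 3] times
   a geometric series of sum one. *)
suff : `|S| <= `|y| ^+ 3 * (1 - 2^-1 ^+ (n - 3)).
  move=> /le_trans; apply; by rewrite ler_piMr ?exprn_ge0// gerBl exprn_ge0.
rewrite /S -{1}(subnKC n3); elim: (n - 3)%N => [|j IH].
  by rewrite addn0 big_geq// normr0 expr0 subrr mulr0.
rewrite addnS big_nat_recr/= ?leq_addr//.
apply: le_trans (ler_normD _ _) _.
have : `|y ^+ (3 + j) / (3 + j)`!%:R| <= `|y| ^+ 3 * 2^-1 ^+ j.+1.
  rewrite normrM normrX exprD -mulrA ler_wpM2l ?exprn_ge0//.
  rewrite -[leRHS]mul1r ler_pM//; first by rewrite exprn_ile1.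
  rewrite ger0_norm ?invr_ge0// exprVn lef_pV2 ?posrE ?exprn_gt0 ?ltr0n ?fact_gt0//.
  rewrite -natrX ler_nat; elim: j {IH} => [//|j IH].
  by rewrite expnS addnS factS leq_mul.
move=> h; apply: le_trans (lerD IH h) _.
rewrite -mulrDr ler_wpM2l ?exprn_ge0// exprS; lra.
Unshelve. all: by end_near. Qed.

Lemma norm_ln1D_le t : `|t| <= 1 / 2 ->
  `|ln (1 + t)| <= 2 * `|t|.
Proof.
move=> t12; have t0 : 0 < 1 + t by move: t12; rewrite ler_norml; lra.
have u : ln (1 + t) <= t by have := le_ln1Dx (x := t); apply; lra.
have l : - ln (1 + t) <= - (t / (1 + t)).
  rewrite -lnV ?posrE//.
  rewrite [X in ln X](_ : _ = 1 + - (t / (1 + t))); last by field; lra.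
  apply: le_ln1Dx; rewrite ltrNr opprK ltr_pdivrMr//; lra.
have l2 : t / (1 + t) <= ln (1 + t) by lra.
have h : `|t / (1 + t)| <= 2 * `|t|.
  rewrite normrM mulrC ler_wpM2r// gtr0_norm ?invr_gt0//.
  rewrite -[2]invrK lef_pV2 ?posrE//; move: t12; rewrite ler_norml; lra.
move: h; rewrite !ler_norml => /andP[h1 h2].
have := ler_norm t; move: (normr_ge0 t); lra.
Qed.

(** This is the binomial expansion of [(1 + t) ^ k]. With [L = ln (1 + t)], the exponential is
    expanded both at [L] and at [k * L]; as [expR L = 1 + t], the first expansion eliminates the
    linear term in [L] from the second. The three errors are [8 + 8 + 18 = 34] times the cube. *)
Lemma powln_taylor k t : 0 <= k <= 1 -> `|t| <= 1 / 2 ->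
  `|expR (k * ln (1 + t)) - (1 + k * t + (k ^+ 2 - k) / 2 * t ^+ 2)| <= 34 * `|t| ^+ 3.
Proof.
move=> /andP[k0 k1] t12; have L2 := norm_ln1D_le t12.
have t0 : 0 < 1 + t by move: t12; rewrite ler_norml; lra.
set L := ln (1 + t) in L2 *.
set T := `|t| in t12 L2 *.
have T0 : 0 <= T by exact: normr_ge0.
have L1 : `|L| <= 1 by lra.
have e1 : expR L = 1 + t by rewrite lnK.
have L3 : `|L| ^+ 3 <= 8 * T ^+ 3.
  have -> : 8 * T ^+ 3 = (2 * T) ^+ 3 by ring.
  by rewrite lerXn2r ?nnegrE//; lra.
have := expR_taylor2 L1; rewrite e1 => h1.
have T3 : T ^+ 3 <= T ^+ 2 / 2 by rewrite exprS; nra.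
have LT2 : `|L| ^+ 2 <= 4 * T ^+ 2.
  have -> : 4 * T ^+ 2 = (2 * T) ^+ 2 by ring.
  by rewrite lerXn2r ?nnegrE//; lra.
have tT : t ^+ 2 = T ^+ 2 by rewrite /T real_normK// num_real.
have LL : L ^+ 2 = `|L| ^+ 2 by rewrite real_normK// num_real.
have h1' : `|1 + t - (1 + L + L ^+ 2 / 2)| <= 8 * T ^+ 3 by lra.
have d1 : `|L - t| <= 6 * T ^+ 2.
  move: h1'; rewrite !ler_norml; have := sqr_ge0 L; lra.
have d2 : `|L ^+ 2 - t ^+ 2| <= 18 * T ^+ 3.
  rewrite subr_sqr normrM.
  have -> : 18 * T ^+ 3 = (6 * T ^+ 2) * (3 * T) by ring.
  rewrite ler_pM//; apply: le_trans (ler_normD _ _) _; rewrite -/T; lra.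
have kL : `|k * L| <= `|L| by rewrite normrM ger0_norm// ler_piMl.
have kL1 : `|k * L| <= 1 by lra.
have h2 := expR_taylor2 kL1.
have kL3 : `|k * L| ^+ 3 <= 8 * T ^+ 3.
  by apply: le_trans L3; rewrite lerXn2r ?nnegrE.
have h2' : `|expR (k * L) - (1 + k * L + (k * L) ^+ 2 / 2)| <= 8 * T ^+ 3 by lra.
set a := 1 + t - (1 + L + L ^+ 2 / 2) in h1'.
set b := L ^+ 2 - t ^+ 2 in d2.
set c := expR _ - _ in h2'.
have -> : expR (k * L) - (1 + k * t + (k ^+ 2 - k) / 2 * t ^+ 2) =
  c - k * a + (k ^+ 2 - k) / 2 * b by rewrite /a /b /c; field.
apply: le_trans (ler_normD _ _) _; apply: le_trans (lerD (ler_normB _ _) (lexx _)) _.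
have ka : `|k * a| <= 8 * T ^+ 3.
  by rewrite normrM ger0_norm//; apply: le_trans h1'; rewrite ler_piMl.
have kb : `|(k ^+ 2 - k) / 2 * b| <= 18 * T ^+ 3.
  rewrite normrM; apply: le_trans d2; rewrite ler_piMl// ler_norml; nra.
lra.
Qed.

(** The mean of [expR (y a)] is [1 + t] with [t = m1 + m2 / 2] up to [eta ^ 3], and [powln_taylor]
    applies to this [t]. As [|t| <= 2 * eta], the errors add up to [34 * 8 + 1 + 3 = 276] times
    [eta ^ 3]. *)
Lemma soft_taylor (A : finType) (p y : A -> R) k eta :
  (forall a, 0 <= p a) -> \sum_a p a = 1 -> 0 <= k <= 1 -> eta <= 1 / 4 ->
  (forall a, `|y a| <= eta) ->
  `|expR (k * ln (\sum_a p a * expR (y a))) -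
    (1 + k * (\sum_a p a * y a) + k / 2 * (\sum_a p a * y a ^+ 2)
     + (k ^+ 2 - k) / 2 * (\sum_a p a * y a) ^+ 2)| <= 300 * eta ^+ 3.
Proof.
move=> p0 p1 k01 eta4 ye.
set m1 := \sum_a p a * y a; set m2 := \sum_a p a * y a ^+ 2.
have eta0 : 0 <= eta.
  case: (pickP A) => [a _|h]; first exact: le_trans (ye a).
  by move: p1; rewrite big_pred0 // => /eqP; rewrite eq_sym oner_eq0.
have avg (f : A -> R) c : (forall a, `|f a| <= c) -> `|\sum_a p a * f a| <= c.
  move=> fc; apply: le_trans (ler_norm_sum _ _ _) _.
  rewrite -[leRHS]mul1r -p1 mulr_suml ler_sum// => a _.
  by rewrite normrM ger0_norm// ler_wpM2l.
have m1e : `|m1| <= eta by exact: avg.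
have m2e : `|m2| <= eta ^+ 2.
  by apply: avg => a; rewrite normrX lerXn2r ?nnegrE.
pose t := \sum_a p a * (expR (y a) - 1).
have tE : \sum_a p a * expR (y a) = 1 + t.
  rewrite -p1 /t -big_split/=; apply: eq_bigr => a _; ring.
have tr : `|t - m1 - m2 / 2| <= eta ^+ 3.
  have -> : t - m1 - m2 / 2 = \sum_a p a * (expR (y a) - (1 + y a + y a ^+ 2 / 2)).
    rewrite /t /m1 /m2 mulr_suml -!sumrB; apply: eq_bigr => a _; ring.
  apply: avg => a; apply: le_trans (expR_taylor2 _) _.
    by apply: le_trans (ye a) _; lra.
  by rewrite lerXn2r ?nnegrE.
have e2 : eta ^+ 2 <= eta / 4 by rewrite expr2; nra.
have e3 : eta ^+ 3 <= eta ^+ 2 / 4 by rewrite exprS; nra.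
have t2 : `|t| <= 2 * eta.
  by move: tr m1e m2e; rewrite !ler_norml; lra.
have t12 : `|t| <= 1 / 2 by lra.
have h := powln_taylor k01 t12.
have t3 : `|t| ^+ 3 <= 8 * eta ^+ 3.
  have -> : 8 * eta ^+ 3 = (2 * eta) ^+ 3 by ring.
  by rewrite lerXn2r ?nnegrE//; lra.
have d : `|t ^+ 2 - m1 ^+ 2| <= 3 * eta ^+ 3.
  rewrite subr_sqr normrM.
  have -> : 3 * eta ^+ 3 = eta ^+ 2 * (3 * eta) by ring.
  rewrite ler_pM//.
    by move: tr m2e; rewrite !ler_norml; lra.
  by apply: le_trans (ler_normD _ _) _; lra.
rewrite tE.
set a := t - m1 - m2 / 2 in tr.
set b := t ^+ 2 - m1 ^+ 2 in d.
set c := expR _ - _ in h.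
have -> : expR (k * ln (1 + t)) - (1 + k * m1 + k / 2 * m2 + (k ^+ 2 - k) / 2 * m1 ^+ 2)
  = c + k * a + (k ^+ 2 - k) / 2 * b by rewrite /a /b /c; field.
case/andP: k01 => k0 k1.
apply: le_trans (ler_normD _ _) _; apply: le_trans (lerD (ler_normD _ _) (lexx _)) _.
have ka : `|k * a| <= eta ^+ 3.
  by rewrite normrM ger0_norm//; apply: le_trans tr; rewrite ler_piMl.
have kb : `|(k ^+ 2 - k) / 2 * b| <= 3 * eta ^+ 3.
  rewrite normrM; apply: le_trans d; rewrite ler_piMl// ler_norml; nra.
have e30 : 0 <= eta ^+ 3 by rewrite exprn_ge0.
lra.
Qed.

End Taylor.

(** * Random signs and Gordon's comparison *)

Section Signs.
Variables (R : realType) (I : finType).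
Implicit Types (F G : {ffun I -> bool} -> R) (e : {ffun I -> bool}).

Definition sgn_avg F : R := (2 ^+ #|I|)^-1 * \sum_e F e.

Lemma sgn_avg_ext F G : F =1 G -> sgn_avg F = sgn_avg G.
Proof. by move=> FG; congr (_ * _); apply: eq_bigr => e _; exact: FG. Qed.

Lemma sgn_avg_le F G : (forall e, F e <= G e) -> sgn_avg F <= sgn_avg G.
Proof. by move=> FG; rewrite ler_wpM2l ?invr_ge0 ?exprn_ge0// ler_sum. Qed.

Lemma sgn_avg_cst c : sgn_avg (fun=> c) = c.
Proof.
rewrite /sgn_avg sumr_const (eq_card (B := {: {ffun I -> bool}}))// card_ffun card_bool -[c *+ _]mulr_natr natrX mulrCA mulVf ?mulr1//.
Qed.

Lemma sgn_avgZ c F : sgn_avg (fun e => c * F e) = c * sgn_avg F.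
Proof. by rewrite /sgn_avg -mulr_sumr mulrCA. Qed.

Lemma sgn_avgD F G : sgn_avg (fun e => F e + G e) = sgn_avg F + sgn_avg G.
Proof. by rewrite /sgn_avg big_split/= mulrDr. Qed.

Lemma sgn_avg_sum (T : Type) (s : seq T) (P : pred T) (F : T -> {ffun I -> bool} -> R) :
  sgn_avg (fun e => \sum_(a <- s | P a) F a e) = \sum_(a <- s | P a) sgn_avg (F a).
Proof. by rewrite /sgn_avg exchange_big/= mulr_sumr. Qed.

Lemma sgn_avg_prod (f : I -> bool -> R) :
  sgn_avg (fun e => \prod_i f i (e i)) = \prod_i ((f i true + f i false) / 2).
Proof.
rewrite /sgn_avg big_split/= prodr_const exprVn mulrC; congr (_ * _).
by rewrite -bigA_distr_bigA/=; apply: eq_bigr => i _; rewrite big_bool.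
Qed.

(** Flipping one sign permutes the sign vectors, so the average of a function odd in that sign
    equals its own negative. *)
Lemma sgn_avg_flip (i : I) F :
  (forall e, F [ffun l => e l (+) (l == i)] = - F e) -> sgn_avg F = 0.
Proof.
move=> FN; rewrite /sgn_avg; set S := \sum_e F e.
suff : S = - S by move=> ?; rewrite (_ : S = 0) ?mulr0//; lra.
rewrite /S -sumrN (reindex_inj (h := fun e => [ffun l => e l (+) (l == i)])) /=.
  by apply: eq_bigr => e _; rewrite FN.
move=> e1 e2 /ffunP e12; apply/ffunP => l; have := e12 l; rewrite !ffunE.
by move=> /addIb.
Qed.

Lemma sgn_avg_lin (u : I -> R) : sgn_avg (fun e => \sum_i u i * (-1) ^+ e i) = 0.
Proof.
rewrite sgn_avg_sum big1// => i _; rewrite sgn_avgZ (@sgn_avg_flip i) ?mulr0// => e.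
by rewrite ffunE eqxx addbT; case: (e i) => /=; rewrite ?expr0 ?expr1 ?opprK.
Qed.

Lemma sgn_avg_quad (u v : I -> R) :
  sgn_avg (fun e => (\sum_i u i * (-1) ^+ e i) * (\sum_i v i * (-1) ^+ e i))
  = \sum_i u i * v i.
Proof.
under sgn_avg_ext do rewrite big_distrlr/=.
rewrite sgn_avg_sum; apply: eq_bigr => i _.
rewrite sgn_avg_sum (bigD1 i)//= big1 ?addr0.
  under sgn_avg_ext => e do
    rewrite mulrACA -exprD addnn -muln2 exprM sqrr_sign mulr1.
  exact: sgn_avg_cst.
move=> j ji; under sgn_avg_ext do rewrite mulrACA.
rewrite sgn_avgZ (@sgn_avg_flip i) ?mulr0// => e.
rewrite !ffunE eqxx (negbTE ji) addbT addbF.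
by case: (e i) => /=; rewrite ?expr0 ?expr1 ?mul1r ?mulN1r ?opprK.
Qed.

End Signs.

Section Steps.
Variables (R : realType) (A : Type) (I : finType).

(* Averaging [f] over one step of the random walk on [A -> R] that moves the
   coordinate [a] by [s * \sum_i c a i * eps_i], for independent signs [eps_i]. *)
Definition walk_step (s : R) (c : A -> I -> R) (f : (A -> R) -> R) (X : A -> R) : R :=
  sgn_avg (fun e : {ffun I -> bool} =>
    f (fun a => X a + s * \sum_i c a i * (-1) ^+ e i)).

Lemma walk_step_le s c f g : (forall X, f X <= g X) ->
  forall X, walk_step s c f X <= walk_step s c g X.
Proof. by move=> fg X; apply: sgn_avg_le => e; exact: fg. Qed.

Lemma walk_stepZ s c r f X : walk_step s c (fun Y => r * f Y) X = r * walk_step s c f X.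
Proof. exact: sgn_avgZ. Qed.

Lemma iter_walk_step_le s c k f g : (forall X, f X <= g X) ->
  forall X, iter k (walk_step s c) f X <= iter k (walk_step s c) g X.
Proof. by elim: k => [//|k IH] fg X; apply: walk_step_le => Y; exact: IH. Qed.

Lemma iter_walk_stepZ s c k r f X :
  iter k (walk_step s c) (fun Y => r * f Y) X = r * iter k (walk_step s c) f X.
Proof.
elim: k X => [//|k IH] X; rewrite !iterS -walk_stepZ.
by apply: sgn_avg_ext => e; exact: IH.
Qed.

End Steps.

Lemma walk_stepC (R : realType) (A : Type) (I1 I2 : finType) (s : R)
    (c1 : A -> I1 -> R) (c2 : A -> I2 -> R) (f : (A -> R) -> R) X :
  walk_step s c1 (walk_step s c2 f) X = walk_step s c2 (walk_step s c1 f) X.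
Proof.
rewrite /walk_step /sgn_avg.
under eq_bigr do rewrite mulr_sumr.
under [in RHS]eq_bigr do rewrite mulr_sumr.
rewrite exchange_big/= !mulr_sumr; apply: eq_bigr => e _.
rewrite !mulr_sumr; apply: eq_bigr => e' _; rewrite mulrCA; congr (_ * (_ * f _)).
by apply/funext => a; rewrite addrAC.
Qed.

Lemma iter_walk_stepC (R : realType) (A : Type) (I1 I2 : finType) (s : R)
    (c1 : A -> I1 -> R) (c2 : A -> I2 -> R) (f : (A -> R) -> R) k :
  walk_step s c1 (iter k (walk_step s c2) f) = iter k (walk_step s c2) (walk_step s c1 f).
Proof.
elim: k => [//|k IH]; rewrite !iterS -IH.
by apply/funext => X; exact: walk_stepC.
Qed.

Section Comparison.
Variables (R : realType) (A I1 I2 : finType).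
Variables (c1 : A -> I1 -> R) (c2 : A -> I2 -> R) (beta k : R).
Hypotheses (A0 : (0 < #|A|)%N) (beta0 : 0 < beta) (k01 : 0 <= k <= 1).
Hypothesis var_c : forall a, \sum_i c2 a i ^+ 2 = \sum_i c1 a i ^+ 2 + 1.
Hypothesis cov_c : forall a b,
  \sum_i c2 a i * c2 b i <= \sum_i c1 a i * c1 b i + 1.

(* As [beta] tends to infinity with [k * beta = lam] fixed, [softmax X] tends to
   [expR (lam * max X)]. *)
Definition softmax (X : A -> R) : R := expR (k * ln (\sum_a expR (beta * X a))).

Lemma sum_expR_gt0 (X : A -> R) : 0 < \sum_a expR (beta * X a).
Proof.
case/card_gt0P: A0 => a _; rewrite (bigD1 a)//=.
by rewrite ltr_pwDl ?expR_gt0// sumr_ge0// => b _; exact: expR_ge0.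
Qed.

(** The shift factors out as a [k]-th power of the mean of [expR (beta * y a)] under the Gibbs
    weights of [X]. One walk step thus reduces to expanding that mean near 1, uniformly in [X]. *)
Lemma softmax_shift (X y : A -> R) :
  softmax (fun a => X a + y a) = softmax X *
    expR (k * ln (\sum_a (expR (beta * X a) / \sum_b expR (beta * X b)) *
      expR (beta * y a))).
Proof.
have Z0 := sum_expR_gt0 X.
rewrite /softmax -expRD -mulrDr -lnM ?posrE//; last first.
  case/card_gt0P: A0 => a _; rewrite (bigD1 a)//=.
  rewrite ltr_pwDl//; first by rewrite mulr_gt0 ?expR_gt0// divr_gt0 ?expR_gt0.
  by rewrite sumr_ge0// => b _; rewrite !mulr_ge0 ?expR_ge0// invr_ge0 ltW.
congr (expR (k * ln _)); rewrite mulr_sumr; apply: eq_bigr => a _.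
by rewrite mulrDr expRD mulrA mulrCA mulfV ?mulr1// gt_eqF.
Qed.

(** The sign average of the expansion in [soft_taylor] when [y a] is [beta * s] times a sign sum
    with coefficients [c a]: the linear term averages to zero, and the squares leave the mean
    variance and the variance of the mean. *)
Definition quad_avg (I : finType) (c : A -> I -> R) (p : A -> R) s : R :=
  1 + k / 2 * (\sum_a p a * ((beta * s) ^+ 2 * \sum_i c a i ^+ 2)) +
  (k ^+ 2 - k) / 2 * ((beta * s) ^+ 2 * \sum_i (\sum_a p a * c a i) ^+ 2).

(** The first bound averages [soft_taylor] over the signs. The other two keep [Q] near 1, so that
    additive errors can be turned into multiplicative ones when two walks are compared. *)
Lemma sgn_avg_softmax (I : finType) (c : A -> I -> R) (p : A -> R) (s D : R) :
  (forall a, 0 <= p a) -> \sum_a p a = 1 -> 0 < s ->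
  (forall a, \sum_i `|c a i| <= D) -> beta * s * D <= 1 / 4 ->
  let Q := sgn_avg (fun e : {ffun I -> bool} =>
     expR (k * ln (\sum_a p a * expR (beta * (s * \sum_i c a i * (-1) ^+ e i))))) in
  [/\ `|Q - quad_avg c p s| <= 300 * (beta * s * D) ^+ 3, 1 / 2 <= Q &
      Q <= 1 + 2 * (beta * s * D)].
Proof.
move=> p0 p1 s0 cD bsD Q.
have D0 : 0 <= D.
  by case/card_gt0P: A0 => a _; apply: le_trans (cD a); rewrite sumr_ge0.
set eta := beta * s * D in bsD *.
have bs0 : 0 <= beta * s by rewrite mulr_ge0// ltW.
have eta0 : 0 <= eta by rewrite mulr_ge0.
pose y (e : {ffun I -> bool}) a := beta * (s * \sum_i c a i * (-1) ^+ e i).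
have ye e a : `|y e a| <= eta.
  rewrite /y mulrA normrM ger0_norm// ler_wpM2l//.
  apply: le_trans (ler_norm_sum _ _ _) _; apply: le_trans (cD a).
  by apply: ler_sum => i _; rewrite normrM normrX normrN1 expr1n mulr1.
pose m1 e := \sum_a p a * y e a; pose m2 e := \sum_a p a * y e a ^+ 2.
have m1E e : m1 e = (beta * s) * \sum_i (\sum_a p a * c a i) * (-1) ^+ e i.
  rewrite /m1 mulr_sumr; under [RHS]eq_bigr do rewrite mulr_suml mulr_sumr.
  rewrite exchange_big/=; apply: eq_bigr => a _.
  rewrite /y !mulr_sumr; apply: eq_bigr => i _; ring.
have avg1 : sgn_avg m1 = 0.
  by under sgn_avg_ext do rewrite m1E; rewrite sgn_avgZ sgn_avg_lin mulr0.
have avg11 : sgn_avg (fun e => m1 e ^+ 2) =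
    (beta * s) ^+ 2 * \sum_i (\sum_a p a * c a i) ^+ 2.
  under sgn_avg_ext do rewrite m1E exprMn.
  rewrite sgn_avgZ; congr (_ * _).
  by under sgn_avg_ext do rewrite expr2; rewrite sgn_avg_quad.
have avg2 : sgn_avg m2 = \sum_a p a * ((beta * s) ^+ 2 * \sum_i c a i ^+ 2).
  rewrite sgn_avg_sum; apply: eq_bigr => a _; rewrite sgn_avgZ; congr (_ * _).
  under sgn_avg_ext do rewrite /y mulrA exprMn.
  rewrite sgn_avgZ; congr (_ * _).
  by under sgn_avg_ext do rewrite expr2; rewrite sgn_avg_quad.
have QE : sgn_avg (fun e => 1 + k * m1 e + k / 2 * m2 e + (k ^+ 2 - k) / 2 * m1 e ^+ 2)
    = quad_avg c p s.
  by rewrite !sgn_avgD !sgn_avgZ avg1 avg11 avg2 sgn_avg_cst mulr0 addr0.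
pose q e := expR (k * ln (\sum_a p a * expR (y e a))).
have qe e := soft_taylor p0 p1 k01 bsD (ye e).
have h1 : Q <= quad_avg c p s + 300 * eta ^+ 3.
  rewrite -QE -(sgn_avg_cst I (300 * eta ^+ 3)) -sgn_avgD.
  apply: sgn_avg_le => e.
  by have := qe e; rewrite ler_norml /m1 /m2 /y => /andP[_]; rewrite lerBlDl.
have h2 : quad_avg c p s <= Q + 300 * eta ^+ 3.
  rewrite -QE -(sgn_avg_cst I (300 * eta ^+ 3)) -sgn_avgD.
  apply: sgn_avg_le => e.
  by have := qe e; rewrite ler_norml /m1 /m2 /y => /andP[+ _]; lra.
have [k0 k1] := andP k01.
have le1 e : expR (- eta) <= \sum_a p a * expR (y e a).
  rewrite -[leLHS]mul1r -p1 mulr_suml ler_sum// => a _.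
  by rewrite ler_wpM2l// ler_expR; have := ye e a; rewrite ler_norml => /andP[].
have le2 e : \sum_a p a * expR (y e a) <= expR eta.
  rewrite -[leRHS]mul1r -p1 mulr_suml ler_sum// => a _.
  by rewrite ler_wpM2l// ler_expR; have := ye e a; rewrite ler_norml => /andP[].
have pos e : 0 < \sum_a p a * expR (y e a) by apply: lt_le_trans (le1 e); exact: expR_gt0.
split.
- by rewrite ler_norml; apply/andP; split; lra.
- rewrite -(sgn_avg_cst I (1 / 2)); apply: sgn_avg_le => e.
  apply: (@le_trans _ _ (expR (- eta))).
    by apply: le_trans (expR_ge1Dx _); lra.
  rewrite ler_expR; have : - eta <= ln (\sum_a p a * expR (y e a)).
    by rewrite -[leLHS]expRK ler_ln ?posrE ?expR_gt0.
  rewrite -/(y e); nra.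
- rewrite -(sgn_avg_cst I (1 + 2 * eta)); apply: sgn_avg_le => e.
  apply: (@le_trans _ _ (expR eta)).
    rewrite ler_expR; have : ln (\sum_a p a * expR (y e a)) <= eta.
      by rewrite -[leRHS]expRK ler_ln ?posrE ?expR_gt0.
    rewrite -/(y e); nra.
  have : `|eta| <= 1 by rewrite ger0_norm//; lra.
  move=> /expR_taylor2; rewrite (ger0_norm eta0) ler_norml => /andP[_ h].
  have : eta ^+ 2 <= eta / 4 by rewrite expr2; nra.
  have : eta ^+ 3 <= eta ^+ 2 / 4 by rewrite exprS; nra.
  lra.
Qed.

Lemma sum_sqr_cov (I : finType) (c : A -> I -> R) (p : A -> R) :
  \sum_i (\sum_a p a * c a i) ^+ 2 = \sum_a \sum_b p a * p b * \sum_i c a i * c b i.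
Proof.
under eq_bigr do rewrite expr2 big_distrlr/=.
rewrite exchange_big/=; apply: eq_bigr => a _.
rewrite exchange_big/=; apply: eq_bigr => b _.
rewrite mulr_sumr; apply: eq_bigr => i _; ring.
Qed.

(* Gordon's comparison for a single step: [expR] of the log-sum is, to second
   order, the quadratic form [quad_avg], in which the covariance enters with the
   nonpositive coefficient [(k ^ 2 - k) / 2], so that the one unit of additional
   variance of [c2] contributes at least [(k * beta * s) ^ 2 / 2]. *)
Lemma walk_step_softmax : exists C : R, forall s : R, 0 < s -> s * C <= 1 ->
  forall X, walk_step s c1 softmax X <=
    expR (- ((k * beta * s) ^+ 2 / 2) + C * s ^+ 3) * walk_step s c2 softmax X.
Proof.
pose D := \sum_a (\sum_i `|c1 a i| + \sum_i `|c2 a i|).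
have D1 a : \sum_i `|c1 a i| <= D.
  rewrite /D (bigD1 a)//=; apply: (@le_trans _ _ (\sum_i `|c1 a i| + \sum_i `|c2 a i|)).
    by rewrite lerDl sumr_ge0.
  by rewrite lerDl sumr_ge0// => b _; rewrite addr_ge0// sumr_ge0.
have D2 a : \sum_i `|c2 a i| <= D.
  rewrite /D (bigD1 a)//=; apply: (@le_trans _ _ (\sum_i `|c1 a i| + \sum_i `|c2 a i|)).
    by rewrite lerDr sumr_ge0.
  by rewrite lerDl sumr_ge0// => b _; rewrite addr_ge0// sumr_ge0.
have D0 : 0 <= D by rewrite sumr_ge0// => b _; rewrite addr_ge0// sumr_ge0.
pose B := beta * D.
have B0 : 0 <= B by rewrite mulr_ge0// ltW.
pose a0 := (k * beta) ^+ 2 / 2.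
have a00 : 0 <= a0 by rewrite divr_ge0// sqr_ge0.
(* The term [4 * B] makes [beta * s * D] at most [1 / 4]. The other two are the relative errors:
   [300 + 300] from the two expansions and [2 * a0] from [Q2 <= 1 + 2 * eta], all doubled because
   [Q2] is only known to be at least [1 / 2]. *)
exists (4 * B + 4 * a0 * B + 1200 * B ^+ 3) => s s0 sC X.
pose Z := \sum_b expR (beta * X b).
pose p a := expR (beta * X a) / Z.
have Z0 : 0 < Z := sum_expR_gt0 X.
have p0 a : 0 <= p a by rewrite divr_ge0 ?expR_ge0// ltW.
have p1 : \sum_a p a = 1 by rewrite -mulr_suml mulfV// gt_eqF.
have B30 : 0 <= B ^+ 3 by rewrite exprn_ge0.
have bsD : beta * s * D <= 1 / 4.
  rewrite mulrAC -/B; have : 0 <= s * (4 * a0 * B + 1200 * B ^+ 3).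
    by apply: mulr_ge0; [exact: ltW|have := mulr_ge0 a00 B0; lra].
  lra.
have [q1 _ _] := sgn_avg_softmax p0 p1 s0 D1 bsD.
have [q2 q2l q2u] := sgn_avg_softmax p0 p1 s0 D2 bsD.
have stepE (I : finType) (c : A -> I -> R) : walk_step s c softmax X =
   softmax X * sgn_avg (fun e : {ffun I -> bool} =>
     expR (k * ln (\sum_a p a * expR (beta * (s * \sum_i c a i * (-1) ^+ e i))))).
  by rewrite /walk_step -sgn_avgZ; apply: sgn_avg_ext => e; rewrite softmax_shift.
rewrite !stepE [leRHS]mulrCA ler_wpM2l ?expR_ge0//.
set Q1 := sgn_avg _ in q1 *; set Q2 := sgn_avg _ in q2 q2l q2u *.
set eta := beta * s * D in bsD q1 q2 q2u.
have eta0 : 0 <= eta by rewrite !mulr_ge0// ltW.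
have [k0 k1] := andP k01.
have diff : quad_avg c1 p s + a0 * s ^+ 2 <= quad_avg c2 p s.
  rewrite /quad_avg !sum_sqr_cov.
  have -> : \sum_a p a * ((beta * s) ^+ 2 * \sum_i c2 a i ^+ 2) =
     \sum_a p a * ((beta * s) ^+ 2 * \sum_i c1 a i ^+ 2) + (beta * s) ^+ 2.
    rewrite -[X in _ = _ + X]mul1r -p1 mulr_suml -big_split/=.
    by apply: eq_bigr => a _; rewrite var_c; ring.
  set V := \sum_a p a * ((beta * s) ^+ 2 * _); set W1 := \sum_a \sum_b p a * p b * \sum_i c1 a i * c1 b i;
    set W2 := \sum_a \sum_b p a * p b * \sum_i c2 a i * c2 b i.
  have W : W2 <= W1 + 1.
    have -> : 1 = \sum_a \sum_b p a * p b :> R.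
      by rewrite -[LHS]mul1r -[in LHS]p1 big_distrlr.
    rewrite /W1 -big_split/=; apply: ler_sum => a _.
    rewrite -big_split/=; apply: ler_sum => b _.
    by have := cov_c a b; have := mulr_ge0 (p0 a) (p0 b); nra.
  have kk : (k ^+ 2 - k) / 2 <= 0 by nra.
  have bs2 : 0 <= (beta * s) ^+ 2 by exact: sqr_ge0.
  have -> : a0 * s ^+ 2 = k ^+ 2 / 2 * (beta * s) ^+ 2 by rewrite /a0; field.
  have : (k ^+ 2 - k) / 2 * ((beta * s) ^+ 2 * (W1 + 1)) <=
         (k ^+ 2 - k) / 2 * ((beta * s) ^+ 2 * W2).
    by rewrite ler_wnM2l// ler_wpM2l.
  lra.
have s2 : 0 <= s ^+ 2 by exact: sqr_ge0.
have main : Q1 <= Q2 * (1 - a0 * s ^+ 2 + (4 * a0 * (eta * s ^+ 2) + 1200 * eta ^+ 3)).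
  move: q1 q2; rewrite !ler_norml => /andP[_ q1] /andP[q2 _].
  have e3 : 0 <= eta ^+ 3 by rewrite exprn_ge0.
  have as2 : 0 <= a0 * s ^+ 2 by rewrite mulr_ge0.
  have := ler_wpM2l as2 q2u.
  have ee : 0 <= 4 * a0 * (eta * s ^+ 2) + 1200 * eta ^+ 3 by have := mulr_ge0 a00 (mulr_ge0 eta0 (sqr_ge0 s)); lra.
  have := ler_wpM2r ee q2l.
  lra.
apply: (le_trans main).
rewrite mulrC ler_wpM2r//; first lra.
have -> : eta = B * s by rewrite /eta /B; ring.
apply: le_trans (expR_ge1Dx _).
have -> : (k * beta * s) ^+ 2 / 2 = a0 * s ^+ 2 by rewrite /a0; field.
have : 0 <= B * s ^+ 3 by rewrite mulr_ge0// exprn_ge0// ltW.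
have : (B * s) ^+ 3 = B ^+ 3 * s ^+ 3 by ring.
have : B * s * s ^+ 2 = B * s ^+ 3 by ring.
move=> -> ->; lra.
Qed.

(* The steps along [c1] and [c2] commute, hence can be exchanged one by one. *)
Lemma iter_walk_step_softmax : exists C : R, forall s : R, 0 < s -> s * C <= 1 ->
  forall j X, iter j (walk_step s c1) softmax X <=
    expR (- ((k * beta * s) ^+ 2 / 2) + C * s ^+ 3) ^+ j
      * iter j (walk_step s c2) softmax X.
Proof.
have [C HC] := walk_step_softmax; exists C => s s0 sC; elim=> [|j IH] X.
  by rewrite expr0 mul1r.
set q := expR _ in IH *.
have q0 : 0 <= q by exact: expR_ge0.
rewrite iterS; apply: (le_trans (walk_step_le s c1 IH X)).
rewrite walk_stepZ exprSr -mulrA ler_wpM2l ?exprn_ge0//.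
rewrite iter_walk_stepC iterSr -iter_walk_stepZ.
by apply: iter_walk_step_le => Y; exact: HC.
Qed.

End Comparison.

(** * Walks with independent coordinates *)

Section Coordinates.
Variables (R : realType) (I : finType).

Definition delta_coef (i j : I) : R := (i == j)%:R.

Lemma sum_delta_coef (u : I -> R) i : \sum_j delta_coef i j * u j = u i.
Proof.
rewrite (bigD1 i)//= /delta_coef eqxx mul1r big1 ?addr0// => j ji.
by rewrite eq_sym (negbTE ji) mul0r.
Qed.

(** A correlated walk is the linear image of a walk whose coordinates move independently, and on the
    latter products of one-coordinate functions factorize. It also puts Gordon's processes and the
    matrix entries on the same sign space. *)
Lemma iter_walk_step_lin (A : Type) (s : R) (c : A -> I -> R) f k z :
  iter k (walk_step s c) f (fun a => \sum_i c a i * z i) =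
  iter k (walk_step s delta_coef) (fun z => f (fun a => \sum_i c a i * z i)) z.
Proof.
elim: k z => [//|k IH] z; rewrite !iterS; apply: sgn_avg_ext => e.
rewrite -IH; congr (iter _ _ _ _); apply/funext => a.
rewrite mulr_sumr -big_split/=; apply: eq_bigr => i _.
by rewrite sum_delta_coef; ring.
Qed.

Definition sign_step (s : R) (f : R -> R) (x : R) : R := (f (x - s) + f (x + s)) / 2.

Lemma walk_step_prod (s : R) (f : I -> R -> R) :
  walk_step s delta_coef (fun z => \prod_i f i (z i)) =
  (fun z => \prod_i sign_step s (f i) (z i)).
Proof.
apply/funext => z; pose g i (b : bool) := f i (z i + s * (-1) ^+ b).
transitivity (sgn_avg (fun e : {ffun I -> bool} => \prod_i g i (e i))).
  apply: sgn_avg_ext => e; apply: eq_bigr => i _; congr (f i (_ + _ * _)).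
  by rewrite sum_delta_coef.
rewrite sgn_avg_prod; apply: eq_bigr => i _.
by rewrite /g /sign_step expr0 expr1 mulrN1 mulr1.
Qed.

Lemma iter_walk_step_prod (s : R) (f : I -> R -> R) k :
  iter k (walk_step s delta_coef) (fun z => \prod_i f i (z i)) =
  (fun z => \prod_i iter k (sign_step s) (f i) (z i)).
Proof.
by elim: k => [//|k IH]; rewrite iterS IH (walk_step_prod s (fun i => iter k (sign_step s) (f i))).
Qed.

Lemma iter_walk_step_sum (A : Type) (s : R) (c : A -> I -> R) (T : Type) (r : seq T)
    (F : T -> (A -> R) -> R) k X :
  iter k (walk_step s c) (fun X => \sum_(t <- r) F t X) X =
  \sum_(t <- r) iter k (walk_step s c) (F t) X.
Proof.
elim: k X => [//|k IH] X; rewrite iterS -sgn_avg_sum.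
by apply: sgn_avg_ext => e; rewrite IH.
Qed.

End Coordinates.

(* The moments of a standard Gaussian. *)
Fixpoint gmom (k : nat) : nat :=
  match k with 0 => 1 | 1 => 0 | k'.+2 => k'.+1 * gmom k' end%N.

Lemma gmom_odd k : odd k -> gmom k = 0%N.
Proof.
elim/ltn_ind: k => -[//|[//|k]] IH /=; rewrite negbK => ok.
by rewrite IH ?muln0// ltnS.
Qed.

(** * Moments of one-dimensional sign walks *)

Section SignStep.
Variable R : realType.
Implicit Types (s x c : R).

Lemma sign_step_le s f g : (forall x, f x <= g x) -> forall x, sign_step s f x <= sign_step s g x.
Proof. by move=> fg x; rewrite ler_wpM2r// lerD. Qed.

Lemma iter_sign_step_sum s (T : Type) (r : seq T) (F : T -> R -> R) k x :
  iter k (sign_step s) (fun x => \sum_(t <- r) F t x) x =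
  \sum_(t <- r) iter k (sign_step s) (F t) x.
Proof.
elim: k x => [//|k IH] x; rewrite iterS /sign_step !IH -big_split/= mulr_suml.
by [].
Qed.

Lemma iter_sign_stepZ s a F k x :
  iter k (sign_step s) (fun x => a * F x) x = a * iter k (sign_step s) F x.
Proof.
elim: k x => [//|k IH] x; rewrite !iterS /sign_step !IH; ring.
Qed.

Lemma cosh_series_cvg x :
  (\sum_(0 <= p < n) x ^+ (2 * p) / (2 * p)`!%:R) @[n --> \oo] --> (expR x + expR (- x)) / 2.
Proof.
have cv y := @expR_series_cvg R y.
have c2 (y : R) : (\sum_(0 <= i < n.*2) y ^+ i / i`!%:R) @[n --> \oo] --> expR y.
  apply: (cvg_comp (fun n => n.*2) _ _ (cv y)).
  by move=> A [N _ HN]; exists N => //= n /= Nn; apply: HN => /=; lia.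
have h : ((\sum_(0 <= i < n.*2) x ^+ i / i`!%:R + \sum_(0 <= i < n.*2) (- x) ^+ i / i`!%:R)
    * 2^-1) @[n --> \oo] --> (expR x + expR (- x)) / 2.
  by apply: cvgM; [apply: cvgD; exact: c2 | exact: cvg_cst].
move: h; apply: cvg_trans; apply: near_eq_cvg; apply: nearW => n.
elim: n => [|n IH]; first by rewrite !big_geq ?addr0 ?mul0r.
rewrite doubleS !big_nat_recr//= -IH -muln2 mulnC !exprS !exprM !sqrrN.
set A := \sum_(_ <= _ < _) _; set B := \sum_(_ <= _ < _) _.
move: ((2 * n)`!%:R^-1) ((2 * n).+1`!%:R^-1) => u v; by field.
Qed.

Lemma cosh_series_le x n :
  \sum_(0 <= p < n) x ^+ (2 * p) / (2 * p)`!%:R <= (expR x + expR (- x)) / 2.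
Proof.
have cv := @cosh_series_cvg x; rewrite -(cvg_lim _ cv)//.
apply: nondecreasing_cvgn_le; last by apply/cvg_ex; eexists; exact: cv.
apply/nondecreasing_seqP => k; rewrite big_nat_recr//= lerDl.
by rewrite divr_ge0// exprM exprn_ge0// sqr_ge0.
Qed.

(** The power series compare term by term, because [2 ^ p * p! <= (2 * p)!]. *)
Lemma cosh_le_expR x : (expR x + expR (- x)) / 2 <= expR (x ^+ 2 / 2).
Proof.
have c1 := @cosh_series_cvg x; have c2 := @expR_series_cvg R (x ^+ 2 / 2).
rewrite -(cvg_lim _ c1)// -(cvg_lim _ c2)//.
apply: ler_lim; [by apply/cvg_ex; eexists; exact: c1|by apply/cvg_ex; eexists; exact: c2|].
near=> n; apply: ler_sum => p _; rewrite expr_div_n -exprM -mulrA ler_wpM2l//.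
  by rewrite exprM exprn_ge0// sqr_ge0.
rewrite -invfM lef_pV2 ?posrE ?mulr_gt0 ?exprn_gt0 ?ltr0n ?fact_gt0//.
rewrite -natrX -natrM ler_nat; elim: p => [//|p IH].
rewrite expnS mulnS 2!addSn add0n !factS; nia.
Unshelve. all: by end_near. Qed.

(** Expanding the two squares leaves the factor [cosh (2 * c * x * s)], which is replaced by its
    Gaussian bound. *)
Lemma sign_step_expR_sqr s c x : 0 <= c ->
  sign_step s (fun x => expR (c * x ^+ 2)) x <=
  expR (c * s ^+ 2) * expR ((c + 2 * c ^+ 2 * s ^+ 2) * x ^+ 2).
Proof.
move=> c0; rewrite /sign_step.
have -> : c * (x - s) ^+ 2 = c * x ^+ 2 + c * s ^+ 2 + - (2 * c * x * s) by ring.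
have -> : c * (x + s) ^+ 2 = c * x ^+ 2 + c * s ^+ 2 + 2 * c * x * s by ring.
set u := 2 * c * x * s.
have -> : (c + 2 * c ^+ 2 * s ^+ 2) * x ^+ 2 = c * x ^+ 2 + u ^+ 2 / 2 by rewrite /u; field.
rewrite !expRD; set E1 := expR (c * _); set E2 := expR (c * _).
have -> : (E1 * E2 * expR (- u) + E1 * E2 * expR u) / 2 =
  E2 * (E1 * ((expR u + expR (- u)) / 2)) by field.
by rewrite !ler_wpM2l ?expR_ge0// cosh_le_expR.
Qed.

(* Solving the recursion [c' = c + 2 c^2 s^2] along the walk: after [j] steps the
   exponent is at most [c / (1 - 2 c s^2 j)], as for a Gaussian of variance [s^2 j]. *)
Lemma iter_sign_step_expR_sqr s c j x : 0 <= c -> 2 * c * s ^+ 2 * j%:R < 1 ->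
  iter j (sign_step s) (fun x => expR (c * x ^+ 2)) x <=
  (Num.sqrt (1 - 2 * c * s ^+ 2 * j%:R))^-1 *
    expR (c / (1 - 2 * c * s ^+ 2 * j%:R) * x ^+ 2).
Proof.
move=> c0; elim: j x => [|j IH] x; first by rewrite /= !mulr0 !subr0 sqrtr1 invr1 mul1r mulr1.
move=> cj.
set w := 2 * c * s ^+ 2 in IH cj *.
have w0 : 0 <= w by rewrite /w mulr_ge0 ?sqr_ge0// mulr_ge0.
set D := 1 - w * j%:R in IH *.
have DE : 1 - w * j.+1%:R = D - w by rewrite /D -addn1 natrD; ring.
rewrite DE.
have D' : 0 < D - w by rewrite -DE subr_gt0.
have D0 : 0 < D by lra.
have IH' : w * j%:R < 1 by rewrite -subr_gt0.
rewrite iterS; apply: (le_trans (sign_step_le s (fun y => IH y IH') x)).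
rewrite /sign_step -mulrDr -mulrA.
have cD0 : 0 <= c / D by rewrite divr_ge0// ltW.
have := sign_step_expR_sqr s x cD0; rewrite /sign_step => h.
have sD0 : 0 <= (Num.sqrt D)^-1 by rewrite invr_ge0 sqrtr_ge0.
apply: (le_trans (ler_wpM2l sD0 h)); rewrite mulrA ler_pM ?mulr_ge0 ?expR_ge0//; last first.
  rewrite ler_expR ler_wpM2r ?sqr_ge0//.
  have -> : c / D + 2 * (c / D) ^+ 2 * s ^+ 2 = c * ((D + w) / D ^+ 2).
    by rewrite /w; field; rewrite gt_eqF.
  rewrite ler_wpM2l// ler_pdivrMr ?exprn_gt0// mulrC ler_pdivlMr//; nra.
rewrite mulrC ler_pdivrMr ?sqrtr_gt0//.
have -> : (Num.sqrt (D - w))^-1 * Num.sqrt D = Num.sqrt (D / (D - w)).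
  by rewrite sqrtrM ?ltW// sqrtrV ?ltW// mulrC.
have -> : expR (c / D * s ^+ 2) = Num.sqrt (expR (w / D)).
  have -> : w / D = c / D * s ^+ 2 *+ 2 by rewrite /w; ring.
  by rewrite -mulr_natl expRM_natl sqrtr_sqr ger0_norm ?expR_ge0.
rewrite ler_wsqrtr//.
(* After squaring, the prefactors compare through [expR (w / D) <= (1 - w / D)^-1]. *)
have := expR_ge1Dx (- (w / D)); rewrite expRN => h1.
have p1 : 0 < 1 - w / D by rewrite subr_gt0 ltr_pdivrMr// mul1r; lra.
have -> : D / (D - w) = (1 - w / D)^-1.
  by field; rewrite !gt_eqF//=.
by rewrite -[leLHS]invrK lef_pV2 ?posrE ?invr_gt0 ?expR_gt0.
Qed.

Lemma sign_stepX s k x : sign_step s (fun x => x ^+ k) x =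
  \sum_(i < k.+1) (~~ odd i)%:R * 'C(k, i)%:R * s ^+ i * x ^+ (k - i).
Proof.
rewrite /sign_step exprBn exprDn -big_split/= mulr_suml; apply: eq_bigr => i _.
rewrite -signr_odd; set X := x ^+ _; set S := s ^+ _.
rewrite -[_ *+ _ + _]/(_ *+ 'C(k, i) + _ *+ 'C(k, i)).
rewrite -[in LHS](mulr_natl (_ * _)) -[X in _ + X](mulr_natl (X * S)).
by case: (odd i) => /=; rewrite ?expr0 ?expr1; field.
Qed.

(** The right-hand count keeps only the terms in which every step of the walk occurs zero or two
    times: [gmom k] pairings of the factors, whose pairs are assigned distinct steps in [j ^_ k./2]
    ways. All discarded terms are nonnegative. In the induction on [j] this means keeping the terms
    0 and 2 of the binomial expansion. *)
Lemma iter_sign_stepX s k j : 0 <= s ->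
  0 <= iter j (sign_step s) (fun x => x ^+ k) 0 /\
  (gmom k)%:R * s ^+ k * (j ^_ k./2)%:R <= iter j (sign_step s) (fun x => x ^+ k) 0.
Proof.
move=> s0; elim: j k => [|j IH] k.
  split; first by rewrite /= expr0n.
  case: k => [|[|k]]/=; first by rewrite ffactn0 !expr0 !mulr1.
    by rewrite !mul0r expr1.
  by rewrite ffact0n mulr0 expr0n.
rewrite iterSr.
have -> : sign_step s (fun x => x ^+ k) = fun x =>
   \sum_(i < k.+1) (~~ odd i)%:R * 'C(k, i)%:R * s ^+ i * x ^+ (k - i).
  by apply/funext => x; exact: sign_stepX.
rewrite iter_sign_step_sum.
under eq_bigr do rewrite iter_sign_stepZ.
have pos i : 0 <= (~~ odd i)%:R * 'C(k, i)%:R * s ^+ i *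
     iter j (sign_step s) (fun x => x ^+ (k - i)) 0.
  by rewrite !mulr_ge0 ?exprn_ge0 ?ler0n//; case: (IH (k - i)%N).
split; first by apply: sumr_ge0.
case: k pos => [|[|k]] pos.
- by rewrite big_ord1 /= !ffactn0 !expr0 !mulr1 !mul1r; have [_] := IH 0%N; rewrite /= ffactn0 !expr0 !mulr1.
- by rewrite !mul0r sumr_ge0.
- rewrite (bigD1 ord0)//= (bigD1 (inord 2))/=; last by rewrite -val_eqE/= inordK.
  rewrite inordK// addrA -[leLHS]addr0 lerD ?sumr_ge0//.
  rewrite bin0 expr0 subn0 subSS subSS subn0 !mul1r.
  have [_ h2] := IH k.+2; have [_ h0] := IH k.
  apply: (@le_trans _ _ ((gmom k.+2)%:R * s ^+ k.+2 * (j ^_ k.+2./2)%:R +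
      'C(k.+2, 2)%:R * s ^+ 2 * ((gmom k)%:R * s ^+ k * (j ^_ k./2)%:R))); last first.
    by rewrite lerD// ler_wpM2l// mulr_ge0// exprn_ge0.
  case ok: (odd k); first by rewrite /= gmom_odd// muln0 !mul0r mulr0 addr0.
  have kE : k = (k./2).*2 by rewrite -[LHS]odd_double_half ok.
  (* With [q = k./2], this combines [(j + 1) ^_ (q + 1) = j ^_ (q + 1) + (q + 1) * j ^_ q] with
     ['C(k + 2, 2) = (k + 1) * (q + 1)] for even [k]. *)
  have : ((k.+1 * gmom k) * j.+1 ^_ k./2.+1 =
          (k.+1 * gmom k) * j ^_ k./2.+1 + 'C(k.+2, 2) * (gmom k * j ^_ k./2))%N.
    have -> : 'C(k.+2, 2) = (k.+1 * k./2.+1)%N.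
      rewrite bin2; have -> : (k.+2 * k.+2.-1 = (k.+1 * k./2.+1).*2)%N.
        by rewrite -muln2 mulnC -mulnA; congr (_ * _)%N; lia.
      by rewrite doubleK.
    rewrite ffactSS ffactnSr; have [jq|jq] := ltnP j k./2.
      by rewrite ffact_small// !muln0.
    have -> : j.+1 = ((j - k./2) + k./2.+1)%N by lia.
    nia.
  move=> /(congr1 (fun n => n%:R * s ^+ k.+2 : R)).
  rewrite /= natrD !natrM => h.
  have e : s ^+ k.+2 = s ^+ 2 * s ^+ k by rewrite -exprD.
  move: h; rewrite e => h; lra.
Qed.

End SignStep.

(** * Pairings and closed walks *)

Section Pairings.

(** The recursive call is on [rem b l'], which is not a structural subterm, hence the fuel; any fuel
    at least [size l] yields all pairings. Pairing the head first makes the first component the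
    earlier step in a sorted list. *)
Fixpoint pairings (fuel : nat) (l : seq nat) : seq (seq (nat * nat)) :=
  match fuel, l with
  | _, [::] => [:: [::]]
  | 0, _ :: _ => [::]
  | fuel'.+1, a :: l' =>
      flatten [seq [seq (a, b) :: q | q <- pairings fuel' (rem b l')] | b <- l']
  end.

Lemma pairings_cons fuel a l q : q \in pairings fuel.+1 (a :: l) ->
  exists b q', [/\ b \in l, q = (a, b) :: q' & q' \in pairings fuel (rem b l)].
Proof.
by move=> /flatten_mapP[b bl /mapP[q' q'P ->]]; exists b, q'.
Qed.

Lemma pairings_perm fuel l q : q \in pairings fuel l ->
  perm_eq (map fst q ++ map snd q) l.
Proof.
elim: fuel l q => [|fuel IH] [|a l] q; rewrite ?inE; try by move=> /eqP ->.
  by [].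
move=> /pairings_cons[b [q' [bl -> /IH h]]] /=.
rewrite perm_cons -cat1s perm_catCA /= (permPr (perm_to_rem bl)).
by rewrite perm_cons.
Qed.

Lemma pairings_lt fuel l q : sorted ltn l -> q \in pairings fuel l ->
  forall a b, (a, b) \in q -> (a < b)%N.
Proof.
elim: fuel l q => [|fuel IH] [|a l] q sl; rewrite ?inE; try by move=> /eqP ->.
  by [].
move=> /pairings_cons[b [q' [bl -> h]]] c d; rewrite inE => /orP[/eqP[-> ->]|cd].
  have := sl; rewrite /= (path_sortedE ltn_trans) => /andP[/allP al _].
  exact: al.
apply: IH h c d cd; apply: (subseq_sorted ltn_trans (rem_subseq b l)).
by move: sl => /= /path_sorted.
Qed.

(* Wick's formula: the left-hand side counts the pairings of [l] that respect
   the colouring [e]. *)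
Lemma prod_gmom_pairings (C : finType) (e : nat -> C) fuel l :
  uniq l -> (size l <= fuel)%N ->
  (\sum_(q <- pairings fuel l) \prod_(ab <- q) (e ab.1 == e ab.2) =
   \prod_(c : C) gmom (count (fun a => e a == c) l))%N.
Proof.
elim: fuel l => [|fuel IH] [|a l] // ul sl.
- by rewrite big_seq1 big_nil big1.
- by rewrite big_seq1 big_nil big1.
move: ul => /= /andP[al ul].
rewrite big_flatten/= big_map.
under eq_bigr => b _ do (rewrite big_map; under eq_bigr do rewrite big_cons /=).
under eq_bigr => b _ do rewrite -big_distrr/=.
rewrite big_seq (eq_bigr (fun b => (e a == e b) *
   \prod_(c : C) gmom (count (fun a0 => e a0 == c) (rem b l))))%N; last first.
  move=> b bl; rewrite IH ?rem_uniq// size_rem//.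
  by case: (l) bl sl => [//|? ?] _ /=; lia.
rewrite -big_seq [RHS](bigD1 (e a))//= eqxx add1n.
set k := count (fun a0 => e a0 == e a) l.
(* The recursion of the Gaussian moments counts the [k] possible partners of [a] of the same colour;
   removing one of them leaves [k.-1] elements of that colour. *)
have -> : (gmom k.+1 = k * gmom k.-1)%N by case: k.
under [in RHS]eq_bigr => c ca do rewrite eq_sym (negbTE ca) add0n.
rewrite -mulnA /k -sum1_count big_distrl/= [RHS]big_mkcond/=.
rewrite big_seq [RHS]big_seq; apply: eq_bigr => b bl.
rewrite eq_sym; case: eqP => [ba|_]; rewrite ?mul1n// ?mul0n//.
rewrite (bigD1 (e a))//=; congr (gmom _ * _)%N.
  by rewrite count_rem bl ba eqxx /= subn1 sum1_count.
by apply: eq_bigr => c ca; rewrite count_rem bl ba eq_sym (negbTE ca) subn0.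
Qed.

End Pairings.

Section SeqSum.
Variables (R : realDomainType) (V : finType).

(** The last vertex is the innermost summation variable, so that a walk can be summed out step by
    step with its past held fixed. *)
Fixpoint seq_sum (L : nat) (F : seq V -> R) : R :=
  match L with
  | 0 => F [::]
  | L'.+1 => seq_sum L' (fun s => \sum_v F (rcons s v))
  end.

Lemma seq_sum_le L F G : (forall s, size s = L -> F s <= G s) ->
  seq_sum L F <= seq_sum L G.
Proof.
elim: L F G => [|L IH] F G FG /=; first exact: FG.
by apply: IH => s sL; apply: ler_sum => v _; apply: FG; rewrite size_rcons sL.
Qed.

Lemma seq_sum_ge0 L F : (forall s, 0 <= F s) -> 0 <= seq_sum L F.
Proof.
elim: L F => [|L IH] F F0 /=; first exact: F0.
by apply: IH => s; apply: sumr_ge0.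
Qed.

Lemma seq_sum_ext L F G : (forall s, size s = L -> F s = G s) ->
  seq_sum L F = seq_sum L G.
Proof.
elim: L F G => [|L IH] F G FG /=; first exact: FG.
by apply: IH => s sL; apply: eq_bigr => v _; apply: FG; rewrite size_rcons sL.
Qed.

Lemma seq_sum_sum (T : Type) (r : seq T) L (F : T -> seq V -> R) :
  seq_sum L (fun s => \sum_(t <- r) F t s) = \sum_(t <- r) seq_sum L (F t).
Proof.
elim: L F => [//|L IH] F /=; rewrite -IH; apply: seq_sum_ext => s _.
by rewrite exchange_big.
Qed.

Lemma seq_sumZ L c F : seq_sum L (fun s => c * F s) = c * seq_sum L F.
Proof.
elim: L F => [//|L IH] F /=; rewrite -IH; apply: seq_sum_ext => s _.
by rewrite mulr_sumr.
Qed.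

End SeqSum.

(* The [a]-th step of a bipartite walk [w 0, w 1, ...] started at a row vertex;
   edges are oriented from rows (even positions) to columns (odd positions). *)
Definition row_pos (a : nat) : nat := (a + odd a)%N.
Definition col_pos (a : nat) : nat := (a + ~~ odd a)%N.

Lemma row_pos_le a : (row_pos a <= a.+1)%N. Proof. rewrite /row_pos; case: (odd a); lia. Qed.
Lemma col_pos_le a : (col_pos a <= a.+1)%N. Proof. rewrite /col_pos; case: (odd a); lia. Qed.
Lemma odd_row_pos a : odd (row_pos a) = false.
Proof. by rewrite /row_pos oddD; case E: (odd a). Qed.
Lemma odd_col_pos a : odd (col_pos a) = true.
Proof. by rewrite /col_pos oddD; case E: (odd a). Qed.

(** * Vertex classes forced by a pairing *)

Section Classes.
Variables (L : nat) (q : seq (nat * nat)).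
Hypotheses (oddL : ~~ odd L)
  (q_perm : perm_eq (map fst q ++ map snd q) (iota 0 L))
  (q_lt : forall a b, (a, b) \in q -> (a < b)%N).

Definition respects (T : Type) (w : nat -> T) : Prop :=
  w 0%N = w L /\ forall a b, (a, b) \in q ->
    w (row_pos a) = w (row_pos b) /\ w (col_pos a) = w (col_pos b).

(* The positions of a walk that the pairing [q] forces to be the same vertex;
   boolean-valued walks are enough to detect this. *)
Definition glued (c d : nat) : Prop :=
  forall w : nat -> bool, respects w -> w c = w d.

(** The least member of the class of [c], that is, the time at which the vertex at position [c] is
    discovered; [c] itself witnesses that the class is nonempty. *)
Definition first_glued (c : nat) : nat :=
  ex_minn (ex_intro (fun d => `[< glued d c >]) c (asboolT (fun w _ => erefl (w c)))).

Lemma first_gluedP c : glued (first_glued c) c /\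
  forall d, glued d c -> (first_glued c <= d)%N.
Proof.
rewrite /first_glued; case: ex_minnP => d /asboolP dc dmin; split => // k kc.
by apply: dmin; apply/asboolP.
Qed.

Lemma first_glued_le c : (first_glued c <= c)%N.
Proof. by apply: (first_gluedP c).2. Qed.

Lemma first_glued_eq c d : glued c d -> first_glued c = first_glued d.
Proof.
move=> cd; have [c1 c2] := first_gluedP c; have [d1 d2] := first_gluedP d.
apply/eqP; rewrite eqn_leq; apply/andP; split.
  by apply: c2 => w rw; rewrite d1// cd.
by apply: d2 => w rw; rewrite c1// cd.
Qed.

(** The parity of the position is itself a boolean walk respecting the pairing, so a row is never
    glued to a column. *)
Lemma odd_first_glued c : odd (first_glued c) = odd c.
Proof.
apply: (first_gluedP c).1; split=> [|a b _]; first by rewrite (negbTE oddL).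
by rewrite !odd_row_pos !odd_col_pos.
Qed.

(** Boolean walks suffice for arbitrary vertices: the test [w d == w c], as a function of [d], is a
    boolean walk that still respects the pairing. *)
Lemma respects_first_glued (T : eqType) (w : nat -> T) c :
  respects w -> w (first_glued c) = w c.
Proof.
move=> [w0 wq].
have e : (w (first_glued c) == w c) = (w c == w c).
  apply: ((first_gluedP c).1 (fun d => w d == w c)); split; first by rewrite w0.
  by move=> a b /wq[-> ->].
by apply/eqP; rewrite e.
Qed.

Lemma q_lt_size a b : (a, b) \in q -> (a < L)%N /\ (b < L)%N.
Proof.
move=> ab; have mem c : c \in map fst q ++ map snd q -> (c < L)%N.
  by rewrite (perm_mem q_perm) mem_iota add0n.
split; apply: mem; rewrite mem_cat.
  by apply/orP; left; apply/mapP; exists (a, b).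
by apply/orP; right; apply/mapP; exists (a, b).
Qed.

Lemma first_glued_respects (T : Type) (w : nat -> T) :
  (forall c, (c <= L)%N -> w (first_glued c) = w c) -> respects w.
Proof.
move=> wf; split=> [|a b ab].
  by rewrite -(wf 0%N)// -(wf L)// (@first_glued_eq 0%N L)// => v [].
have [aL bL] := q_lt_size ab.
have ra := leq_trans (row_pos_le a) aL; have rb := leq_trans (row_pos_le b) bL.
have ca := leq_trans (col_pos_le a) aL; have cb := leq_trans (col_pos_le b) bL.
rewrite -(wf _ ra) -(wf _ rb) -(wf _ ca) -(wf _ cb).
rewrite (@first_glued_eq (row_pos a) (row_pos b)); last by move=> v [_ /(_ _ _ ab)[]].
by rewrite (@first_glued_eq (col_pos a) (col_pos b))// => v [_ /(_ _ _ ab)[]].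
Qed.

(* A vertex class can only be discovered by the first step of a pair: the second
   step of a pair retraces an edge. *)
Lemma new_not_snd a : first_glued a.+1 = a.+1 -> a \notin map snd q.
Proof.
move=> na; apply/negP => /mapP[[b a'] ba /= aa']; rewrite -aa' in ba.
have ltba := q_lt ba.
have [c cb ca] : exists2 c, (c <= b.+1)%N & glued c a.+1.
  case oa: (odd a).
    exists (row_pos b); first exact: row_pos_le.
    by move=> w [_ /(_ _ _ ba)[-> _]]; rewrite /row_pos oa addn1.
  exists (col_pos b); first exact: col_pos_le.
  by move=> w [_ /(_ _ _ ba)[_ ->]]; rewrite /col_pos oa addn1.
by have := (first_gluedP a.+1).2 _ ca; rewrite na; lia.
Qed.

Definition is_new (a : nat) : bool := first_glued a.+1 == a.+1.

(** The two steps of a pair carry equal weights and together give a square. Second steps are never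
    new, and the squares of pairs whose first step is not new are bounded by 1. *)
Lemma prod_pairs_le (R : realDomainType) (B : nat -> R) :
  (forall a, 0 <= B a <= 1) -> (forall a b, (a, b) \in q -> B a = B b) ->
  \prod_(a <- iota 0 L) B a <= \prod_(a <- iota 0 L | is_new a) B a ^+ 2.
Proof.
move=> B01 Bq.
rewrite -!(perm_big _ q_perm)/= !big_cat/= !big_map.
have -> : \prod_(i <- q | is_new i.2) B i.2 ^+ 2 = 1.
  rewrite big_seq_cond big_pred0// => -[a b] /=; apply/negbTE/negP => /andP[ab /eqP nb].
  by have := new_not_snd nb => /negP; apply; apply/mapP; exists (a, b).
rewrite mulr1 -big_split/= [leRHS]big_mkcond/= big_seq [leRHS]big_seq.
apply: ler_prod => -[a b] /= ab; rewrite -(Bq _ _ ab).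
have /andP[B0 B1] := B01 a; rewrite mulr_ge0//=.
by case: ifP => _; rewrite ?expr2// -[leRHS]mulr1 ler_pM.
Qed.

End Classes.

(** * Comparison of weighted walks with walks in the complete bipartite graph *)

Section Compare.
Variables (R : realDomainType).

Section WalkSum.
Variables (V : finType) (B : V -> V -> R).

Definition walk_edge (u : V) (s : seq V) (a : nat) : V * V :=
  (nth u (u :: s) (row_pos a), nth u (u :: s) (col_pos a)).

(* The mixed moment of independent standard Gaussians along the closed walk that
   starts at [u] and continues with [s]. *)
Definition wick_weight (p : nat) (u : V) (s : seq V) : nat :=
  \prod_(c : V * V) gmom (count_mem c (map (walk_edge u s) (iota 0 (2 * p)))).

Definition wick_walks (p : nat) (u : V) : R :=
  seq_sum (2 * p) (fun s => (last u s == u)%:R *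
    \prod_(a <- iota 0 (2 * p)) B (walk_edge u s a).1 (walk_edge u s a).2 *
    (wick_weight p u s)%:R).

Definition pair_walks (p : nat) (u : V) (q : seq (nat * nat)) : R :=
  seq_sum (2 * p) (fun s => (last u s == u)%:R *
    \prod_(a <- iota 0 (2 * p)) B (walk_edge u s a).1 (walk_edge u s a).2 *
    \prod_(ab <- q) (walk_edge u s ab.1 == walk_edge u s ab.2)%:R).

Lemma wick_walksE p u : wick_walks p u =
  \sum_(q <- pairings (2 * p) (iota 0 (2 * p))) pair_walks p u q.
Proof.
rewrite -seq_sum_sum; apply: seq_sum_ext => s _; rewrite -mulr_sumr; congr (_ * _).
rewrite /wick_weight; under eq_bigr do rewrite count_map.
rewrite -(@prod_gmom_pairings _ (walk_edge u s) (2 * p) _ (iota_uniq 0 (2 * p))) ?size_iota//.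
by rewrite natr_sum; apply: eq_bigr => q _; rewrite natr_prod.
Qed.

End WalkSum.

(** The weights of the standard Gaussian matrix. They vanish from columns to rows because
    [walk_edge] lists the row endpoint first in both directions of travel. *)
Definition complete_bip (N M : nat) (u v : 'I_N + 'I_M) : R :=
  if u is inl _ then (if v is inr _ then 1 else 0) else 0.

Section Fixed.
Variables (p : nat) (q : seq (nat * nat)).
Let L := (2 * p)%N.
Hypotheses (q_perm : perm_eq (map fst q ++ map snd q) (iota 0 L))
  (q_lt : forall a b, (a, b) \in q -> (a < b)%N).
Variables (N M : nat).

Let oddL : ~~ odd L. Proof. by rewrite /L oddM. Qed.

Let rho := first_glued L q.
Let isnew := is_new L q.

(* The cost of the step [a]: only the discovery of a new vertex is charged. *)
Let D (a : nat) : R := if isnew a then (if odd a then N%:R else M%:R) else 1.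

Lemma nth_rcons_lt (V : eqType) (u : V) (s : seq V) v c : (c <= size s)%N ->
  nth u (u :: rcons s v) c = nth u (u :: s) c.
Proof. by case: c => [//|c] cs /=; rewrite nth_rcons cs. Qed.

Lemma nth_rcons_size (V : eqType) (u : V) (s : seq V) v :
  nth u (u :: rcons s v) (size s).+1 = v.
Proof. by rewrite /= nth_rcons ltnn eqxx. Qed.

(** The summand is dominated by one factor [g] per step: the squared weight at a discovery, and
    otherwise the indicator that the walk returns to the representative of its class. A discovery
    then costs a row or column sum, a return leaves a single choice. *)
Lemma pair_walks_le (V : finType) (B : V -> V -> R) (u : V) :
  (forall x y, 0 <= B x y <= 1) ->
  (forall x, \sum_y B x y ^+ 2 <= M%:R) -> (forall y, \sum_x B x y ^+ 2 <= N%:R) ->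
  pair_walks B p u q <= \prod_(a <- iota 0 L) D a.
Proof.
move=> B01 BM BN.
pose g (s : seq V) a : R := if isnew a then
    B (walk_edge u s a).1 (walk_edge u s a).2 ^+ 2
  else (nth u (u :: s) a.+1 == nth u (u :: s) (rho a.+1))%:R.
have g0 s a : 0 <= g s a by rewrite /g; case: ifP => _; rewrite ?sqr_ge0.
apply: (@le_trans _ _ (seq_sum L (fun s => \prod_(a <- iota 0 L) g s a))).
  apply: seq_sum_le => s sL.
  have gge0 : 0 <= \prod_(a <- iota 0 L) g s a by apply: prodr_ge0.
  case: eqP => [lu|_]; last by rewrite !mul0r.
  rewrite mul1r.
  have [/allP allq|] := boolP (all (fun ab => walk_edge u s ab.1 == walk_edge u s ab.2) q);
    last first.
    by move=> /allPn[ab abq /negbTE ne]; rewrite (big_rem ab)//= ne mul0r mulr0.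
  rewrite [X in _ * X]big1_seq ?mulr1; last by move=> ab /andP[_ /allq ->].
  have wq : respects L q (nth u (u :: s)).
    split; first by rewrite -[L]/(2 * p)%N -sL -last_nth lu.
    by move=> a b /allq /eqP[].
  pose bb a := B (walk_edge u s a).1 (walk_edge u s a).2.
  have bb01 a : 0 <= bb a <= 1 by exact: B01.
  have bbq a b : (a, b) \in q -> bb a = bb b by move=> /allq /eqP /= e; rewrite /bb e.
  apply: (le_trans (prod_pairs_le oddL q_perm q_lt bb01 bbq)).
  rewrite [leLHS]big_mkcond/=; apply: ler_prod => a _; rewrite /g -/(isnew a).
  case: ifP => _; rewrite ?sqr_ge0//= ?lexx// ler01/=.
  by rewrite (respects_first_glued _ wq) eqxx.
(* The number [k] of summed steps varies while the classes stay those of the full length [L]. The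
   last vertex is summed first; earlier factors only look at positions up to [k]. *)
suff gen k : seq_sum k (fun s => \prod_(a <- iota 0 k) g s a) <= \prod_(a <- iota 0 k) D a.
  exact: gen.
elim: k => [|k IH].
  by rewrite /= !big_nil.
rewrite -[k.+1]addn1 iotaD !big_cat/= !big_seq1 add0n.
apply: (@le_trans _ _ (seq_sum k (fun s => D k * \prod_(a <- iota 0 k) g s a))); last first.
  rewrite seq_sumZ mulrC ler_wpM2r ?IH// /D.
  by case: ifP => // _; case: ifP.
rewrite addn1 /=; apply: seq_sum_le => s sk.
under eq_bigr do rewrite big_cat/= big_seq1.
have eg v a : (a < k)%N -> g (rcons s v) a = g s a.
  move=> ak.
  have le c : (c <= a.+1)%N -> nth u (u :: rcons s v) c = nth u (u :: s) c.
    by move=> ca; rewrite nth_rcons_lt// sk (leq_trans ca).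
  by rewrite /g /walk_edge !le ?first_glued_le ?row_pos_le ?col_pos_le.
have -> : \sum_v (\prod_(a <- iota 0 k) g (rcons s v) a * g (rcons s v) k) =
  \prod_(a <- iota 0 k) g s a * \sum_v g (rcons s v) k.
  rewrite mulr_sumr; apply: eq_bigr => v _; congr (_ * _).
  rewrite big_seq [RHS]big_seq; apply: eq_bigr => a; rewrite mem_iota => /andP[_ ak].
  exact: eg.
rewrite mulrC ler_wpM2r ?prodr_ge0// /D /g.
case: ifP => [_|nk].
  case ok: (odd k).
    rewrite (eq_bigr (fun v => B v (nth u (u :: s) k) ^+ 2)) ?BN// => v _.
    rewrite /walk_edge /row_pos /col_pos ok /= addn1 addn0 -{1}sk nth_rcons_size.
    by rewrite -sk nth_rcons_lt.
  rewrite (eq_bigr (fun v => B (nth u (u :: s) k) v ^+ 2)) ?BM// => v _.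
  rewrite /walk_edge /row_pos /col_pos ok /= addn1 addn0 -{2}sk nth_rcons_size.
  by rewrite -sk nth_rcons_lt.
have rk : (rho k.+1 <= size s)%N.
  by have := first_glued_le L q k.+1; move: nk; rewrite /isnew /is_new sk -/rho; lia.
under eq_bigr do rewrite -{1}sk nth_rcons_size nth_rcons_lt//.
rewrite (bigD1 (nth u (u :: s) (rho k.+1)))//= eqxx big1 ?addr0// => v /negbTE -> //.
Qed.

Hypothesis N0 : (0 < N)%N.
Let V' := ('I_N + 'I_M)%type.
Let u0 : V' := inl (Ordinal N0).

Let typed (c : nat) (v : V') : bool := if v is inl _ then ~~ odd c else odd c.

(** The cost bound is reached here: every choice of new vertices on the correct side, completed by
    the forced returns, is a closed walk that respects [q] and has all weights equal to 1. *)
Lemma pair_walks_complete :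
  \prod_(a <- iota 0 L) D a <= pair_walks (@complete_bip N M) p u0 q.
Proof.
pose g (s : seq V') a : R := if isnew a then (typed a.+1 (nth u0 (u0 :: s) a.+1))%:R
  else (nth u0 (u0 :: s) a.+1 == nth u0 (u0 :: s) (rho a.+1))%:R.
have gb s a : g s a = (if isnew a then typed a.+1 (nth u0 (u0 :: s) a.+1)
  else nth u0 (u0 :: s) a.+1 == nth u0 (u0 :: s) (rho a.+1))%:R.
  by rewrite /g; case: ifP.
apply: (@le_trans _ _ (seq_sum L (fun s => \prod_(a <- iota 0 L) g s a))); last first.
  apply: seq_sum_le => s sL.
  have F0 : 0 <= (last u0 s == u0)%:R *
     \prod_(a <- iota 0 (2 * p)) complete_bip (walk_edge u0 s a).1 (walk_edge u0 s a).2 *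
     \prod_(ab <- q) (walk_edge u0 s ab.1 == walk_edge u0 s ab.2)%:R :> R.
    rewrite !mulr_ge0// prodr_ge0// => a _; rewrite /complete_bip.
    by case: (_.1) => //; case: (_.2).
  have [/allP allg|] := boolP (all (fun a => g s a != 0) (iota 0 L)); last first.
    by move=> /allPn[a aL]; rewrite negbK => /eqP g0; rewrite (big_rem a)//= g0 mul0r.
  have wf c : (c <= L)%N -> nth u0 (u0 :: s) (rho c) = nth u0 (u0 :: s) c.
    case: c => [_|c cL].
      by have := first_glued_le L q 0%N; rewrite -/rho leqn0 => /eqP ->.
    have /allg : c \in iota 0 L by rewrite mem_iota add0n.
    rewrite gb; case: ifP => [/eqP nc _|_]; first by rewrite /rho nc.
    by rewrite pnatr_eq0 eqb0 negbK => /eqP ->.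
  (* New vertices lie on the correct side by the definition of [g]; an old one inherits its side
     from its earlier representative, which has the same parity. *)
  have ty c : (c <= L)%N -> typed c (nth u0 (u0 :: s) c).
    elim/ltn_ind: c => -[//|c] IH cL.
    have /allg : c \in iota 0 L by rewrite mem_iota add0n.
    rewrite gb; case: ifP => [_|nn _]; first by case: (typed _ _); rewrite ?eqxx.
    rewrite -wf//.
    have rc : (rho c.+1 < c.+1)%N.
      by have := first_glued_le L q c.+1; move: nn; rewrite /isnew /is_new -/rho; lia.
    have := IH _ rc (leq_trans (ltnW rc) cL).
    by rewrite /typed (odd_first_glued q oddL).
  have [w0L wq] := first_glued_respects q_perm wf.
  apply: (@le_trans _ _ 1).
    apply: prodr_ile1 => a _; rewrite gb.
    by case: (if _ then _ else _); rewrite /= ?lexx ?ler01.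
  have -> : last u0 s = u0 by rewrite (last_nth u0) sL.
  rewrite eqxx mul1r big1_seq ?mul1r; last first.
    move=> a; rewrite mem_iota add0n => /andP[_ aL].
    have := ty _ (leq_trans (row_pos_le a) aL); have := ty _ (leq_trans (col_pos_le a) aL).
    rewrite /typed odd_row_pos odd_col_pos /walk_edge /complete_bip /=.
    by case: (nth _ _ (col_pos a)) => //; case: (nth _ _ (row_pos a)).
  rewrite big1_seq// => -[a b] /andP[_ /wq[h1 h2]] /=.
  by rewrite /walk_edge h1 h2 eqxx.
suff gen k : \prod_(a <- iota 0 k) D a <= seq_sum k (fun s => \prod_(a <- iota 0 k) g s a).
  exact: gen.
elim: k => [|k IH].
  by rewrite /= !big_nil.
rewrite -[k.+1]addn1 iotaD !big_cat/= !big_seq1 add0n.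
apply: (@le_trans _ _ (seq_sum k (fun s => D k * \prod_(a <- iota 0 k) g s a))).
  rewrite seq_sumZ mulrC ler_wpM2l// /D.
  by case: ifP => // _; case: ifP.
rewrite addn1 /=; apply: seq_sum_le => s sk.
under [leRHS]eq_bigr do rewrite big_cat/= big_seq1.
have eg v a : (a < k)%N -> g (rcons s v) a = g s a.
  move=> ak.
  have le c : (c <= a.+1)%N -> nth u0 (u0 :: rcons s v) c = nth u0 (u0 :: s) c.
    by move=> ca; rewrite nth_rcons_lt// sk (leq_trans ca).
  by rewrite /g !le ?first_glued_le.
have -> : \sum_v (\prod_(a <- iota 0 k) g (rcons s v) a * g (rcons s v) k) =
  \prod_(a <- iota 0 k) g s a * \sum_v g (rcons s v) k.
  rewrite mulr_sumr; apply: eq_bigr => v _; congr (_ * _).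
  rewrite big_seq [RHS]big_seq; apply: eq_bigr => a; rewrite mem_iota => /andP[_ ak].
  exact: eg.
rewrite [leRHS]mulrC ler_wpM2r//.
  by apply: prodr_ge0 => a _; rewrite gb ler0n.
rewrite /D /g; case: ifP => [_|nk].
  under eq_bigr do rewrite -{2}sk nth_rcons_size.
  rewrite big_sumType/= /typed /=.
  by case: (odd k) => /=; rewrite !sumr_const !card_ord mul0rn ?addr0 ?add0r.
have rk : (rho k.+1 <= size s)%N.
  by have := first_glued_le L q k.+1; move: nk; rewrite /isnew /is_new sk -/rho; lia.
under eq_bigr do rewrite -{1}sk nth_rcons_size nth_rcons_lt//.
rewrite (bigD1 (nth u0 (u0 :: s) (rho k.+1)))//= eqxx.
by rewrite lerDl sumr_ge0.
Qed.

End Fixed.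

Lemma wick_walks_le (V : finType) (B : V -> V -> R) (u : V) p N M (N0 : (0 < N)%N) :
  (forall x y, 0 <= B x y <= 1) ->
  (forall x, \sum_y B x y ^+ 2 <= M%:R) -> (forall y, \sum_x B x y ^+ 2 <= N%:R) ->
  wick_walks B p u <= wick_walks (@complete_bip N M) p (inl (Ordinal N0)).
Proof.
move=> B01 BM BN; rewrite !wick_walksE big_seq [leRHS]big_seq; apply: ler_sum => q qp.
have q_perm := pairings_perm qp.
have q_lt := pairings_lt (iota_ltn_sorted 0 (2 * p)) qp.
apply: (le_trans (pair_walks_le q_perm q_lt u B01 BM BN)).
exact: pair_walks_complete.
Qed.

End Compare.

(** * Walk expansion of Gram matrix powers *)

Section MatrixWalks.
Variables (R : realDomainType) (n m : nat).

Definition bip_entry (X : 'M[R]_(n, m)) (u v : 'I_n + 'I_m) : R :=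
  match u, v with inl i, inr j => X i j | _, _ => 0 end.

Definition mx_walks (X : 'M[R]_(n, m)) p (u : 'I_n + 'I_m) : R :=
  seq_sum (2 * p) (fun s => (last u s == u)%:R *
    \prod_(a <- iota 0 (2 * p)) bip_entry X (walk_edge u s a).1 (walk_edge u s a).2).

Lemma gram_exp_diagE (X : 'M[R]_(n, m)) p i :
  ((X *m X^T) ^+ p) i i = mx_walks X p (inl i).
Proof.
(* The end vertex is generalized so that two steps can be peeled off. A walk of even length ending
   at a column has weight zero, whence the default value in [GE]. *)
pose G q v := seq_sum (2 * q) (fun s => (last (inl i) s == v)%:R *
    \prod_(a <- iota 0 (2 * q)) bip_entry X (walk_edge (inl i) s a).1 (walk_edge (inl i) s a).2).
suff GE q v : G q v = if v is inl i' then ((X *m X^T) ^+ q) i i' else 0 by rewrite /mx_walks -/(G p _) GE.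
elim: q v => [|q IH] v.
  rewrite /G muln0 /= big_nil mulr1; case: v => [i'|j'] //.
  by rewrite expr0 mxE.
have step : G q.+1 v = \sum_x \sum_y G q x * (bip_entry X x y * bip_entry X v y).
  rewrite /G mulnS add2n; set F := (F in seq_sum _.+2 F); rewrite [LHS]/=.
  under [RHS]eq_bigr => x _ do under eq_bigr => y _ do rewrite mulrC -seq_sumZ.
  under [RHS]eq_bigr => x _ do rewrite -seq_sum_sum.
  rewrite -seq_sum_sum; apply: seq_sum_ext => s sq.
  rewrite [RHS](bigD1 (last (inl i) s))//= [X in _ + X]big1 ?addr0; last first.
    by move=> x /negbTE xl; rewrite big1// => y _; rewrite eq_sym xl mul0r mulr0.
  apply: eq_bigr => y _; rewrite eqxx mul1r.
  rewrite (bigD1 v)//= [X in _ + X]big1 ?addr0; last first.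
    by move=> x /negbTE xl; rewrite /F last_rcons xl mul0r.
  rewrite /F last_rcons eqxx mul1r -[(2 * q).+2]addn2 iotaD big_cat/= add0n mulrC; congr (_ * _).
    rewrite !big_cons big_nil mulr1 /walk_edge /row_pos /col_pos /= oddM /= !addn1 !addn0.
    have e0 : nth (inl i) (inl i :: rcons (rcons s y) v) (2 * q) = last (inl i) s.
      by rewrite nth_rcons_lt ?size_rcons ?sq// nth_rcons_lt ?sq// -sq -last_nth.
    have e1 : nth (inl i) (inl i :: rcons (rcons s y) v) (2 * q).+1 = y.
      by rewrite nth_rcons_lt ?size_rcons ?sq// -sq nth_rcons_size.
    have e2 : nth (inl i) (inl i :: rcons (rcons s y) v) (2 * q).+2 = v.
      by rewrite -sq -(size_rcons s y) nth_rcons_size.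
    by move: e0 e1 e2 => /= -> -> ->.
  rewrite big_seq [RHS]big_seq; apply: eq_bigr => a; rewrite mem_iota add0n => /andP[_ aq].
  have le c : (c <= a.+1)%N -> nth (inl i) (inl i :: rcons (rcons s y) v) c =
      nth (inl i) (inl i :: s) c.
    by move=> ca; rewrite !nth_rcons_lt ?size_rcons// sq; lia.
  by rewrite /walk_edge !le ?row_pos_le ?col_pos_le.
rewrite step; case: v {step} => [i'|j']; last first.
  by rewrite big1// => x _; rewrite big1// => y _; rewrite /= !mulr0.
rewrite big_sumType/= [X in _ + X]big1 ?addr0; last first.
  by move=> x _; rewrite big1// => y _; rewrite mul0r mulr0.
rewrite exprSr mxE; apply: eq_bigr => x _.
rewrite big_sumType/= [X in X + _]big1 ?add0r; last by move=> y _; rewrite mulr0 mulr0.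
by rewrite mxE mulr_sumr; apply: eq_bigr => y _; rewrite IH mxE.
Qed.

End MatrixWalks.

(** * Matrices of sign walks in place of Gaussian matrices *)

Section SignMatrix.
Variables (R : realType) (N M : nat).
Let V := ('I_N + 'I_M)%type.

(* The walk of [J ^ 2] steps of size [1 / J] replaces a Gaussian average: its
   increments have the Gaussian covariance, and its moments converge to the
   Gaussian ones as [J] tends to infinity. *)
Definition sign_mean (A : Type) (I : finType) (J : nat) (c : A -> I -> R) (f : (A -> R) -> R) : R :=
  iter (J ^ 2) (walk_step J%:R^-1 c) f (fun=> 0).

Definition coord_mx (z : V * V -> R) : 'M[R]_(N, M) := \matrix_(i, j) z (inl i, inr j).

Lemma bip_entry_coord z u v :
  bip_entry (coord_mx z) u v = @complete_bip R N M u v * z (u, v).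
Proof. by case: u v => [i|i] [j|j]; rewrite /= ?mxE ?mul1r ?mul0r. Qed.

Lemma prod_count_mem (C : finType) (z : C -> R) (s : seq C) :
  \prod_(c <- s) z c = \prod_(c : C) z c ^+ count_mem c s.
Proof.
elim: s => [|c s IH]; first by rewrite big_nil big1.
rewrite big_cons IH (bigD1 c)//= [RHS](bigD1 c)//= eqxx mulrA -exprS; congr (_ * _).
by apply: eq_bigr => d /negbTE dc; rewrite eq_sym dc.
Qed.

Lemma leq_exp_ffact K p q : (q <= p)%N -> ((K - p) ^ q <= K ^_ q)%N.
Proof.
elim: q => [//|q IH] qp; rewrite expnSr ffactnSr leq_mul ?IH ?(ltnW qp)//; lia.
Qed.

(** The coordinates are independent, so [iter_sign_stepX] applies to each of them with [J ^ 2]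
    steps. The prefactor is the price of replacing falling factorials by powers through
    [leq_exp_ffact], and tends to 1 with [J]. *)
Lemma sign_mean_prodX (C : finType) (J p : nat) (k : C -> nat) : (0 < J)%N -> (p <= J ^ 2)%N ->
  (\sum_c k c = 2 * p)%N ->
  (1 - p%:R / (J ^ 2)%:R) ^+ p * (\prod_c gmom (k c))%:R <=
  sign_mean J (@delta_coef R C) (fun z => \prod_c z c ^+ k c).
Proof.
move=> J0 pJ kp; rewrite /sign_mean (@iter_walk_step_prod R C J%:R^-1 (fun c x => x ^+ k c)).
set r2 := 1 - _.
have J2 : 0 < (J ^ 2)%:R :> R by rewrite ltr0n expn_gt0 J0.
have r20 : 0 <= r2 by rewrite subr_ge0 ler_pdivrMr// mul1r ler_nat.
(* As the exponents sum to [2 * p], the loss [r2 ^ p] can be distributed over the coordinates in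
   proportion to [k c]. *)
have -> : r2 ^+ p = \prod_c Num.sqrt r2 ^+ k c.
  by rewrite prodrXr kp exprM sqr_sqrtr.
rewrite natr_prod -big_split/=; apply: ler_prod => c _.
rewrite mulr_ge0 ?exprn_ge0 ?sqrtr_ge0//=.
have J1 : 0 <= J%:R^-1 :> R by rewrite invr_ge0.
have [_ h] := iter_sign_stepX (k c) (J ^ 2) J1; apply: le_trans h.
case okc: (odd (k c)); first by rewrite gmom_odd// !mul0r mulr0.
rewrite mulrC -mulrA ler_wpM2l//.
have kE : k c = (2 * (k c)./2)%N by rewrite mul2n -[LHS]odd_double_half okc.
have kp2 : ((k c)./2 <= p)%N.
  have : (k c <= 2 * p)%N by rewrite -kp (bigD1 c)//= leq_addr.
  by rewrite {1}kE leq_pmul2l.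
rewrite {1 2}kE !exprM sqr_sqrtr// exprVn.
have -> : r2 = (J%:R ^+ 2)^-1 * (J ^ 2 - p)%:R.
  by rewrite /r2 natrB// natrX; field; rewrite pnatr_eq0; lia.
rewrite exprMn ler_wpM2l//.
by rewrite -natrX ler_nat leq_exp_ffact.
Qed.

End SignMatrix.

Lemma sum_count_mem (C : finType) (s : seq C) : (\sum_c count_mem c s = size s)%N.
Proof.
elim: s => [|c s IH]; first by rewrite big1.
rewrite /= big_split/= IH (bigD1 c)//= eqxx big1 ?addn0// => d /negbTE.
by rewrite eq_sym => ->.
Qed.

Lemma iter_walk_step_seq_sum (R : realType) (A : Type) (I V : finType) (s : R)
    (c : A -> I -> R) (L : nat) (F : (A -> R) -> seq V -> R) k X :
  iter k (walk_step s c) (fun X => seq_sum L (F X)) X =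
  seq_sum L (fun t => iter k (walk_step s c) (fun X => F X t) X).
Proof.
elim: L F => [//|L IH] F /=; rewrite IH; apply: seq_sum_ext => t _.
by rewrite iter_walk_step_sum.
Qed.

Section GaussianMatrix.
Variables (R : realType) (N M : nat).
Let V := ('I_N + 'I_M)%type.

Lemma wick_walks_le_sign_mean (J p : nat) (i : 'I_N) : (0 < J)%N -> (p <= J ^ 2)%N ->
  (1 - p%:R / (J ^ 2)%:R) ^+ p * wick_walks (@complete_bip R N M) p (inl i) <=
  sign_mean J (@delta_coef R (V * V)%type)
    (fun z => ((coord_mx z *m (coord_mx z)^T) ^+ p) i i).
Proof.
move=> J0 pJ.
have -> : (fun z : (V * V)%type -> R => ((coord_mx z *m (coord_mx z)^T) ^+ p) i i) =
  fun z => mx_walks (coord_mx z) p (inl i).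
  by apply/funext => z; exact: gram_exp_diagE.
rewrite /sign_mean /mx_walks iter_walk_step_seq_sum -seq_sumZ.
apply: seq_sum_le => s sp.
set E := map (walk_edge (inl i) s) (iota 0 (2 * p)).
set B := (last (inl i) s == inl i)%:R * \prod_(a <- iota 0 (2 * p))
  @complete_bip R N M (walk_edge (inl i) s a).1 (walk_edge (inl i) s a).2.
have B0 : 0 <= B.
  rewrite mulr_ge0// prodr_ge0// => a _; rewrite /complete_bip.
  by case: (_.1) => //; case: (_.2).
have -> : (fun z : (V * V)%type -> R => (last (inl i) s == inl i)%:R *
     \prod_(a <- iota 0 (2 * p)) bip_entry (coord_mx z) (walk_edge (inl i) s a).1
       (walk_edge (inl i) s a).2) = fun z => B * \prod_c z c ^+ count_mem c E.
  apply/funext => z; rewrite -prod_count_mem /E big_map /B -mulrA -big_split/=.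
  congr (_ * _); apply: eq_bigr => a _; exact: bip_entry_coord.
rewrite iter_walk_stepZ mulrCA ler_wpM2l//.
by apply: sign_mean_prodX => //; rewrite sum_count_mem size_map size_iota.
Qed.

(** * Gordon's comparison for two finite families of unit vectors *)

Section Gordon.
Variables (U W : finType) (alpha : U -> 'I_N -> R) (beta : W -> 'I_M -> R).
Hypotheses (alpha1 : forall a, \sum_i alpha a i ^+ 2 = 1)
           (beta1 : forall b, \sum_j beta b j ^+ 2 = 1).
Hypotheses (U0 : (0 < #|U|)%N) (W0 : (0 < #|W|)%N) (N0 : (0 < N)%N) (M0 : (0 < M)%N).

(* [bilin_coef] and [lin_coef] are the coefficients of Gordon's two processes
   [alpha^T Y beta] and [g . alpha + h . beta]. *)
Definition bilin_coef (ab : U * W) (c : V * V) : R :=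
  match c with (inl i, inr j) => alpha ab.1 i * beta ab.2 j | _ => 0 end.

Definition lin_coef (ab : U * W) (v : V) : R :=
  match v with inl i => alpha ab.1 i | inr j => beta ab.2 j end.

Lemma sum_bilin_coef (f : V * V -> R) ab :
  \sum_c bilin_coef ab c * f c =
  \sum_i \sum_j alpha ab.1 i * beta ab.2 j * f (inl i, inr j).
Proof.
transitivity (\sum_x \sum_y bilin_coef ab (x, y) * f (x, y)).
  by rewrite pair_bigA /=; apply: eq_bigr => -[].
rewrite big_sumType/= [X in _ + X]big1 ?addr0; last first.
  by move=> j _; rewrite big1// => v _; rewrite mul0r.
apply: eq_bigr => i _; rewrite big_sumType/= [X in X + _]big1 ?add0r//.
by move=> j _; rewrite mul0r.
Qed.

Lemma unit_cov_le1 (I : finType) (x y : I -> R) :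
  \sum_i x i ^+ 2 = 1 -> \sum_i y i ^+ 2 = 1 -> \sum_i x i * y i <= 1.
Proof.
move=> x1 y1; have : 0 <= \sum_i (x i - y i) ^+ 2 by apply: sumr_ge0 => i _; exact: sqr_ge0.
have -> : \sum_i (x i - y i) ^+ 2 = \sum_i x i ^+ 2 + \sum_i y i ^+ 2 - 2 * \sum_i x i * y i.
  by rewrite mulr_sumr -big_split/= -sumrB; apply: eq_bigr => i _; ring.
rewrite x1 y1; lra.
Qed.

Lemma bilin_cov ab cd : \sum_c bilin_coef ab c * bilin_coef cd c =
  (\sum_i alpha ab.1 i * alpha cd.1 i) * (\sum_j beta ab.2 j * beta cd.2 j).
Proof.
rewrite sum_bilin_coef big_distrlr/=; apply: eq_bigr => i _; apply: eq_bigr => j _.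
by rewrite mulrACA.
Qed.

Lemma lin_cov ab cd : \sum_v lin_coef ab v * lin_coef cd v =
  \sum_i alpha ab.1 i * alpha cd.1 i + \sum_j beta ab.2 j * beta cd.2 j.
Proof. by rewrite big_sumType. Qed.

(** Each of the [J ^ 2] steps, of size [1 / J], gains [lam ^ 2 / (2 * J ^ 2)] in the exponent and
    loses [C / J ^ 3]. *)
Lemma sign_mean_softmax_cmp (lam b : R) : 0 < lam -> lam <= b ->
  exists C : R, forall J : nat, (0 < J)%N -> C <= J%:R ->
    sign_mean J bilin_coef (softmax b (lam / b)) <=
    expR (- (lam ^+ 2 / 2) + C / J%:R) * sign_mean J lin_coef (softmax b (lam / b)).
Proof.
move=> lam0 lamb; have b0 : 0 < b by lra.
have A0 : (0 < #|{: U * W}|)%N by rewrite card_prod muln_gt0 U0.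
have k01 : 0 <= lam / b <= 1 by apply/andP; split; [rewrite divr_ge0// ltW | rewrite ler_pdivrMr// mul1r].
(* For the inner products [x] and [y] of unit vectors this is [0 <= (1 - x) * (1 - y)], with
   equality on the diagonal. *)
have cov ab cd : \sum_i lin_coef ab i * lin_coef cd i <=
    \sum_i bilin_coef ab i * bilin_coef cd i + 1.
  rewrite bilin_cov lin_cov.
  have := unit_cov_le1 (alpha1 ab.1) (alpha1 cd.1).
  have := unit_cov_le1 (beta1 ab.2) (beta1 cd.2).
  set x := \sum_i _; set y := \sum_j _; move=> *; nra.
have var ab : \sum_i lin_coef ab i ^+ 2 = \sum_i bilin_coef ab i ^+ 2 + 1.
  under eq_bigr do rewrite expr2.
  under [in RHS]eq_bigr do rewrite expr2.
  have e1 : \sum_i alpha ab.1 i * alpha ab.1 i = 1.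
    by rewrite -(alpha1 ab.1); apply: eq_bigr => i _; rewrite expr2.
  have e2 : \sum_j beta ab.2 j * beta ab.2 j = 1.
    by rewrite -(beta1 ab.2); apply: eq_bigr => j _; rewrite expr2.
  by rewrite lin_cov bilin_cov e1 e2 mulr1.
have [C HC] := iter_walk_step_softmax A0 b0 k01 var cov.
exists C => J J0 CJ; rewrite /sign_mean.
have J0' : 0 < J%:R :> R by rewrite ltr0n.
have s0 : 0 < J%:R^-1 :> R by rewrite invr_gt0.
have sC : J%:R^-1 * C <= 1 by rewrite mulrC ler_pdivrMr// mul1r.
apply: (le_trans (HC _ s0 sC _ _)).
rewrite -expRM_natl natrX.
suff -> : J%:R ^+ 2 * (- ((lam / b * b / J%:R) ^+ 2 / 2) + C * J%:R^-1 ^+ 3) =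
  - (lam ^+ 2 / 2) + C / J%:R by [].
by field; rewrite !gt_eqF.
Qed.

(** Young's inequality, from [0 <= |r x - z| ^ 2]. It bounds the supremum over all unit vectors by a
    quadratic expression in [z], whose exponential factorizes over the coordinates. *)
Lemma lin_le_quad (I : finType) (x z : I -> R) (r : R) : 0 < r -> \sum_i x i ^+ 2 = 1 ->
  \sum_i x i * z i <= r / 2 + \sum_i (2 * r)^-1 * z i ^+ 2.
Proof.
move=> r0 x1; have : 0 <= \sum_i (r * x i - z i) ^+ 2 by apply: sumr_ge0 => i _; exact: sqr_ge0.
have -> : \sum_i (r * x i - z i) ^+ 2 =
    r ^+ 2 * (\sum_i x i ^+ 2) + \sum_i z i ^+ 2 - 2 * r * \sum_i x i * z i.
  by rewrite !mulr_sumr -big_split/= -sumrB; apply: eq_bigr => i _; ring.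
rewrite x1 mulr1 -mulr_sumr => h.
rewrite -(ler_pM2l (x := 2 * r)) ?mulr_gt0//.
set Sz := \sum_i z i ^+ 2 in h *.
have -> : 2 * r * (r / 2 + (2 * r)^-1 * Sz) = r ^+ 2 + Sz by field; rewrite gt_eqF.
lra.
Qed.

(** The walk has total variance 1, so the chi-square bound is [(1 - lam / (nu + lam)) ^ (-1/2)],
    which equals [(1 + lam / nu) ^ (1/2)]. *)
Lemma iter_sign_step_chi (lam nu : R) (J : nat) : 0 < lam -> 0 < nu -> (0 < J)%N ->
  iter (J ^ 2) (sign_step J%:R^-1)
    (fun x => expR (lam * (2 * (nu + lam))^-1 * x ^+ 2)) 0 <= expR (lam / (2 * nu)).
Proof.
move=> lam0 nu0 J0.
have r0 : 0 < nu + lam by lra.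
have c0 : 0 <= lam * (2 * (nu + lam))^-1 by rewrite mulr_ge0 ?invr_ge0 ?mulr_ge0// ltW.
have cE : 2 * (lam * (2 * (nu + lam))^-1) * J%:R^-1 ^+ 2 * (J ^ 2)%:R = lam / (nu + lam).
  by rewrite natrX; field; rewrite !gt_eqF// ltr0n.
have c1 : 2 * (lam * (2 * (nu + lam))^-1) * J%:R^-1 ^+ 2 * (J ^ 2)%:R < 1.
  by rewrite cE ltr_pdivrMr// mul1r; lra.
apply: (le_trans (iter_sign_step_expR_sqr 0 c0 c1)).
rewrite expr0n/= mulr0 expR0 mulr1 cE -sqrtrV; last first.
  by rewrite subr_ge0 ler_pdivrMr// mul1r; lra.
have -> : expR (lam / (2 * nu)) = Num.sqrt (expR (lam / nu)).
  have -> : lam / nu = 2%:R * (lam / (2 * nu)) by field; rewrite gt_eqF.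
  by rewrite expRM_natl sqrtr_sqr ger0_norm ?expR_ge0.
rewrite ler_wsqrtr//.
have -> : (1 - lam / (nu + lam))^-1 = 1 + lam / nu.
  by field; rewrite !gt_eqF//=; lra.
exact: expR_ge1Dx.
Qed.

(** [lin_le_quad] is used with [r = sqrt N + lam] and [r = sqrt M + lam]. The rows cost
    [lam * (sqrt N + lam) / 2], and [N] chi-square factors cost [N * lam / (2 * sqrt N)], in total
    [lam * sqrt N + lam ^ 2 / 2]; the columns cost the same with [M]. *)
Lemma sign_mean_softmax_le (lam b : R) (J : nat) : 0 < lam -> lam <= b -> (0 < J)%N ->
  sign_mean J lin_coef (softmax b (lam / b)) <=
  expR (lam / b * ln #|{: U * W}|%:R + lam * (Num.sqrt N%:R + Num.sqrt M%:R) + lam ^+ 2).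
Proof.
move=> lam0 lamb J0; have b0 : 0 < b by lra.
have A0 : (0 < #|{: U * W}|)%N by rewrite card_prod muln_gt0 U0.
set n1 := Num.sqrt N%:R; set n2 := Num.sqrt M%:R.
have n10 : 0 < n1 by rewrite sqrtr_gt0 ltr0n.
have n20 : 0 < n2 by rewrite sqrtr_gt0 ltr0n.
pose r1 := n1 + lam; pose r2 := n2 + lam.
have r10 : 0 < r1 by rewrite /r1; lra.
have r20 : 0 < r2 by rewrite /r2; lra.
pose kap (v : V) : R := lam * (2 * ((if v is inl _ then n1 else n2) + lam))^-1.
pose c0 := lam / b * ln #|{: U * W}|%:R + lam * (r1 / 2 + r2 / 2).
rewrite /sign_mean.
have -> : (fun=> 0 : R) = (fun ab : U * W => \sum_v lin_coef ab v * (fun=> 0) v).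
  by apply/funext => ab; rewrite big1// => v _; rewrite mulr0.
rewrite iter_walk_step_lin.
apply: (@le_trans _ _ (iter (J ^ 2) (walk_step J%:R^-1 (@delta_coef R V))
  (fun z => expR c0 * \prod_v expR (kap v * z v ^+ 2)) (fun=> 0))).
  apply: iter_walk_step_le => z.
  rewrite -expR_sum -expRD ler_expR.
  (* [T] bounds the linear process at all pairs of vectors at once, so the sum of exponentials is at
     most [#|U * W|] times [expR (b * T)]. *)
  pose T := r1 / 2 + r2 / 2 + lam^-1 * \sum_v kap v * z v ^+ 2.
  have XT ab : \sum_v lin_coef ab v * z v <= T.
    rewrite /T big_sumType/= [X in lam^-1 * X]big_sumType/= mulrDr addrACA lerD//.
      apply: (le_trans (lin_le_quad (fun i => z (inl i)) r10 (alpha1 _))).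
      rewrite lerD2l mulr_sumr ler_sum// => i _.
      by rewrite /kap /r1 !mulrA mulVf ?mul1r// gt_eqF.
    apply: (le_trans (lin_le_quad (fun i => z (inr i)) r20 (beta1 _))).
    rewrite lerD2l mulr_sumr ler_sum// => i _.
    by rewrite /kap /r2 !mulrA mulVf ?mul1r// gt_eqF.
  have -> : c0 + \sum_v kap v * z v ^+ 2 = lam / b * (ln #|{: U * W}|%:R + b * T).
    by rewrite /c0 /T; field; rewrite !gt_eqF.
  apply: ler_wpM2l; first by rewrite divr_ge0// ltW.
  rewrite -[b * T]expRK -lnM ?posrE ?ltr0n ?expR_gt0// ler_ln ?posrE ?sum_expR_gt0//.
    rewrite -mulr_natl mulr1 mulr_natl -sumr_const.
    by apply: ler_sum => ab _; rewrite ler_expR ler_wpM2l// ltW.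
  by rewrite mulr_gt0 ?expR_gt0// ltr0n.
rewrite iter_walk_stepZ (@iter_walk_step_prod R V J%:R^-1 (fun v x => expR (kap v * x ^+ 2))).
have h : \prod_v iter (J ^ 2) (sign_step J%:R^-1) (fun x => expR (kap v * x ^+ 2)) 0 <=
   \prod_(v : V) expR (lam / (2 * (if v is inl _ then n1 else n2))).
  apply: ler_prod => v _; apply/andP; split.
    have pos j x : 0 <= iter j (sign_step J%:R^-1) (fun x => expR (kap v * x ^+ 2)) x.
      elim: j x => [|j IH] x; first exact: expR_ge0.
      by rewrite iterS /sign_step divr_ge0// addr_ge0.
    exact: pos.
  by rewrite /kap; case: v => ?; exact: iter_sign_step_chi.
apply: (le_trans (ler_wpM2l (expR_ge0 _) h)).
rewrite big_sumType/= !prodr_const !card_ord -!expRM_natl -!expRD ler_expR.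
have q1 : n1 ^+ 2 = N%:R by rewrite sqr_sqrtr.
have q2 : n2 ^+ 2 = M%:R by rewrite sqr_sqrtr.
rewrite /c0 /r1 /r2 -q1 -q2.
set l := ln _.
suff -> : lam / b * l + lam * ((n1 + lam) / 2 + (n2 + lam) / 2) +
  (n1 ^+ 2 * (lam / (2 * n1)) + n2 ^+ 2 * (lam / (2 * n2))) =
  lam / b * l + lam * (n1 + n2) + lam ^+ 2 by [].
by field; rewrite !gt_eqF.
Qed.

End Gordon.

End GaussianMatrix.

(** * Nets and bilinear forms *)

Section RowGeometry.
Variable R : realType.

Section OneDim.
Variable n : nat.
Implicit Types (x y z : 'rV[R]_n).

Definition dot x y : R := (x *m y^T) 0 0.

Lemma dotE x y : dot x y = \sum_i x 0 i * y 0 i.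
Proof. by rewrite /dot mxE; apply: eq_bigr => i _; rewrite mxE. Qed.

Lemma dotC x y : dot x y = dot y x.
Proof. by rewrite !dotE; apply: eq_bigr => i _; rewrite mulrC. Qed.

Lemma dotDl x y z : dot (x + y) z = dot x z + dot y z.
Proof. by rewrite /dot mulmxDl mxE. Qed.

Lemma dotZl (a : R) x y : dot (a *: x) y = a * dot x y.
Proof. by rewrite /dot -scalemxAl mxE. Qed.

Lemma dotDr x y z : dot z (x + y) = dot z x + dot z y.
Proof. by rewrite dotC dotDl !(dotC z). Qed.

Lemma dotZr (a : R) x y : dot x (a *: y) = a * dot x y.
Proof. by rewrite dotC dotZl dotC. Qed.

Lemma dotNl x y : dot (- x) y = - dot x y.
Proof. by rewrite -scaleN1r dotZl mulN1r. Qed.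

Lemma dotNr x y : dot x (- y) = - dot x y.
Proof. by rewrite dotC dotNl dotC. Qed.

Lemma dot0l x : dot 0 x = 0.
Proof. by rewrite -(scale0r 0) dotZl mul0r. Qed.

Lemma dot0r x : dot x 0 = 0.
Proof. by rewrite dotC dot0l. Qed.

Lemma dot_ge0 x : 0 <= dot x x.
Proof. by rewrite dotE sumr_ge0// => i _; rewrite -expr2 sqr_ge0. Qed.

Lemma dot_eq0 x : dot x x = 0 -> x = 0.
Proof.
rewrite dotE => /eqP; rewrite psumr_eq0; last by move=> i _; rewrite -expr2 sqr_ge0.
move=> /allP h; apply/rowP => i; rewrite mxE; apply/eqP.
by have := h i (mem_index_enum i); rewrite mulf_eq0 orbb.
Qed.

Lemma dot_CS x y : dot x y ^+ 2 <= dot x x * dot y y.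
Proof.
have [y0|] := eqVneq (dot y y) 0.
  by rewrite (dot_eq0 y0) !dot0r expr0n mulr0.
move=> y0; have yy : 0 < dot y y by rewrite lt_neqAle eq_sym y0 dot_ge0.
have := dot_ge0 (dot y y *: x - dot x y *: y).
rewrite dotDl !dotDr dotNl !dotNr !dotZl !dotZr dotNl !dotZl (dotC y x) => h.
rewrite -(ler_pM2l yy); nra.
Qed.

Definition nrm x : R := Num.sqrt (dot x x).

Lemma nrm_ge0 x : 0 <= nrm x. Proof. exact: sqrtr_ge0. Qed.

Lemma sqr_nrm x : nrm x ^+ 2 = dot x x. Proof. by rewrite sqr_sqrtr ?dot_ge0. Qed.

Lemma nrmZ (a : R) x : 0 <= a -> nrm (a *: x) = a * nrm x.
Proof.
move=> a0; rewrite /nrm dotZl dotZr mulrA -expr2 sqrtrM ?sqr_ge0//.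
by rewrite sqrtr_sqr ger0_norm.
Qed.

Lemma nrm_eq0 x : nrm x = 0 -> x = 0.
Proof. by move=> x0; apply: dot_eq0; rewrite -sqr_nrm x0 expr0n. Qed.

Lemma entry_le_nrm x i : `|x 0 i| <= nrm x.
Proof.
rewrite -sqrtr_sqr /nrm ler_wsqrtr// dotE (bigD1 i)//= -expr2 lerDl sumr_ge0// => j _.
by rewrite -expr2 sqr_ge0.
Qed.

Lemma nrm_delta i : nrm (delta_mx 0 i : 'rV[R]_n) = 1.
Proof.
rewrite /nrm dotE (bigD1 i)//= !mxE !eqxx mulr1 big1 ?addr0 ?sqrtr1// => j ji.
by rewrite !mxE (negbTE ji) andbF mul0r.
Qed.

(** The coordinates are rounded to a grid of mesh [1 / L], and each occupied cell is represented by
    one of its own unit vectors; two vectors of a cell are at distance at most [sqrt n / L]. The net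
    points must have norm exactly 1 for Gordon's covariances. *)
Lemma unit_net (eps : R) (i0 : 'I_n) : 0 < eps ->
  exists (U : finType) (al : U -> 'rV[R]_n), [/\ (0 < #|U|)%N, forall a, nrm (al a) = 1 &
    forall x, nrm x = 1 -> exists a, nrm (x - al a) <= eps].
Proof.
move=> eps0.
pose L := (Num.trunc (Num.sqrt n%:R / eps)).+1.
have L0 : 0 < L%:R :> R by rewrite ltr0n.
have LE : Num.sqrt n%:R / L%:R <= eps.
  rewrite ler_pdivrMr// mulrC -ler_pdivrMr//; apply: ltW.
  by have /andP[] := truncn_itv (x := Num.sqrt n%:R / eps) (divr_ge0 (sqrtr_ge0 _) (ltW eps0)).
pose cell x : {ffun 'I_n -> 'I_(2 * L).+1} :=
  [ffun i => inord (Num.trunc (L%:R * (x 0 i + 1)))].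
exists {ffun 'I_n -> 'I_(2 * L).+1}.
pose P f x := nrm x = 1 /\ cell x = f.
(* Cells that contain no unit vector receive a basis vector as a placeholder, so that all values
   have norm 1. *)
exists (fun f => if pselect (exists x, P f x) is left h then projT1 (cid h) else delta_mx 0 i0).
split.
- by apply/card_gt0P; exists [ffun => ord0].
- move=> f; case: pselect => [h|_]; last exact: nrm_delta.
  by case: (cid h) => x [].
- move=> x x1; exists (cell x); case: pselect => [h|]; last by case; exists x.
  case: (cid h) => y [y1 yx] /=.
  have close i : (x - y) 0 i ^+ 2 <= (L%:R^-1) ^+ 2.
    have := congr1 (fun f : {ffun 'I_n -> 'I_(2 * L).+1} => nat_of_ord (f i)) yx.
    rewrite !ffunE /=.
    have b z : nrm z = 1 -> 0 <= L%:R * (z 0 i + 1) /\ L%:R * (z 0 i + 1) <= (2 * L)%:R.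
      move=> z1; have := entry_le_nrm z i; rewrite z1 ler_norml => /andP[? ?].
      by rewrite natrM; split; nra.
    have [bx1 bx2] := b _ x1; have [by1 by2] := b _ y1.
    have tr (r : R) : 0 <= r -> r <= (2 * L)%:R -> (Num.trunc r < (2 * L).+1)%N.
      move=> r0 r1; rewrite -(ltr_nat R); have /andP[h1 _] := truncn_itv r0.
      by apply: (le_lt_trans h1); apply: (le_lt_trans r1); rewrite ltr_nat.
    rewrite !inordK ?tr// => e.
    have /andP[u1 u2] := truncn_itv bx1; have /andP[v1 v2] := truncn_itv by1.
    rewrite e in v1 v2; rewrite -natr1 in u2; rewrite -natr1 in v2.
    have d : `|L%:R * (x - y) 0 i| <= 1.
      by rewrite !mxE ler_norml; apply/andP; split; lra.
    rewrite exprVn -[leRHS]div1r ler_pdivlMr ?exprn_gt0// mulrC -exprMn.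
    by move: d; rewrite ler_norml => /andP[d1 d2]; nra.
  apply: le_trans LE.
  have -> : Num.sqrt n%:R / L%:R = Num.sqrt (n%:R * L%:R^-1 ^+ 2 : R).
    by rewrite sqrtrM// sqrtr_sqr ger0_norm// invr_ge0.
  rewrite ler_wsqrtr// dotE.
  apply: (@le_trans _ _ (\sum_(i < n) L%:R^-1 ^+ 2)).
    by apply: ler_sum => i _; rewrite -expr2.
  by rewrite sumr_const card_ord mulr_natl.
Qed.

End OneDim.

Lemma dot_mulmx (n m : nat) (A : 'M[R]_(n, m)) x y : dot (x *m A) y = dot x (y *m A^T).
Proof. by rewrite /dot trmx_mul trmxK mulmxA. Qed.

Section OpNorm.
Variables (n m : nat) (A : 'M[R]_(n, m)) (i0 : 'I_n) (j0 : 'I_m).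

Definition bil_values : set R :=
  [set r | exists x y, [/\ nrm x = 1, nrm y = 1 & r = dot (x *m A) y]].

(** The variational norm, on which nets act directly; it serves for the comparison matrix, whereas
    [spectral_norm] is defined through eigenvalues. *)
Definition opnorm : R := sup bil_values.

Lemma has_sup_bil_values : has_sup bil_values.
Proof.
split.
  by exists (dot (delta_mx 0 i0 *m A) (delta_mx 0 j0)), (delta_mx 0 i0), (delta_mx 0 j0);
    rewrite !nrm_delta.
exists (\sum_j \sum_i `|A i j|) => r [x [y [x1 y1 ->]]].
rewrite dotE; apply: ler_sum => j _; rewrite mxE mulr_suml; apply: ler_sum => i _.
apply: le_trans (ler_norm _) _; rewrite !normrM.
have := entry_le_nrm x i; have := entry_le_nrm y j; rewrite x1 y1 => hy hx.
apply: (@le_trans _ _ (`|x 0 i| * `|A i j|)); first by rewrite ler_piMr ?mulr_ge0.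
by rewrite ler_piMl.
Qed.

Lemma dot_le_opnorm1 x y : nrm x = 1 -> nrm y = 1 -> dot (x *m A) y <= opnorm.
Proof.
move=> x1 y1; apply: ub_le_sup; first by case: has_sup_bil_values.
by exists x, y.
Qed.

Lemma opnorm_ge0 : 0 <= opnorm.
Proof.
have h1 := @dot_le_opnorm1 (delta_mx 0 i0) (delta_mx 0 j0) (nrm_delta _) (nrm_delta _).
have h2 := @dot_le_opnorm1 (delta_mx 0 i0) (- delta_mx 0 j0) (nrm_delta _).
have e : nrm (- delta_mx 0 j0 : 'rV[R]_m) = 1.
  by rewrite /nrm dotNl dotNr opprK -/(nrm _) nrm_delta.
have := h2 e; rewrite dotNr; lra.
Qed.

Lemma dot_le_opnorm x y : dot (x *m A) y <= opnorm * nrm x * nrm y.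
Proof.
have [x0|x0] := eqVneq (nrm x) 0.
  by rewrite x0 (nrm_eq0 x0) mul0mx mulr0 mul0r dot0l.
have [y0|y0] := eqVneq (nrm y) 0.
  by rewrite y0 (nrm_eq0 y0) mulr0 dot0r.
have xp : 0 < nrm x by rewrite lt_neqAle eq_sym x0 nrm_ge0.
have yp : 0 < nrm y by rewrite lt_neqAle eq_sym y0 nrm_ge0.
have := @dot_le_opnorm1 ((nrm x)^-1 *: x) ((nrm y)^-1 *: y).
rewrite !nrmZ ?invr_ge0 ?nrm_ge0// !mulVf// => /(_ erefl erefl).
rewrite -scalemxAl dotZl dotZr mulrA -invfM mulrC ler_pdivrMr ?mulr_gt0//.
by rewrite mulrA.
Qed.

Lemma nrm_mulmx_le x : nrm (x *m A) <= opnorm * nrm x.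
Proof.
have [h|h] := eqVneq (nrm (x *m A)) 0.
  by rewrite h mulr_ge0 ?opnorm_ge0 ?nrm_ge0.
have p : 0 < nrm (x *m A) by rewrite lt_neqAle eq_sym h nrm_ge0.
by rewrite -(ler_pM2r p) -expr2 sqr_nrm dot_le_opnorm.
Qed.

Lemma nrm_mulmx_tr_le y : nrm (y *m A^T) <= opnorm * nrm y.
Proof.
have [h|h] := eqVneq (nrm (y *m A^T)) 0.
  by rewrite h mulr_ge0 ?opnorm_ge0 ?nrm_ge0.
have p : 0 < nrm (y *m A^T) by rewrite lt_neqAle eq_sym h nrm_ge0.
rewrite -(ler_pM2r p) -expr2 sqr_nrm -dot_mulmx.
by apply: le_trans (dot_le_opnorm _ _) _; rewrite mulrAC.
Qed.

Lemma diag_exp_le_opnorm p i : ((A *m A^T) ^+ p) i i <= opnorm ^+ (2 * p).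
Proof.
have h q : nrm (delta_mx 0 i *m (A *m A^T) ^+ q) <= opnorm ^+ (2 * q).
  elim: q => [|q IH]; first by rewrite muln0 !expr0 mulmx1 nrm_delta.
  rewrite exprSr mulnS addnC addn2 !exprS -mulmxE !mulmxA mulrCA mulrA -expr2.
  apply: le_trans (nrm_mulmx_tr_le _) _; rewrite expr2 -mulrA ler_wpM2l ?opnorm_ge0//.
  by apply: le_trans (nrm_mulmx_le _) _; rewrite ler_wpM2l ?opnorm_ge0.
apply: le_trans (h p); apply: le_trans (entry_le_nrm _ i).
by rewrite -rowE mxE ler_norm.
Qed.

(** Replacing the two unit vectors by net points, one after the other, costs [eps * opnorm] each
    time; the supremum is then absorbed on the left. *)
Lemma opnorm_le_net (U W : finType) (al : U -> 'rV[R]_n) (be : W -> 'rV[R]_m) eps t :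
  0 <= eps ->
  (forall a, nrm (al a) = 1) -> (forall b, nrm (be b) = 1) ->
  (forall x, nrm x = 1 -> exists a, nrm (x - al a) <= eps) ->
  (forall y, nrm y = 1 -> exists b, nrm (y - be b) <= eps) ->
  (forall a b, dot (al a *m A) (be b) <= t) ->
  opnorm * (1 - 2 * eps) <= t.
Proof.
move=> eps0 al1 be1 netU netW tP.
suff : opnorm <= t + 2 * eps * opnorm by lra.
apply: ge_sup; first by case: has_sup_bil_values.
move=> r [x [y [x1 y1 ->]]].
have [a ax] := netU _ x1; have [b by_] := netW _ y1.
have -> : dot (x *m A) y = dot (al a *m A) (be b) + dot ((x - al a) *m A) y
    + dot (al a *m A) (y - be b).
  by rewrite mulmxBl !(dotDl, dotDr, dotNl, dotNr); ring.
have := tP a b.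
have o0 := opnorm_ge0.
have := dot_le_opnorm (x - al a) y; rewrite y1 mulr1.
have := dot_le_opnorm (al a) (y - be b); rewrite al1 mulr1.
have := ler_wpM2l o0 ax; have := ler_wpM2l o0 by_; lra.
Qed.

End OpNorm.

End RowGeometry.

(** * The exponential series of the Gaussian comparison matrix *)

Section WickSeries.
Variables (R : realType) (N M : nat) (i0 : 'I_N) (j0 : 'I_M).

Lemma wick_walks_ge0 p : 0 <= wick_walks (@complete_bip R N M) p (inl i0).
Proof.
apply: seq_sum_ge0 => s; rewrite !mulr_ge0// prodr_ge0// => a _.
by rewrite /complete_bip; case: (_.1) => //; case: (_.2).
Qed.

Lemma bernoulli_le (x : R) p : 0 <= x <= 1 -> 1 - p%:R * x <= (1 - x) ^+ p.
Proof.
move=> /andP[x0 x1]; elim: p => [|p IH]; first by rewrite mul0r subr0 expr0.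
rewrite exprS; apply: (@le_trans _ _ ((1 - x) * (1 - p%:R * x))).
  rewrite -natr1; have : 0 <= p%:R * (x * x) by rewrite !mulr_ge0.
  lra.
by rewrite ler_wpM2l// subr_ge0.
Qed.

(** Pointwise in [z]: a diagonal entry is at most [opnorm ^ (2 * p)], the series is then below an
    exponential of the norm, and the factor [1 - 2 * eps] put into the series compensates for
    passing from the norm to the maximum over the net. *)
Lemma diag_series_le_softmax (U W : finType) (al : U -> 'rV[R]_N) (be : W -> 'rV[R]_M)
    (lam b eps : R) (P : nat) (z : ('I_N + 'I_M) * ('I_N + 'I_M) -> R) :
  (0 < #|{: U * W}|)%N -> 0 < lam -> lam <= b -> 0 <= eps -> 2 * eps < 1 ->
  (forall a, nrm (al a) = 1) -> (forall b, nrm (be b) = 1) ->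
  (forall x, nrm x = 1 -> exists a, nrm (x - al a) <= eps) ->
  (forall y, nrm y = 1 -> exists b, nrm (y - be b) <= eps) ->
  \sum_(0 <= p < P) (lam * (1 - 2 * eps)) ^+ (2 * p) / (2 * p)`!%:R *
    ((coord_mx z *m (coord_mx z)^T) ^+ p) i0 i0 <=
  softmax b (lam / b) (fun ab => \sum_c bilin_coef (fun a i => al a 0 i)
    (fun b j => be b 0 j) ab c * z c).
Proof.
move=> A0 lam0 lamb eps0 eps1 al1 be1 netU netW.
have b0 : 0 < b by lra.
set Y := coord_mx z; set X := (X in softmax _ _ X).
have XE ab : X ab = dot (al ab.1 *m Y) (be ab.2).
  rewrite /X sum_bilin_coef dotE exchange_big/=; apply: eq_bigr => j _.
  rewrite mxE mulr_suml; apply: eq_bigr => i _; rewrite mxE; ring.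
have [ab0 XP] : exists ab0, forall ab, X ab <= X ab0.
  case/card_gt0P: A0 => ab _; exists [arg max_(c > ab) X c]%O.
  by case: arg_maxP => // c _ h d; exact: h.
have o0 := opnorm_ge0 Y i0 j0.
have oX : opnorm Y * (1 - 2 * eps) <= X ab0.
  by apply: (opnorm_le_net i0 j0 eps0 al1 be1 netU netW) => a c; rewrite -(XE (a, c)).
set x := lam * (1 - 2 * eps).
have x0 : 0 <= x by rewrite mulr_ge0 ?subr_ge0// ltW.
apply: (@le_trans _ _ (expR (lam * X ab0))); last first.
  rewrite ler_expR.
  have -> : lam * X ab0 = lam / b * ln (expR (b * X ab0)).
    by rewrite expRK mulrA divfK// gt_eqF.
  apply: ler_wpM2l; first by rewrite divr_ge0// ltW.
  rewrite ler_ln ?posrE ?expR_gt0 ?sum_expR_gt0//.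
  by rewrite (bigD1 ab0)//= lerDl sumr_ge0// => c _; exact: expR_ge0.
apply: (@le_trans _ _ (\sum_(0 <= p < P) (x * opnorm Y) ^+ (2 * p) / (2 * p)`!%:R)).
  apply: ler_sum => p _; set f := (2 * p)`!%:R.
  have -> : (x * opnorm Y) ^+ (2 * p) / f = x ^+ (2 * p) / f * opnorm Y ^+ (2 * p).
    by rewrite [in LHS]exprMn mulrAC.
  by rewrite ler_wpM2l ?divr_ge0 ?exprn_ge0// diag_exp_le_opnorm.
apply: (le_trans (cosh_series_le _ _)).
have xo : 0 <= x * opnorm Y by rewrite mulr_ge0.
apply: (@le_trans _ _ (expR (x * opnorm Y))).
  have : expR (- (x * opnorm Y)) <= expR (x * opnorm Y) by rewrite ler_expR; lra.
  lra.
by rewrite ler_expR /x -mulrA ler_wpM2l 1?mulrC// ltW.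
Qed.

(** The constant [C] is the logarithm of the number of net pairs. It is chosen before [b], so that
    its contribution [lam / b * C] vanishes as [b] grows. *)
Lemma wick_series_le_net (lam eps : R) (P : nat) : 0 < lam ->
  0 < eps -> 2 * eps < 1 ->
  exists C : R, forall b : R, lam <= b ->
  \sum_(0 <= p < P) (lam * (1 - 2 * eps)) ^+ (2 * p) / (2 * p)`!%:R *
    wick_walks (@complete_bip R N M) p (inl i0) <=
  expR (lam / b * C + lam * (Num.sqrt N%:R + Num.sqrt M%:R) + lam ^+ 2 / 2).
Proof.
move=> lam0 eps0 eps1.
have [U [al [U0 al1 netU]]] := unit_net i0 eps0.
have [W [be [W0 be1 netW]]] := unit_net j0 eps0.
have A0 : (0 < #|{: U * W}|)%N by rewrite card_prod muln_gt0 U0.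
exists (ln #|{: U * W}|%:R) => b lamb.
have al1' a : \sum_i al a 0 i ^+ 2 = 1.
  rewrite -[RHS](expr1n _ 2) -(al1 a) sqr_nrm dotE.
  by apply: eq_bigr => i _; rewrite expr2.
have be1' a : \sum_i be a 0 i ^+ 2 = 1.
  rewrite -[RHS](expr1n _ 2) -(be1 a) sqr_nrm dotE.
  by apply: eq_bigr => i _; rewrite expr2.
have [C HC] := sign_mean_softmax_cmp al1' be1' U0 W0 lam0 lamb.
set x := lam * (1 - 2 * eps).
have x0 : 0 <= x by rewrite mulr_ge0 ?subr_ge0// ltW.
set S := \sum_(_ <= _ < _) _.
set T := expR _.
have N0 : (0 < N)%N by case: (N) i0 => // -[].
have M0 : (0 < M)%N by case: (M) j0 => // -[].
(* The loss [(1 - p / J ^ 2) ^ p] is at least [1 - P ^ 2 / J ^ 2] for all [p < P] by Bernoulli's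
   inequality, which makes it uniform over the truncated series. *)
have key (J : nat) : (0 < J)%N -> (P <= J)%N -> C <= J%:R ->
  S * (1 - P%:R ^+ 2 * J%:R^-1 ^+ 2) <= T * expR (C * J%:R^-1).
  move=> J0 PJ CJ.
  have J0' : 0 < J%:R :> R by rewrite ltr0n.
  pose Q p (z : ('I_N + 'I_M) * ('I_N + 'I_M) -> R) := x ^+ (2 * p) / (2 * p)`!%:R *
    ((coord_mx z *m (coord_mx z)^T) ^+ p) i0 i0.
  pose E := sign_mean J (@delta_coef R (('I_N + 'I_M) * ('I_N + 'I_M))%type).
  apply: (@le_trans _ _ (E (fun z => \sum_(0 <= p < P) Q p z))).
    rewrite /E /sign_mean iter_walk_step_sum /S mulr_suml.
    rewrite big_nat [leRHS]big_nat; apply: ler_sum => p /= pP.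
    rewrite iter_walk_stepZ -mulrA ler_wpM2l ?mulr_ge0 ?invr_ge0 ?exprn_ge0//.
    have pJ : (p <= J ^ 2)%N by rewrite (leq_trans (ltnW pP))// (leq_trans PJ)// expnS leq_pmulr// expn_gt0 J0.
    have := @wick_walks_le_sign_mean R N M J p i0 J0 pJ; rewrite /sign_mean; apply: le_trans.
    rewrite mulrC ler_wpM2r ?wick_walks_ge0//.
    have J2 : 0 < (J ^ 2)%:R :> R by rewrite ltr0n expn_gt0 J0.
    apply: le_trans (bernoulli_le _ _); last first.
      by rewrite divr_ge0//= ler_pdivrMr// mul1r ler_nat.
    rewrite lerD2l lerN2 natrX exprVn mulrA ler_wpM2r ?invr_ge0 ?exprn_ge0//.
    by rewrite expr2 ler_pM// ler_nat ltnW.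
  have h1 : E (fun z => \sum_(0 <= p < P) Q p z) <=
      sign_mean J (bilin_coef (fun a i => al a 0 i) (fun b j => be b 0 j)) (softmax b (lam / b)).
    have zE : (fun=> 0 : R) = (fun ab : U * W => \sum_c bilin_coef (fun a i => al a 0 i)
       (fun b j => be b 0 j) ab c * (fun=> 0) c).
      by apply/funext => ab; rewrite big1// => v _; rewrite mulr0.
    rewrite [leRHS]/sign_mean zE iter_walk_step_lin /E /sign_mean.
    by apply: iter_walk_step_le => z; apply: diag_series_le_softmax => //; exact: ltW.
  apply: (le_trans h1); apply: (le_trans (HC _ J0 CJ)).
  have h2 := sign_mean_softmax_le al1' be1' U0 W0 N0 M0 lam0 lamb J0.
  apply: (le_trans (ler_wpM2l (expR_ge0 _) h2)).
  rewrite /T -!expRD ler_expR; lra.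
have h0 := @cvg_harmonic R.
(* [harmonic n] is [1 / (n + 1)], so [key] is applied with [J = n.+1]. *)
have cl : S * (1 - P%:R ^+ 2 * harmonic n ^+ 2) @[n --> \oo] --> S * (1 - P%:R ^+ 2 * 0 ^+ 2).
  apply: cvgM; first exact: cvg_cst.
  apply: cvgB; first exact: cvg_cst.
  apply: cvgM; first exact: cvg_cst.
  rewrite expr2; under eq_fun do rewrite expr2; exact: cvgM.
have cr : T * expR (C * harmonic n) @[n --> \oo] --> T * expR (C * 0).
  apply: cvgM; first exact: cvg_cst.
  apply: continuous_cvg; first exact: continuous_expR.
  by apply: cvgM; first exact: cvg_cst.
have : S * (1 - P%:R ^+ 2 * 0 ^+ 2) <= T * expR (C * 0).
  rewrite -(cvg_lim _ cl)// -(cvg_lim _ cr)//; apply: ler_lim.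
  - by apply/cvg_ex; eexists; exact: cl.
  - by apply/cvg_ex; eexists; exact: cr.
  near=> n; apply: key => //.
    by near: n; exists P => // n /= Pn; rewrite (leq_trans Pn).
  near: n; have [k Ck] : exists k : nat, C <= k%:R.
    exists (Num.trunc `|C|).+1; apply: le_trans (ler_norm _) _.
    by have /andP[_ /ltW] := truncn_itv (normr_ge0 C).
  by exists k => // n /= kn; apply: le_trans Ck _; rewrite ler_nat (leq_trans kn).
by rewrite expr0n/= !mulr0 expR0 subr0 !mulr1.
Unshelve. all: by end_near. Qed.

(** The net bound is applied at some [l > lam] with [eps = (1 - lam / l) / 2], so that
    [l * (1 - 2 * eps)] is exactly [lam]. Then [b = l * (n + 1)] tends to infinity, and finally [l]
    decreases to [lam]. *)
Lemma wick_series_le (lam : R) (P : nat) : 0 < lam ->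
  \sum_(0 <= p < P) lam ^+ (2 * p) / (2 * p)`!%:R *
    wick_walks (@complete_bip R N M) p (inl i0) <=
  expR (lam * (Num.sqrt N%:R + Num.sqrt M%:R) + lam ^+ 2 / 2).
Proof.
move=> lam0; set S := \sum_(_ <= _ < _) _; set nu := Num.sqrt N%:R + Num.sqrt M%:R.
have h0 := @cvg_harmonic R.
have step1 (l : R) : lam < l -> S <= expR (l * nu + l ^+ 2 / 2).
  move=> laml; have l0 : 0 < l by lra.
  have lr : 0 < lam / l < 1 by rewrite divr_gt0//= ltr_pdivrMr// mul1r.
  have /andP[lr0 lr1] := lr.
  pose eps := (1 - lam / l) / 2.
  have eps0 : 0 < eps by rewrite /eps; lra.
  have eps1 : 2 * eps < 1 by rewrite /eps; lra.
  have [C HC] := wick_series_le_net P l0 eps0 eps1.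
  have lE : l * (1 - 2 * eps) = lam by rewrite /eps; field; rewrite gt_eqF.
  rewrite lE -/S -/nu in HC.
  have cr : expR (harmonic n * C + l * nu + l ^+ 2 / 2) @[n --> \oo] -->
      expR (0 * C + l * nu + l ^+ 2 / 2).
    apply: continuous_cvg; first exact: continuous_expR.
    apply: cvgD; last exact: cvg_cst.
    apply: cvgD; last exact: cvg_cst.
    by apply: cvgM; last exact: cvg_cst.
  have : S <= expR (0 * C + l * nu + l ^+ 2 / 2).
    rewrite -(cvg_lim _ cr)//; apply: limr_ge; first by apply/cvg_ex; eexists; exact: cr.
    near=> n; have := HC (l * n.+1%:R).
    rewrite invfM mulrA mulfV ?gt_eqF// mul1r; apply.
    by rewrite ler_peMr ?ler1n// ltW.
  by rewrite mul0r add0r.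
have cr : expR ((lam + harmonic n) * nu + (lam + harmonic n) ^+ 2 / 2) @[n --> \oo] -->
      expR ((lam + 0) * nu + (lam + 0) ^+ 2 / 2).
  have c1 : lam + harmonic n @[n --> \oo] --> lam + 0 by apply: cvgD; [exact: cvg_cst|].
  apply: continuous_cvg; first exact: continuous_expR.
  apply: cvgD; first by apply: cvgM; last exact: cvg_cst.
  apply: cvgM; last exact: cvg_cst.
  by rewrite expr2; under eq_fun do rewrite expr2; exact: cvgM.
rewrite -[in leRHS](addr0 lam) -(cvg_lim _ cr)//.
apply: limr_ge; first by apply/cvg_ex; eexists; exact: cr.
near=> n; apply: step1; rewrite ltrDl; exact: harmonic_gt0.
Unshelve. all: by end_near. Qed.

End WickSeries.

(** * Spectral norm *)

Section Spectral.
Variable R : realType.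

Lemma continuous_sum_rV (m : nat) (I : finType) (F : I -> 'rV[R]_m -> R) :
  (forall i, continuous (F i)) -> continuous (fun v => \sum_i F i v).
Proof.
move=> Fc; elim: (index_enum I) => [|i r IH].
  by under eq_fun do rewrite big_nil; exact: cst_continuous.
under eq_fun do rewrite big_cons.
by move=> v; exact: (cvgD (Fc i v) (IH v)).
Qed.

Lemma continuous_dot_mulmx (m k : nat) (B : 'M[R]_(m, k)) :
  continuous (fun v : 'rV[R]_m => dot (v *m B) (v *m B)).
Proof.
have -> : (fun v : 'rV[R]_m => dot (v *m B) (v *m B)) =
  fun v => \sum_i (\sum_j v 0 j * B j i) * (\sum_j v 0 j * B j i).
  by apply/funext => v; rewrite dotE; apply: eq_bigr => i _; rewrite !mxE.
apply: continuous_sum_rV => i v.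
have c : continuous (fun v : 'rV[R]_m => \sum_j v 0 j * B j i).
  apply: continuous_sum_rV => j w.
  have h : (fun v : 'rV[R]_m => v 0 j) @ w --> w 0 j by exact: coord_continuous.
  exact: (cvgM h (cvg_cst _)).
exact: (cvgM (c v) (c v)).
Qed.

Lemma continuous_dot (m : nat) : continuous (fun v : 'rV[R]_m => dot v v).
Proof.
have -> : (fun v : 'rV[R]_m => dot v v) = fun v => dot (v *m 1%:M) (v *m 1%:M).
  by apply/funext => v; rewrite mulmx1.
exact: continuous_dot_mulmx.
Qed.

Lemma compact_sphere (m : nat) : compact [set v : 'rV[R]_m | dot v v = 1].
Proof.
apply: bounded_closed_compact.
  exists 1; split; first exact: num_real.
  move=> M M1 v /= v1; rewrite [`|v|]mx_normrE; apply: bigmax_le; first by lra.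
  move=> [i j] _ /=; rewrite ord1; apply: le_trans (entry_le_nrm _ _) _.
  by rewrite /nrm v1 sqrtr1 ltW.
apply: (@closed_comp _ _ (fun v : 'rV[R]_m => dot v v) [set 1]); last exact: closed_eq.
by move=> v _; exact: continuous_dot.
Qed.

Section Fixed.
Variables (n m : nat) (A : 'M[R]_(n, m)).

Lemma dot_mulmx_sqr (v : 'rV[R]_m) : dot (v *m A^T) (v *m A^T) = dot v (v *m (A^T *m A)).
Proof. by rewrite dot_mulmx trmxK mulmxA. Qed.

Lemma dot_gt0 (k : nat) (v : 'rV[R]_k) : v != 0 -> 0 < dot v v.
Proof.
by move=> v0; rewrite lt_neqAle dot_ge0 andbT eq_sym; apply: contra v0 => /eqP/dot_eq0/eqP.
Qed.

(** A maximizer of the form on the compact unit sphere is an eigenvector by first variation: moving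
    against the residual [w] would otherwise increase the Rayleigh quotient. *)
Lemma rayleigh_max : (0 < m)%N -> exists v0 : 'rV[R]_m,
  [/\ v0 != 0, v0 *m (A^T *m A) = dot (v0 *m A^T) (v0 *m A^T) *: v0 &
   forall v, dot (v *m A^T) (v *m A^T) <= dot (v0 *m A^T) (v0 *m A^T) * dot v v].
Proof.
move=> m0; pose f (v : 'rV[R]_m) := dot (v *m A^T) (v *m A^T).
have Sne : [set v : 'rV[R]_m | dot v v = 1] !=set0.
  exists (delta_mx 0 (Ordinal m0)).
  have e := sqr_nrm (delta_mx 0 (Ordinal m0) : 'rV[R]_m).
  by rewrite nrm_delta expr1n in e; rewrite /= -e.
have fc : {within [set v : 'rV[R]_m | dot v v = 1], continuous f}.
  by apply: continuous_subspaceT; exact: continuous_dot_mulmx.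
have [v0 + fmax] := compact_EVT_max Sne (@compact_sphere m) fc.
rewrite inE /= => v01; rewrite -/(f v0).
have le v : f v <= f v0 * dot v v.
  have [->|vn0] := eqVneq v 0.
    by rewrite /f mul0mx !dot0l mulr0.
  have v0' := dot_gt0 vn0.
  have np : 0 < nrm v by rewrite lt_neqAle nrm_ge0 andbT eq_sym; apply: contra vn0 => /eqP/nrm_eq0/eqP.
  have := fmax ((nrm v)^-1 *: v); rewrite inE /= dotZl dotZr -sqr_nrm mulrA -invfM -expr2.
  rewrite mulVf ?expf_neq0 ?gt_eqF// => /(_ erefl).
  rewrite /f -scalemxAl dotZl dotZr -/(f v) mulrA -invfM -expr2 mulrC ler_pdivrMr ?exprn_gt0//.
exists v0; split => //.
  by apply: contra_eq_neq v01 => ->; rewrite dot0l eq_sym oner_eq0.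
set mu := f v0 in le *.
set w := mu *: v0 - v0 *m (A^T *m A).
have bw z : mu * dot v0 z - dot (v0 *m A^T) (z *m A^T) = dot w z.
  rewrite /w dotDl dotNl dotZl; congr (_ - _).
  by rewrite dot_mulmx trmxK [RHS]dot_mulmx trmx_mul trmxK mulmxA.
suff w0 : w = 0 by move/eqP: w0; rewrite subr_eq0 => /eqP.
clearbody w.
apply: dot_eq0; apply/eqP; rewrite eq_le dot_ge0 andbT.
have [//|ww] := leP (dot w w) 0.
pose q := mu * dot w w - f w.
have q0 : 0 <= q by rewrite subr_ge0.
have key t : 0 <= - 2 * t * dot w w + t ^+ 2 * q.
  have := le (v0 - t *: w).
  rewrite /f mulmxBl -scalemxAl !(dotDl, dotDr, dotNl, dotNr, dotZl, dotZr).
  rewrite (dotC (w *m _) (v0 *m _)) (dotC w v0).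
  have := bw w; have : mu * dot v0 v0 = mu by rewrite v01 mulr1.
  rewrite /q /f -/(f v0) -/mu; nra.
(* For this [t], [t ^ 2 * q <= t * dot w w], which is less than [2 * t * dot w w] and contradicts
   [key]. *)
have := key (dot w w / (q + 1)); have q1 : 0 < q + 1 by lra.
set t := dot w w / (q + 1); have t0 : 0 < t by rewrite divr_gt0.
have tq : t * (q + 1) = dot w w by rewrite /t divfK// gt_eqF.
nra.
Qed.

Lemma singular_value_gt c : 0 <= c -> c < spectral_norm A ->
  exists s (v : 'rV[R]_m), [/\ c < s, v != 0 & v *m (A^T *m A) = s ^+ 2 *: v].
Proof.
move=> c0 cA; apply: contrapT => h.
have le s : singular_value A s -> s <= c.
  move=> [s0 /eigenvalueP[v vA vn0]]; rewrite leNgt; apply/negP => cs.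
  by apply: h; exists s, v.
move: cA; apply/negP; rewrite -leNgt /spectral_norm.
(* The supremum of the empty set is 0, which is excluded by [0 <= c]. *)
have [->|/set0P S0] := eqVneq [set s | singular_value A s] set0; first by rewrite sup0.
by apply: ge_sup => // s /= /le.
Qed.

Lemma spectral_norm_gtP c : (0 < m)%N -> 0 <= c ->
  (c < spectral_norm A) <->
  exists v : 'rV[R]_m, c ^+ 2 * dot v v < dot (v *m A^T) (v *m A^T).
Proof.
move=> m0 c0; split.
  move=> /(singular_value_gt c0)[s [v [cs vn0 vA]]]; exists v.
  rewrite dot_mulmx_sqr vA dotZr ltr_pM2r ?dot_gt0//.
  by rewrite ltr_pXn2r// nnegrE//; lra.
move=> [v cv]; have [v0 [v0n0 v0A v0max]] := rayleigh_max m0.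
set mu := dot (v0 *m A^T) (v0 *m A^T) in v0A v0max.
have mu0 : 0 <= mu by exact: dot_ge0.
have vp : 0 < dot v v.
  apply: dot_gt0; apply: contraTneq cv => ->.
  by rewrite mul0mx !dot0l mulr0 ltxx.
have cmu : c ^+ 2 < mu by rewrite -(ltr_pM2r vp); exact: lt_le_trans cv (v0max v).
have smu : singular_value A (Num.sqrt mu).
  split; first exact: sqrtr_ge0.
  by apply/eigenvalueP; exists v0 => //; rewrite sqr_sqrtr.
apply: (@lt_le_trans _ _ (Num.sqrt mu)).
  by rewrite -(ltr_pXn2r (n := 2))// ?nnegrE ?sqrtr_ge0// sqr_sqrtr.
(* A supremum is meaningful only for a bounded set: the largest Rayleigh quotient bounds every
   singular value, and its root is one of them. *)
apply: ub_le_sup => //; exists (Num.sqrt mu) => s [s0 /eigenvalueP[u uA un0]].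
rewrite -(ler_pXn2r (n := 2))// ?nnegrE ?sqrtr_ge0// sqr_sqrtr//.
by rewrite -(ler_pM2r (dot_gt0 un0)) -dotZr -uA -dot_mulmx_sqr.
Qed.

(** The induction advances by two: for [G] the Gram matrix, [G ^ (p + 2)] is [(G C) (G C)^T] by
    symmetry of [G]. The factorization expresses that the powers are positive semidefinite. *)
Lemma exp_gram_factor p : exists k (C : 'M[R]_(n, k)), (A *m A^T) ^+ p = C *m C^T.
Proof.
elim/ltn_ind: p => -[|[|p]] IH.
- by exists n, 1%:M; rewrite expr0 trmx1 mulmx1.
- by exists m, A; rewrite expr1.
have [k [C CE]] := IH p (ltnW (ltnSn _)).
exists k, (A *m A^T *m C); rewrite exprS exprSr CE -!mulmxE !trmx_mul trmxK.
by rewrite !mulmxA.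
Qed.

(** The left-hand side is the sum of the squared inner products of [u] with the columns of [C];
    Cauchy-Schwarz is applied to each of them. *)
Lemma dot_gram_le_trace k (C : 'M[R]_(n, k)) (u : 'rV[R]_n) :
  dot (u *m (C *m C^T)) u <= (\sum_i (C *m C^T) i i) * dot u u.
Proof.
rewrite mulmxA dot_mulmx trmxK dotE.
have -> : \sum_i (C *m C^T) i i = \sum_j dot ((col j C)^T) ((col j C)^T).
  under eq_bigr do rewrite mxE.
  rewrite exchange_big/=; apply: eq_bigr => j _; rewrite dotE.
  by apply: eq_bigr => i _; rewrite !mxE.
rewrite mulr_suml; apply: ler_sum => j _; rewrite -expr2.
have -> : (u *m C) 0 j = dot u ((col j C)^T).
  by rewrite mxE dotE; apply: eq_bigr => i _; rewrite !mxE.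
by rewrite mulrC; exact: dot_CS.
Qed.

(** Multiplication by [A^T] turns an eigenvector of [A^T A] into one of [A A^T], nonzero because
    [s > 0]. The trace is thus over the [n] rows rather than the [m] columns. *)
Lemma spectral_norm_trace c p : 0 <= c -> c < spectral_norm A ->
  c ^+ (2 * p) <= \sum_i ((A *m A^T) ^+ p) i i.
Proof.
move=> c0 /(singular_value_gt c0)[s [v [cs vn0 vA]]].
set u := v *m A^T.
have s0 : 0 < s by lra.
have up : 0 < dot u u by rewrite dot_mulmx_sqr vA dotZr mulr_gt0 ?exprn_gt0 ?dot_gt0.
have uA : u *m (A *m A^T) = s ^+ 2 *: u.
  by rewrite /u mulmxA -(mulmxA v) vA -scalemxAl.
have uAp : u *m (A *m A^T) ^+ p = s ^+ (2 * p) *: u.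
  elim: p => [|p IH]; first by rewrite muln0 !expr0 mulmx1 scale1r.
  by rewrite exprSr -mulmxE mulmxA IH -scalemxAl uA scalerA mulnS addnC exprD.
apply: (@le_trans _ _ (s ^+ (2 * p))).
  by rewrite lerXn2r ?nnegrE// ltW.
rewrite -(ler_pM2r up) -dotZl -uAp.
by have [k [C ->]] := exp_gram_factor p; exact: dot_gram_le_trace.
Qed.

End Fixed.

Lemma nbhs_rat_row (m : nat) (v : 'rV[R]_m) (O : set 'rV[R]_m) : nbhs v O ->
  exists q : 'rV[rat]_m, O (map_mx ratr q).
Proof.
move=> [P Pn PO].
have : forall j, exists q : rat, P ord0 j (ratr q).
  move=> j; have /nbhs_ballP[e /= e0 eP] := Pn ord0 j.
  have /rat_in_itvoo[q] : v ord0 j - e < v ord0 j + e by lra.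
  rewrite in_itv/= => /andP[q1 q2]; exists q; apply: eP.
  by rewrite /ball/= ltr_norml; apply/andP; split; lra.
move=> /choice[q qP]; exists (\row_j q j); apply: PO => i j.
by rewrite !mxE ord1.
Qed.

(** The inequality is an open condition on the vector, so rational vectors detect it. This exhibits
    the tail event as a countable union of measurable sets. *)
Lemma spectral_norm_gt_rat (n m : nat) (A : 'M[R]_(n, m)) c : (0 < m)%N -> 0 <= c ->
  (c < spectral_norm A) <->
  exists q : 'rV[rat]_m, c ^+ 2 * dot (map_mx ratr q) (map_mx ratr q) <
    dot (map_mx ratr q *m A^T) (map_mx ratr q *m A^T).
Proof.
move=> m0 c0; rewrite spectral_norm_gtP//; split; last by move=> [q qP]; exists (map_mx ratr q).
move=> [v vP].
apply: (@nbhs_rat_row m v [set v | c ^+ 2 * dot v v < dot (v *m A^T) (v *m A^T)]).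
pose g (v : 'rV[R]_m) := dot (v *m A^T) (v *m A^T) - c ^+ 2 * dot v v.
have gc : g @ v --> g v.
  have h1 := @continuous_dot_mulmx m n A^T v.
  have h2 := @continuous_dot m v.
  exact: (cvgB h1 (cvgM (cvg_cst _) h2)).
have gv : 0 < g v by rewrite subr_gt0.
have : \forall w \near v, 0 < g w by exact: (cvgr_gt (g v) gc).
by apply: filterS => w /=; rewrite /g subr_gt0.
Qed.

End Spectral.

(** * Independence and moments *)

Import HBSimple HBNNSimple.

Section Weighted.
Context (d d' : measure_display) (T : measurableType d) (T' : measurableType d') (R : realType).
Variables (mu : {measure set T -> \bar R}) (nu : {measure set T' -> \bar R}).
Variables (X : T -> T') (G : T -> R) (c : R).
Hypotheses (mX : measurable_fun setT X) (mG : measurable_fun setT G).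
Hypotheses (G0 : forall w, 0 <= G w) (c0 : 0 <= c).
Hypothesis HA : forall A, measurable A ->
  (\int[mu]_w (\1_A (X w) * G w)%:E = c%:E * nu A)%E.

Lemma weighted_integral_nnsfun (f : {nnsfun T' >-> R}) :
  (\int[mu]_w (f (X w) * G w)%:E = c%:E * \int[nu]_x (f x)%:E)%E.
Proof.
have mI (r : R) : measurable (f @^-1` [set r]) by exact: measurable_funPTI.
have mIX (r : R) : measurable_fun setT (fun w => \1_(f @^-1` [set r]) (X w) : R).
  by apply: measurableT_comp => //; exact: measurable_indic.
have -> : (\int[mu]_w (f (X w) * G w)%:E =
   \int[mu]_w (\sum_(r \in range f) (r * (\1_(f @^-1` [set r]) (X w) * G w))%:E))%E.
  apply: eq_integral => w _; rewrite fimfunE fsumEFin// mulr_fsuml //.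
  by congr EFin; apply: eq_fsbigr => r _; rewrite mulrA.
have rge0 (r : R) x : 0 <= r * \1_(f @^-1` [set r]) x.
  by have := nnfun_muleindic_ge0 f r x; rewrite -EFinM lee_fin.
rewrite ge0_integral_fsum//; last 2 first.
  - move=> r; apply/measurable_EFinP; apply: measurable_funM => //; exact: measurable_funM.
  - by move=> r w _; rewrite lee_fin mulrA mulr_ge0.
have -> : (\int[nu]_x (f x)%:E = \int[nu]_x (\sum_(r \in range f) (r * \1_(f @^-1` [set r]) x)%:E))%E.
  by apply: eq_integral => w _; rewrite fimfunE fsumEFin.
rewrite ge0_integral_fsum//; last 2 first.
  - by move=> r; apply/measurable_EFinP; apply: measurable_funM.
  - by move=> r w _; rewrite lee_fin.
rewrite ge0_mule_fsumr; last first.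
  by move=> r; apply: integral_ge0 => x _; rewrite lee_fin.
apply: eq_fsbigr => r.
rewrite inE => -[x _ <-].
under eq_integral do rewrite EFinM.
rewrite ge0_integralZl//; last 3 first.
  - by apply/measurable_EFinP; exact: measurable_funM.
  - by move=> w _; rewrite lee_fin mulr_ge0.
  - by rewrite lee_fin.
under [in RHS]eq_integral do rewrite EFinM.
rewrite ge0_integralZl//; last 2 first.
  - by apply/measurable_EFinP.
  - by rewrite lee_fin.
by rewrite HA// integral_indic// setIT muleCA.
Qed.

(** Extension from indicators by monotone convergence. It is used with the weight [G] being a
    product of other independent factors, the constant 1 for the symmetry of a law, and the normal
    density. *)
Lemma ge0_weighted_integral (f : T' -> R) :
  measurable_fun setT f -> (forall x, 0 <= f x) ->
  (\int[mu]_w (f (X w) * G w)%:E = c%:E * \int[nu]_x (f x)%:E)%E.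
Proof.
move=> mf f0.
have mEf : measurable_fun setT (fun x => (f x)%:E) by exact/measurable_EFinP.
have Ef0 x : setT x -> (0 <= (f x)%:E)%E by move=> _; rewrite lee_fin.
pose f_ := nnsfun_approx measurableT mEf.
have cf x : (f_ k x)%:E @[k --> \oo] --> (f x)%:E.
  exact: (cvg_nnsfun_approx measurableT mEf).
have mfX k : measurable_fun setT (fun w => f_ k (X w) * G w).
  by apply: measurable_funM => //; exact: measurableT_comp.
transitivity (lim (\int[mu]_w (f_ k (X w) * G w)%:E @[k --> \oo])%E).
  rewrite -monotone_convergence//=.
  - apply: eq_integral => w _; apply/esym/cvg_lim => //=.
    rewrite EFinM; under eq_fun do rewrite EFinM.
    by apply: cvgeZr => //; exact: cf.
  - by move=> n; exact/measurable_EFinP.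
  - by move=> n w _; rewrite lee_fin mulr_ge0.
  - move=> w _ k l kl; rewrite lee_fin ler_wpM2r//.
    exact/lefP/(nd_nnsfun_approx measurableT mEf).
have -> : (\int[nu]_x (f x)%:E = lim (\int[nu]_x (f_ k x)%:E @[k --> \oo]))%E.
  rewrite -monotone_convergence//=.
  - by apply: eq_integral => x _; apply/esym/cvg_lim => //; exact: cf.
  - by move=> n; exact/measurable_EFinP.
  - by move=> n x _; rewrite lee_fin.
  - by move=> x _ k l kl; rewrite lee_fin; exact/lefP/(nd_nnsfun_approx measurableT mEf).
rewrite -limeMl//.
  by apply: congr_lim; apply/funext => n /=; exact: weighted_integral_nnsfun.
apply/ereal_nondecreasing_is_cvgn => k l kl; apply: ge0_le_integral => //=.
- by move=> x _; rewrite lee_fin.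
- exact/measurable_EFinP.
- exact/measurable_EFinP.
- by move=> x _; rewrite lee_fin; exact/lefP/(nd_nnsfun_approx measurableT mEf).
Qed.

End Weighted.

Section Independence.
Context (d : measure_display) (T : measurableType d) (R : realType).
Variables (P : probability T R) (I : finType) (X : I -> {RV P >-> R}).
Hypothesis X_indep : mutually_independent X.

Lemma measurable_prod_comp (f : I -> R -> R) (Q : pred I) :
  (forall i, measurable_fun setT (f i)) ->
  measurable_fun setT (fun w => \prod_(i | Q i) f i (X i w)).
Proof.
move=> mf; under eq_fun do rewrite big_mkcond; apply: measurable_prod => i _.
by case: (Q i) => //; exact: measurableT_comp.
Qed.

Lemma integral_indic_indep (A : I -> set R) : (forall i, measurable (A i)) ->
  (\int[P]_w (\prod_i \1_(A i) (X i w) : R)%:E =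
   \prod_i \int[P]_w (\1_(A i) (X i w))%:E)%E.
Proof.
move=> mA.
have mXA i : measurable (X i @^-1` A i) by rewrite -[X in measurable X]setTI; exact: measurable_funP.
have -> : (\int[P]_w (\prod_i \1_(A i) (X i w) : R)%:E =
    \int[P]_w (\1_(\bigcap_(i in [set` [set: I]%SET]) (X i @^-1` A i)) w)%:E)%E.
  apply: eq_integral => w _; congr EFin.
  have [wA|wA] := pselect ((\bigcap_(i in [set` [set: I]%SET]) (X i @^-1` A i)) w).
    rewrite indicE mem_set// big1// => i _.
    by rewrite indicE mem_set//; apply: wA; rewrite /= inE.
  rewrite indicE memNset//.
  have [i iA] : exists i, ~ A i (X i w).
    apply: contrapT => H; apply: wA => i _ /=.
    by apply: contrapT => iA; apply: H; exists i.
  by apply/eqP/prodf_eq0; exists i => //; rewrite indicE memNset.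
rewrite integral_indic//; last first.
  by apply: fin_bigcap_measurable => //; exact: finite_finset.
rewrite setIT; etransitivity; first exact: (X_indep [set: I]%SET mA).
apply: eq_big => [i|i _]; first by rewrite inE.
have -> : (fun w => (\1_(A i) (X i w))%:E) = (fun w => (\1_(X i @^-1` A i) w : R)%:E) by [].
by rewrite integral_indic// setIT.
Qed.

(* Induction on [S]: indicators are replaced by general functions one index at
   a time. *)
Lemma ge0_integral_prod_indep (S : {set I}) (f : I -> R -> R) :
  (forall i, measurable_fun setT (f i)) -> (forall i x, 0 <= f i x) ->
  (forall i, P.-integrable setT (fun w => (f i (X i w))%:E)) ->
  (forall i, i \notin S -> exists2 A, measurable A & f i = \1_A) ->
  (\int[P]_w (\prod_i f i (X i w))%:E = \prod_i \int[P]_w (f i (X i w))%:E)%E.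
Proof.
have [n] := ubnP #|S|; elim: n S f => // n IH S f ltS mf f0 intf indf.
have [S0|[k kS]] := set_0Vmem S.
  have /choice[A HA] i : exists A, measurable A /\ f i = \1_A.
    by have [|A mA fA] := indf i; [rewrite S0 inE | exists A].
  under eq_integral do under eq_bigr => i _ do rewrite (HA i).2.
  rewrite integral_indic_indep; last by move=> i; exact: (HA i).1.
  by apply: eq_bigr => i _; apply: eq_integral => w _; rewrite (HA i).2.
have finf i : (\int[P]_w (f i (X i w))%:E)%E \is a fin_num by exact: integrable_fin_num.
set G := fun w => \prod_(i | i != k) f i (X i w).
set c : R := \prod_(i | i != k) fine (\int[P]_w (f i (X i w))%:E)%E.
have cE : (c%:E = \prod_(i | i != k) \int[P]_w (f i (X i w))%:E)%E.
  rewrite /c -prodEFin; apply: eq_bigr => i _; rewrite fineK//.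
have c0 : 0 <= c.
  by apply: prodr_ge0 => i _; apply: fine_ge0; apply: integral_ge0 => w _; rewrite lee_fin.
have mG : measurable_fun setT G by exact: measurable_prod_comp.
have G0 w : 0 <= G w by apply: prodr_ge0 => i _.
have HA A : measurable A -> (\int[P]_w (\1_A (X k w) * G w)%:E = c%:E * distribution P (X k) A)%E.
  move=> mA; pose f' i := if i == k then \1_A else f i.
  have := IH (S :\ k)%SET f'.
  have -> : (\int[P]_w (\prod_i f' i (X i w))%:E = \int[P]_w (\1_A (X k w) * G w)%:E)%E.
    apply: eq_integral => w _; congr EFin; rewrite (bigD1 k)//= /f' eqxx; congr *%R.
    by apply: eq_bigr => i /negPf ->.
  move=> ->.
  - rewrite (bigD1 k)//= muleC; congr *%E.
      by rewrite cE; apply: eq_bigr => i /negPf ik; rewrite /f' ik.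
    rewrite /f' eqxx.
    have -> : (fun w => (\1_A (X k w))%:E) = (fun w => (\1_(X k @^-1` A) w : R)%:E) by [].
    rewrite integral_indic// ?setIT//.
    by rewrite -[X in measurable X]setTI; exact: measurable_funP.
  - by rewrite (cardsD1 k S) kS in ltS.
  - by move=> i; rewrite /f'; case: eqP.
  - by move=> i x; rewrite /f'; case: eqP.
  - move=> i; rewrite /f'; case: eqP => // _.
    apply: (@le_integrable _ _ _ P setT measurableT _ (cst 1%:E)) => //.
      by apply/measurable_EFinP; apply: measurableT_comp.
      by move=> w _ /=; rewrite lee_fin ger0_norm// normr1 indicE lern1 leq_b1.
    exact: finite_measure_integrable_cst.
  - move=> i; rewrite !inE negb_and negbK /f'; case: eqP => [_ _|_ /=]; first by exists A.
    exact: indf.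
have := ge0_weighted_integral (measurable_funPT (X k)) mG G0 HA (mf k) (f0 k).
rewrite ge0_integral_distribution//; last 2 first.
  - exact/measurable_EFinP.
  - by move=> x; rewrite lee_fin.
move=> H; rewrite [in RHS](bigD1 k)//= muleC -cE -H.
by apply: eq_integral => w _; rewrite (bigD1 k).
Qed.

Lemma integrable_prod_indep (f : I -> R -> R) :
  (forall i, measurable_fun setT (f i)) ->
  (forall i, P.-integrable setT (fun w => (f i (X i w))%:E)) ->
  P.-integrable setT (fun w => (\prod_i f i (X i w))%:E).
Proof.
move=> mf intf; apply/integrableP; split.
  by apply/measurable_EFinP; exact: measurable_prod_comp.
have intn i : P.-integrable setT (fun w => `|f i (X i w)|%:E).
  exact: (integrable_abse (intf i)).
under eq_integral do rewrite abse_EFin normr_prod.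
rewrite (@ge0_integral_prod_indep [set: I]%SET (fun i x => `|f i x|))//; last 2 first.
  - by move=> i; apply: measurableT_comp => //; exact: measurable_normr.
  - by move=> i; rewrite inE.
apply: (@le_lt_trans _ _ (\prod_i fine (\int[P]_w `|f i (X i w)|%:E))%:E); last by rewrite ltry.
rewrite -prodEFin; under [leRHS]eq_bigr do rewrite fineK ?integrable_fin_num//.
by [].
Qed.

(* Induction on [S]: the functions with index in [S] are split one at a time
   into positive and negative parts. *)
Lemma integral_prod_indep (S : {set I}) (f : I -> R -> R) :
  (forall i, measurable_fun setT (f i)) ->
  (forall i, P.-integrable setT (fun w => (f i (X i w))%:E)) ->
  (forall i, i \notin S -> forall x, 0 <= f i x) ->
  (\int[P]_w (\prod_i f i (X i w))%:E = \prod_i \int[P]_w (f i (X i w))%:E)%E.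
Proof.
have [n] := ubnP #|S|; elim: n S f => // n IH S f ltS mf intf f0.
have [S0|[k kS]] := set_0Vmem S.
  apply: (@ge0_integral_prod_indep [set: I]%SET) => //; last by move=> i; rewrite inE.
  by move=> i; apply: f0; rewrite S0 inE.
pose g (s : R) i (x : R) := if i == k then Num.max (s * f i x) 0 else f i x.
have mg s i : measurable_fun setT (g s i).
  rewrite /g; case: eqP => // _; apply: measurable_maxr => //.
  exact: measurable_funM.
have intg s i : P.-integrable setT (fun w => (g s i (X i w))%:E).
  rewrite /g; case: eqP => // _.
  apply: (@le_integrable _ _ _ P setT measurableT _ (fun w => (s * f i (X i w))%:E)) => //.
  - apply/measurable_EFinP; apply: measurable_maxr => //.
    by apply: measurable_funM => //; exact: measurableT_comp.
  - by move=> w _ /=; rewrite lee_fin ger0_norm ?le_max ?lexx ?orbT// ge_max ler_norm normr_ge0.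
  - by under eq_fun do rewrite EFinM; exact: integrableZl.
have Eg s : (\int[P]_w (\prod_i g s i (X i w))%:E = \prod_i \int[P]_w (g s i (X i w))%:E)%E.
  apply: (IH (S :\ k)%SET) => //.
    by rewrite (cardsD1 k S) kS in ltS.
  move=> i; rewrite !inE negb_and negbK /g; case: eqP => [_ _ x|_ /= iS]; last exact: f0.
  by rewrite le_max lexx orbT.
have gB x : f k x = g 1 k x - g (-1) k x.
  by rewrite /g eqxx; have [h|h] := leP (1 * f k x) 0; have [h'|h'] := leP (-1 * f k x) 0; lra.
have gE s i : i != k -> g s i = f i by move=> /negPf ik; apply/funext => x; rewrite /g ik.
have -> : (\int[P]_w (\prod_i f i (X i w))%:E =
    \int[P]_w ((\prod_i g 1 i (X i w))%:E - (\prod_i g (-1) i (X i w))%:E))%E.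
  apply: eq_integral => w _; rewrite -EFinB; congr EFin.
  rewrite !(bigD1 (P := xpredT) k)//= gB mulrBl; congr (_ * _ - _ * _);
    by apply: eq_bigr => i ik; rewrite gE.
rewrite integralB_EFin//; last 2 first.
  - exact: integrable_prod_indep.
  - exact: integrable_prod_indep.
rewrite !Eg !(bigD1 (P := xpredT) k)//=.
have cE s : (\prod_(i | i != k) \int[P]_w (g s i (X i w))%:E =
    \prod_(i | i != k) \int[P]_w (f i (X i w))%:E)%E.
  by apply: eq_bigr => i ik; rewrite gE.
have cfin : (\prod_(i | i != k) \int[P]_w (f i (X i w))%:E)%E \is a fin_num.
  by apply: prode_fin_num => i _; exact: integrable_fin_num.
rewrite !cE -muleBl//; last first.
  by rewrite fin_num_adde_defr// integrable_fin_num.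
congr *%E; rewrite -integralB_EFin//; [|exact: intg..].
by apply: eq_integral => w _; rewrite -EFinB -gB.
Qed.
End Independence.

Section Moments.
Context (d : measure_display) (T : measurableType d) (R : realType).
Variable P : probability T R.

(** From [y <= 1 + y ^ 2] with [y = |X| ^ k]: the even moments, which are what the hypotheses
    control, make every power integrable. *)
Lemma integrable_pow (X : {RV P >-> R}) (k : nat) :
  (\int[P]_w (X w ^+ (2 * k))%:E < +oo)%E ->
  P.-integrable setT (fun w => (X w ^+ k)%:E).
Proof.
move=> fin.
have int2 : P.-integrable setT (fun w => (X w ^+ (2 * k))%:E).
  apply/integrableP; split; first by apply/measurable_EFinP; exact: measurable_funX.
  have e0 w : 0 <= X w ^+ (2 * k) by rewrite exprM exprn_ge0 ?sqr_ge0.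
  by under eq_integral do rewrite abse_EFin ger0_norm//.
apply: (@le_integrable _ _ _ P setT measurableT _ (fun w => (1 + X w ^+ (2 * k))%:E)) => //.
- by apply/measurable_EFinP; exact: measurable_funX.
- move=> w _ /=; rewrite lee_fin normrX mulnC exprM -(real_normK (num_real (X w ^+ k))) normrX.
  set y := `|X w| ^+ k; have y0 : 0 <= y by rewrite exprn_ge0.
  rewrite ger0_norm ?addr_ge0 ?sqr_ge0//; nra.
- by under eq_fun do rewrite EFinD; apply: integrableD => //; exact: finite_measure_integrable_cst.
Qed.

(** Symmetry is given on sets, hence extends to nonnegative functions first. For odd [k], negating
    the argument exchanges the positive and the negative part of [x ^ k], whose integrals therefore
    agree and are finite. *)
Lemma symmetric_law_odd_moment (X : {RV P >-> R}) (k : nat) :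
  symmetric_law X -> odd k -> P.-integrable setT (fun w => (X w ^+ k)%:E) ->
  (\int[P]_w (X w ^+ k)%:E = 0)%E.
Proof.
move=> symX oddk intX.
have mN : measurable_fun setT (fun w => - X w) by exact: measurableT_comp.
have symE (f : R -> R) : measurable_fun setT f -> (forall x, 0 <= f x) ->
    (\int[P]_w (f (X w))%:E = \int[P]_w (f (- X w))%:E)%E.
  move=> mf f0.
  have := @ge0_weighted_integral _ _ _ _ _ P (distribution P X) _ (cst 1) 1 mN.
  move=> /(_ (measurable_cst _) (fun=> ler01)) H.
  have := H _ f mf f0.
  rewrite ge0_integral_distribution//; last exact/measurable_EFinP.
  rewrite mul1e /= => HX; transitivity (\int[P]_w (f (- X w) * cst 1 w)%:E)%E; last first.
    by apply: eq_integral => w _; rewrite mulr1.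
  apply/esym/HX => A mA; rewrite mul1e.
  have -> : (fun w => (\1_A (- X w) * 1)%:E) = (fun w => (\1_((fun w => - X w) @^-1` A) w : R)%:E).
    by apply/funext => w; rewrite mulr1.
  rewrite integral_indic// ?setIT; last first.
    by rewrite -[X in measurable X]setTI; exact: mN.
  by rewrite /distribution /pushforward symX.
pose f (s x : R) := Num.max (s * x ^+ k) 0.
have mf s : measurable_fun setT (f s).
  by apply: measurable_maxr => //; apply: measurable_funM => //; exact: measurable_funX.
have f0 s x : 0 <= f s x by rewrite le_max lexx orbT.
have intf s : P.-integrable setT (fun w => (f s (X w))%:E).
  apply: (@le_integrable _ _ _ P setT measurableT _ (fun w => (s * X w ^+ k)%:E)) => //.
  - apply/measurable_EFinP; apply: measurableT_comp => //; exact: mf.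
  - by move=> w _ /=; rewrite lee_fin ger0_norm ?le_max ?lexx ?orbT// ge_max ler_norm normr_ge0.
  - by under eq_fun do rewrite EFinM; exact: integrableZl.
have fB x : x ^+ k = f 1 x - f (-1) x.
  by rewrite /f; have [h|h] := leP (1 * x ^+ k) 0; have [h'|h'] := leP (-1 * x ^+ k) 0; lra.
under eq_integral do rewrite fB EFinB.
rewrite integralB_EFin//; [|exact: intf..].
have -> : (\int[P]_w (f (-1) (X w))%:E = \int[P]_w (f 1 (X w))%:E)%E.
  rewrite symE//; apply: eq_integral => w _.
  by rewrite /f exprNn -signr_odd oddk expr1 mulN1r mulN1r opprK mul1r.
by rewrite subee// integrable_fin_num//; exact: intf.
Qed.

Lemma indep_moment_le (I : finType) (X : I -> {RV P >-> R}) (k : I -> nat) :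
  mutually_independent X -> (forall i, symmetric_law (X i)) ->
  (forall i p, (\int[P]_w (X i w ^+ (2 * p))%:E <= (gmom (2 * p))%:R%:E)%E) ->
  P.-integrable setT (fun w => (\prod_i X i w ^+ k i)%:E) /\
  (\int[P]_w (\prod_i X i w ^+ k i)%:E <= (\prod_i gmom (k i))%:R%:E)%E.
Proof.
move=> X_indep symX momX.
have intX i : P.-integrable setT (fun w => (X i w ^+ k i)%:E).
  by apply: integrable_pow; apply: le_lt_trans (momX _ _) _; rewrite ltry.
have mk i : measurable_fun setT (fun x : R => x ^+ k i) by exact: measurable_funX.
split; first exact: (@integrable_prod_indep _ _ _ _ _ _ X_indep (fun i x => x ^+ k i)).
rewrite (@integral_prod_indep _ _ _ _ _ _ X_indep [set: I]%SET (fun i x => x ^+ k i))//; last first.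
  by move=> i; rewrite inE.
rewrite natr_prod -prodEFin.
have [oddk|] := pselect (exists i, odd (k i)).
  case: oddk => i oddk; rewrite (bigD1 i)//= symmetric_law_odd_moment// mul0e.
  by apply: prode_ge0 => j _; rewrite lee_fin.
move=> evk; have {}evk i : ~~ odd (k i) by apply/negP => oddk; apply: evk; exists i.
have kE i : k i = (2 * (k i)./2)%N by rewrite mul2n even_halfK.
suff: (0 <= \prod_i \int[P]_w (X i w ^+ k i)%:E <= \prod_i (gmom (k i))%:R%:E)%E by case/andP.
elim/big_ind2 : _ => [|x x' y y' /andP[x0 xx'] /andP[y0 yy']|i _].
- by rewrite lee_fin ler01 lexx.
- by rewrite mule_ge0// lee_pmul.
- rewrite (kE i) momX andbT; apply: integral_ge0 => w _.
  by rewrite lee_fin exprM exprn_ge0 ?sqr_ge0.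
Qed.
End Moments.

(** * Gaussian moments *)

Section Gaussian.
Variable R : realType.
Notation mu := (@lebesgue_measure R).
Let phi : R -> R := normal_pdf 0 1.

Lemma is_derive_normal_pdf01 (x : R) : is_derive x 1 (fun y => - phi y) (x * phi x).
Proof.
have -> : phi = fun y => normal_peak 1 * expR (- (y ^+ 2 / 2)).
  apply/funext => y; rewrite /phi normal_pdfE ?oner_eq0//= /normal_fun subr0 expr1n mulNr; reflexivity.
apply: is_derive_eq; rewrite /GRing.scale /=.
by field.
Qed.

Lemma continuous_phi : continuous phi.
Proof. by apply: continuous_normal_pdf; rewrite oner_eq0. Qed.

Lemma continuous_exprn (k : nat) : continuous (fun x : R => x ^+ k).
Proof. exact: exprn_continuous. Qed.

(** Integration by parts with the primitive [- phi] of [x * phi x] reproduces the recursion of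
    [gmom]. The boundary term on a symmetric interval is nonpositive and is dropped, which leaves an
    upper bound. *)
Lemma normal_moment_itv (q : nat) (a : R) : 0 < a ->
  (\int[mu]_(x in `[(- a)%R, a]) (x ^+ (2 * q) * phi x)%:E <= (gmom (2 * q))%:R%:E)%E.
Proof.
move=> a0; elim: q => [|q IH].
  rewrite muln0 /=; apply: (@le_trans _ _ (\int[mu]_x (phi x)%:E)%E); last first.
    by rewrite integral_normal_pdf.
  under eq_integral do rewrite expr0 mul1r.
  apply: ge0_subset_integral => //=.
  - by apply/measurable_EFinP; exact: measurable_normal_pdf.
  - by move=> x _; rewrite lee_fin normal_pdf_ge0.
have phiN x : phi (- x) = phi x.
  by rewrite /phi !normal_pdfE ?oner_eq0//= /normal_fun !subr0 sqrrN.
have ltNa : - a < a by lra.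
have cphi := continuous_phi.
have intf : mu.-integrable `[(- a)%R, a] (fun x => (x ^+ (2 * q) * phi x)%:E).
  apply: continuous_compact_integrable; first exact: segment_compact.
  have cf : continuous (fun x : R => x ^+ (2 * q) * phi x).
    by move=> x; apply: cvgM; [exact: continuous_exprn|exact: cphi].
  exact: continuous_subspaceT.
have -> : (\int[mu]_(x in `[(- a)%R, a]) (x ^+ (2 * q.+1) * phi x)%:E =
    \int[mu]_(x in `[(- a)%R, a]) (x ^+ (2 * q).+1 * (x * phi x))%:E)%E.
  by apply: eq_integral => x _; rewrite mulrA -exprSr mulnS.
have dF (x : R) : is_derive x 1 (fun y : R => y ^+ (2 * q).+1) ((2 * q).+1%:R * x ^+ (2 * q)).
  have := @is_deriveX R R id (2 * q).+1 x 1 1 (is_derive_id _ _).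
  have -> : (id : R -> R) ^+ (2 * q).+1 = fun y => y ^+ (2 * q).+1.
    by apply/funext => y; rewrite exprfctE.
  by rewrite /GRing.scale /= mulr1.
have dG := is_derive_normal_pdf01.
rewrite (@integration_by_parts R (fun x => x ^+ (2 * q).+1) (fun x => - phi x)
  (fun x => (2 * q).+1%:R * x ^+ (2 * q)) (fun x => x * phi x))//.
- have -> : (\int[mu]_(x in `[(- a)%R, a]) ((2 * q).+1%:R * x ^+ (2 * q) * - phi x)%:E =
      - ((2 * q).+1%:R%:E * \int[mu]_(x in `[(- a)%R, a]) (x ^+ (2 * q) * phi x)%:E))%E.
    rewrite -integralZl// -muleN1 -integralZr//=; last first.
      exact: integrableZl.
    by apply: eq_integral => x _; rewrite -[RHS]/(((2 * q).+1%:R * (x ^+ (2 * q) * phi x) * -1)%:E) mulrN1 mulrN mulrA.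
  rewrite oppeK; apply: (@le_trans _ _ (0 + (2 * q).+1%:R%:E * (gmom (2 * q))%:R%:E)%E).
    apply: leeD; last by apply: lee_wpmul2l => //; rewrite lee_fin.
    have aN : (- a) ^+ (2 * q) = a ^+ (2 * q) by rewrite !exprM sqrrN.
    rewrite lee_fin phiN !exprS aN.
    have e0 : 0 <= a ^+ (2 * q) * phi a by rewrite mulr_ge0 ?normal_pdf_ge0 ?exprn_ge0 ?(ltW a0).
    have := mulr_ge0 (ltW a0) e0; lra.
  by rewrite add0e mulnS /= natrM.
- have cf : continuous (fun x : R => (2 * q).+1%:R * x ^+ (2 * q)).
    by move=> x; apply: cvgM; [exact: cvg_cst|exact: continuous_exprn].
  exact: continuous_subspaceT.
- split => [x _||]; first by have [] := dF x.
    by apply: cvg_at_right_filter; exact: continuous_exprn.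
  by apply: cvg_at_left_filter; exact: continuous_exprn.
- by move=> x _; rewrite derive1E; have [] := dF x.
- have cf : continuous (fun x : R => x * phi x).
    by move=> x; apply: cvgM; [exact: cvg_id|exact: cphi].
  exact: continuous_subspaceT.
- split => [x _||]; first by have [] := dG x.
    by apply: cvg_at_right_filter; apply: continuousN; exact: cphi.
  by apply: cvg_at_left_filter; apply: continuousN; exact: cphi.
- by move=> x _; rewrite derive1E; have [] := dG x.
Qed.

Lemma normal_moment_le (q : nat) :
  (\int[normal_prob (0:R) 1]_x (x ^+ (2 * q))%:E <= (gmom (2 * q))%:R%:E)%E.
Proof.
have mX : measurable_fun setT (fun x : R => x ^+ (2 * q)) by exact: measurable_funX.
have X0 (x : R) : 0 <= x ^+ (2 * q) by rewrite exprM exprn_ge0 ?sqr_ge0.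
have mphi : measurable_fun setT phi by exact: measurable_normal_pdf.
have phi0 x : 0 <= phi x by exact: normal_pdf_ge0.
have -> : (\int[normal_prob (0:R) 1]_x (x ^+ (2 * q))%:E = \int[mu]_x (x ^+ (2 * q) * phi x)%:E)%E.
  have := @ge0_weighted_integral _ _ _ _ R mu (normal_prob (0:R) 1) id phi 1 (@measurable_id _ _ _) mphi phi0.
  move=> /(_ _ (fun x => x ^+ (2 * q)) mX X0) /= ->; rewrite ?mul1e//.
  move=> A mA; rewrite mul1e /normal_prob [RHS]integral_mkcond.
  apply: eq_integral => x _; rewrite patchE indicE.
  by case: (x \in A); rewrite ?mul1r ?mul0r.
have T_eq : \bigcup_k [set` `[(- k.+1%:R : R)%R, k.+1%:R]] = [set: R].
  rewrite -subTset => x _; exists (Num.truncn `|x|) => //=.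
  by rewrite in_itv/= -ler_norml ltW// truncnS_gt.
rewrite -T_eq.
set f := fun x : R => (x ^+ (2 * q) * phi x)%:E.
pose F k : set (measurableTypeR R) := [set` `[(- k.+1%:R : R)%R, k.+1%:R]].
have ndF : nondecreasing_seq F.
  apply/nondecreasing_seqP => k; rewrite subsetEset => x /=; rewrite /F /= !in_itv/= -!ler_norml => /le_trans; apply.
  by rewrite ler_nat.
have mf : measurable_fun setT f by apply/measurable_EFinP; exact: measurable_funM.
have mF k : measurable (F k) by exact: measurable_itv.
have mfF k : measurable_fun (F k) f by exact: measurable_funTS.
have f0 k x : F k x -> (0 <= f x)%E by move=> _; rewrite lee_fin mulr_ge0.
have cv := @ge0_nondecreasing_set_cvg_integral _ (measurableTypeR R) R F f mu ndF mF mfF f0.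
rewrite -(cvg_lim _ cv)//; apply: lime_le; first by apply/cvg_ex; eexists; exact: cv.
by apply: nearW => k; exact: normal_moment_itv.
Qed.
End Gaussian.

Lemma wick_walksZ (R : realDomainType) (V : finType) (B : V -> V -> R) (c : R) p u :
  wick_walks (fun x y => c * B x y) p u = c ^+ (2 * p) * wick_walks B p u.
Proof.
rewrite /wick_walks -seq_sumZ; apply: seq_sum_ext => s _.
rewrite big_split /= big_const_seq count_predT size_iota iter_mulr_1; ring.
Qed.

Lemma trace_gram_ge0 (R : realType) (n m : nat) (A : 'M[R]_(n, m)) p :
  0 <= \sum_i ((A *m A^T) ^+ p) i i.
Proof.
have [k [C ->]] := exp_gram_factor A p; apply: sumr_ge0 => i _.
rewrite mxE; apply: sumr_ge0 => j _; rewrite mxE -expr2; exact: sqr_ge0.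
Qed.

Lemma big_sum_pair (R : Type) (idx : R) (op : Monoid.com_law idx) (I J : finType)
    (F : (I + J) * (I + J) -> R) :
  (forall e, (forall i j, e <> (inl i, inr j)) -> F e = idx) ->
  \big[op/idx]_e F e = \big[op/idx]_(ij : I * J) F (inl ij.1, inr ij.2).
Proof.
move=> F1; transitivity (\big[op/idx]_u \big[op/idx]_v F (u, v)).
  by rewrite pair_bigA; apply: eq_bigr => -[].
rewrite big_sumType /= [X in op _ X]big1 ?Monoid.mulm1; last first.
  by move=> j _; apply: big1 => v _; rewrite F1.
rewrite -(pair_bigA _ (fun i j => F (inl i, inr j))) /=; apply: eq_bigr => i _.
rewrite big_sumType /= big1 ?Monoid.mul1m// => j _.
by rewrite F1.
Qed.

(** * Expectation of traces and the tail bound *)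

Section MeanLe.
Context (d : measure_display) (T : measurableType d) (R : realType).
Variable P : probability T R.

(** Integrability is bundled with the bound, so that the relation is stable under sums and
    nonnegative multiples. *)
Definition mean_le (f : T -> R) (g : R) : Prop :=
  P.-integrable setT (fun w => (f w)%:E) /\ (\int[P]_w (f w)%:E <= g%:E)%E.

Lemma mean_le_trans f g g' : mean_le f g -> g <= g' -> mean_le f g'.
Proof. by move=> [intf fg] gg'; split => //; apply: le_trans fg _; rewrite lee_fin. Qed.

Lemma mean_le0 : mean_le (fun=> 0) 0.
Proof.
split; first exact: finite_measure_integrable_cst.
by rewrite integral_cst// mul0e.
Qed.

Lemma mean_leD f g f' g' : mean_le f g -> mean_le f' g' ->
  mean_le (fun w => f w + f' w) (g + g').
Proof.
move=> [intf fg] [intf' fg']; split.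
  by under eq_fun do rewrite EFinD; exact: integrableD.
under eq_integral do rewrite EFinD.
by rewrite integralD// EFinD leeD.
Qed.

Lemma mean_leZ c f g : 0 <= c -> mean_le f g -> mean_le (fun w => c * f w) (c * g).
Proof.
move=> c0 [intf fg]; split.
  by under eq_fun do rewrite EFinM; exact: integrableZl.
under eq_integral do rewrite EFinM.
by rewrite integralZl// EFinM lee_wpmul2l// lee_fin.
Qed.

Lemma mean_le_sum (I : Type) (r : seq I) (f : I -> T -> R) (g : I -> R) :
  (forall i, mean_le (f i) (g i)) ->
  mean_le (fun w => \sum_(i <- r) f i w) (\sum_(i <- r) g i).
Proof.
move=> fg; elim: r => [|i r IH].
  by under eq_fun do rewrite big_nil; rewrite big_nil; exact: mean_le0.
under eq_fun do rewrite big_cons.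
by rewrite big_cons; exact: mean_leD.
Qed.

Lemma mean_le_seq_sum (V : finType) L (f : seq V -> T -> R) (g : seq V -> R) :
  (forall s, mean_le (f s) (g s)) ->
  mean_le (fun w => seq_sum L (f^~ w)) (seq_sum L g).
Proof.
elim: L f g => [|L IH] f g fg /=; first exact: fg.
by apply: (IH (fun s w => \sum_v f (rcons s v) w)) => s; exact: mean_le_sum.
Qed.

Lemma mean_le_markov (E : set T) (a : R) f g : measurable E -> 0 <= a ->
  (forall w, 0 <= f w) -> (forall w, E w -> a <= f w) -> mean_le f g ->
  (a%:E * P E <= g%:E)%E.
Proof.
move=> mE a0 f0 Ef [intf fg]; apply: le_trans fg.
have := intf => /integrableP[mf _].
have -> : P E = (\int[P]_w (\1_E w : R)%:E)%E by rewrite integral_indic// setIT.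
rewrite -ge0_integralZl//.
apply: ge0_le_integral => //.
- by move=> w _; rewrite lee_fin mulr_ge0.
- by under eq_fun do rewrite -EFinM; apply/measurable_EFinP; exact: measurable_funM.
- move=> w _; rewrite -EFinM lee_fin indicE.
  have [wE|wE] := boolP (w \in E); last by rewrite mulr0.
  by rewrite mulr1; apply: Ef; rewrite inE in wE.
by apply/measurable_EFinP; exact: measurable_indic.
Qed.

End MeanLe.

Section Matrix.
Context (d : measure_display) (T : measurableType d) (R : realType).
Variables (P : probability T R) (n m : nat) (b : 'I_n -> 'I_m -> R).
Variable xi : 'I_n -> 'I_m -> {RV P >-> R}.
Hypothesis b_ge0 : forall i j, 0 <= b i j.
Hypothesis xi_indep : mutually_independent (fun k : 'I_n * 'I_m => xi k.1 k.2).
Hypothesis xi_sym : forall i j, symmetric_law (xi i j).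
Hypothesis xi_mom : forall i j p,
  (\int[P]_w (xi i j w ^+ (2 * p))%:E <= (gmom (2 * p))%:R%:E)%E.
Local Notation V := ('I_n + 'I_m)%type.
Let X := weighted_matrix b (fun i j => xi i j).
Let B := bip_entry (\matrix_(i, j) b i j).

(** The value 1 outside row-to-column pairs is harmless, since the weight [B] vanishes there. *)
Let xi_edge (e : V * V) (w : T) : R :=
  match e with (inl i, inr j) => xi i j w | _ => 1 end.

Lemma bip_entry_weighted u v w : bip_entry (X w) u v = B u v * xi_edge (u, v) w.
Proof. by case: u v => [i|i] [j|j]; rewrite /= ?mul0r// !mxE. Qed.

Lemma bip_ge0 u v : 0 <= B u v.
Proof. by case: u v => [i|i] [j|j]; rewrite /B /= ?mxE. Qed.

Lemma mean_walk_weight p u (s : seq V) :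
  mean_le P (fun w => \prod_(a <- iota 0 (2 * p)) bip_entry (X w) (walk_edge u s a).1 (walk_edge u s a).2)
    (\prod_(a <- iota 0 (2 * p)) B (walk_edge u s a).1 (walk_edge u s a).2 * (wick_weight p u s)%:R).
Proof.
set r := iota _ _; set E := map (walk_edge u s) r.
have -> : (fun w => \prod_(a <- r) bip_entry (X w) (walk_edge u s a).1 (walk_edge u s a).2) =
    (fun w => \prod_(a <- r) B (walk_edge u s a).1 (walk_edge u s a).2 *
      \prod_(ij : 'I_n * 'I_m) xi ij.1 ij.2 w ^+ count_mem (inl ij.1, inr ij.2) E).
  apply/funext => w.
  have -> : \prod_(ij : 'I_n * 'I_m) xi ij.1 ij.2 w ^+ count_mem (inl ij.1, inr ij.2) E =
      \prod_(e <- E) xi_edge e w.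
    rewrite [RHS]prod_count_mem big_sum_pair// => -[[i|i] [j|j]]//= ne; rewrite ?expr1n//.
    by case: (ne i j).
  rewrite big_map -big_split /=; apply: eq_bigr => a _.
  exact: bip_entry_weighted.
have B0 : 0 <= \prod_(a <- r) B (walk_edge u s a).1 (walk_edge u s a).2.
  by apply: prodr_ge0 => a _; exact: bip_ge0.
(* If the weight is zero, both sides vanish. Otherwise the walk uses only row-to-column pairs, and
   all other pairs contribute [gmom 0 = 1] to [wick_weight]. *)
have [/eqP Bz|Bn0] := boolP (\prod_(a <- r) B (walk_edge u s a).1 (walk_edge u s a).2 == 0).
  by rewrite Bz; under eq_fun do rewrite mul0r; rewrite mul0r; exact: mean_le0.
apply: mean_leZ => //.
have -> : wick_weight p u s = (\prod_(ij : 'I_n * 'I_m) gmom (count_mem (inl ij.1, inr ij.2) E))%N.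
  rewrite /wick_weight -/r -/E.
  rewrite big_sum_pair// => -[x y] nxy.
  suff /count_memPn -> : (x, y) \notin E by [].
  apply: contra Bn0 => /mapP[a ar xyE].
  rewrite (big_rem a ar) /=; case: xyE => <- <-.
  by case: x y nxy => [i|i] [j|j] nxy /=; rewrite ?mul0r//; case: (nxy i j).
exact: (indep_moment_le (fun ij : 'I_n * 'I_m => count_mem (inl ij.1, inr ij.2) E) xi_indep).
Qed.

Lemma mean_trace p :
  mean_le P (fun w => \sum_i ((X w *m (X w)^T) ^+ p) i i) (\sum_i wick_walks B p (inl i)).
Proof.
apply: mean_le_sum => i.
have -> : (fun w => ((X w *m (X w)^T) ^+ p) i i) = fun w => mx_walks (X w) p (inl i).
  by apply/funext => w; rewrite gram_exp_diagE.
apply: (@mean_le_seq_sum _ _ _ P _ _ (fun s w => _ * _)) => s.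
by rewrite -mulrA; apply: mean_leZ => //; exact: mean_walk_weight.
Qed.

Lemma measurable_spectral_norm_gt c : (0 < m)%N -> 0 <= c ->
  measurable [set w | c < spectral_norm (X w)].
Proof.
move=> m0 c0.
pose r (q : 'rV[rat]_m) : 'rV[R]_m := map_mx ratr q.
have -> : [set w | c < spectral_norm (X w)] = \bigcup_(q : 'rV[rat]_m)
    [set w | c ^+ 2 * dot (r q) (r q) < dot (r q *m (X w)^T) (r q *m (X w)^T)].
  apply/seteqP; split => w /=.
    by move=> /(spectral_norm_gt_rat _ m0 c0)[q Hq]; exists q.
  by move=> [q _ Hq]; apply/(spectral_norm_gt_rat _ m0 c0); exists q.
apply: (countable_bigcupT_measurable (countableP _)) => q.
have mD : measurable_fun setT (fun w => dot (r q *m (X w)^T) (r q *m (X w)^T)).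
  under eq_fun do rewrite dotE.
  apply: measurable_sum => i; apply: measurable_funM;
    under eq_fun do rewrite mxE; apply: measurable_sum => j;
    under eq_fun do rewrite !mxE; do 2 apply: measurable_funM => //.
rewrite -[X in measurable X]setTI.
exact: (measurable_fun_ltr (measurable_cst _) mD).
Qed.

End Matrix.

Section Sigma.
Variables (R : realType) (n m : nat) (b : 'I_n -> 'I_m -> R).
Hypothesis b_ge0 : forall i j, 0 <= b i j.

Lemma sum_col_le_sigma1 j : \sum_i b i j ^+ 2 <= sigma1 b ^+ 2.
Proof.
rewrite sqr_sqrtr; first exact: (le_bigmax _ (fun j => \sum_i b i j ^+ 2)).
exact: bigmax_ge_id.
Qed.

Lemma sum_row_le_sigma2 i : \sum_j b i j ^+ 2 <= sigma2 b ^+ 2.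
Proof.
rewrite sqr_sqrtr; first exact: (le_bigmax _ (fun i => \sum_j b i j ^+ 2)).
exact: bigmax_ge_id.
Qed.

Lemma le_sigmastar i j : b i j <= sigmastar b.
Proof.
rewrite -(ler_pXn2r (n := 2))// ?nnegrE ?sqrtr_ge0//.
rewrite sqr_sqrtr ?bigmax_ge_id//.
apply: le_trans (le_bigmax _ (fun i => \big[Num.max/0]_j b i j ^+ 2) i).
exact: (le_bigmax _ (fun j => b i j ^+ 2)).
Qed.

Lemma sigmastar_le1 : sigmastar b <= sigma1 b.
Proof.
rewrite -(ler_pXn2r (n := 2))// ?nnegrE ?sqrtr_ge0//.
rewrite sqr_sqrtr ?bigmax_ge_id//.
apply: bigmax_le => [|i _]; first exact: sqr_ge0.
apply: bigmax_le => [|j _]; first exact: sqr_ge0.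
apply: le_trans (sum_col_le_sigma1 j).
by rewrite (bigD1 i)//= lerDl; apply: sumr_ge0 => k _; exact: sqr_ge0.
Qed.

Lemma sigmastar_le2 : sigmastar b <= sigma2 b.
Proof.
rewrite -(ler_pXn2r (n := 2))// ?nnegrE ?sqrtr_ge0//.
rewrite sqr_sqrtr ?bigmax_ge_id//.
apply: bigmax_le => [|i _]; first exact: sqr_ge0.
apply: bigmax_le => [|j _]; first exact: sqr_ge0.
apply: le_trans (sum_row_le_sigma2 i).
by rewrite (bigD1 j)//= lerDl; apply: sumr_ge0 => k _; exact: sqr_ge0.
Qed.
End Sigma.

(** An integer at most [x ^ 2 + 1] is at most [(x + 1 / 2) ^ 2] when [x >= 1]. The ratios
    [sigma1 / sigmastar] and [sigma2 / sigmastar] are at least 1 by [sigmastar_le1] and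
    [sigmastar_le2]. *)
Lemma sqrt_roundup (R : realType) (x : R) : 1 <= x ->
  exists N : nat, [/\ (0 < N)%N, x ^+ 2 <= N%:R & Num.sqrt N%:R <= x + 1 / 2].
Proof.
move=> x1; exists (Num.truncn (x ^+ 2)).+1; split => //.
  by rewrite ltW// truncnS_gt.
rewrite -(ler_pXn2r (n := 2))// ?nnegrE ?sqrtr_ge0//; last by lra.
rewrite sqr_sqrtr// -natr1.
have := truncn_le (x ^+ 2); rewrite sqr_ge0 => h; nra.
Qed.

(** * The tail bound for positive [sigmastar] *)

Section Tail.
Context (d : measure_display) (T : measurableType d) (R : realType).
Variables (P : probability T R) (n m : nat) (b : 'I_n -> 'I_m -> R).
Variable xi : 'I_n -> 'I_m -> {RV P >-> R}.
Hypotheses (n_gt0 : (0 < n)%N) (m_gt0 : (0 < m)%N).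
Hypothesis b_ge0 : forall i j, 0 <= b i j.
Hypothesis xi_indep : mutually_independent (fun k : 'I_n * 'I_m => xi k.1 k.2).
Hypothesis xi_sym : forall i j, symmetric_law (xi i j).
Hypothesis xi_mom : forall i j p,
  (\int[P]_w (xi i j w ^+ (2 * p))%:E <= (gmom (2 * p))%:R%:E)%E.
Let X := weighted_matrix b (fun i j => xi i j).
Let s := sigmastar b.
Hypothesis s0 : 0 < s.

Lemma wick_walks_le_complete p u (N M : nat) (N0 : (0 < N)%N) :
  (sigma1 b / s) ^+ 2 <= N%:R -> (sigma2 b / s) ^+ 2 <= M%:R ->
  wick_walks (bip_entry (\matrix_(i, j) b i j)) p u <=
  s ^+ (2 * p) * wick_walks (@complete_bip R N M) p (inl (Ordinal N0)).
Proof.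
move=> HN HM; set B := bip_entry _.
have -> : B = fun x y => s * (s^-1 * B x y).
  by apply/funext => x; apply/funext => y; rewrite mulrA divff ?mul1r ?gt_eqF.
rewrite wick_walksZ ler_wpM2l ?exprn_ge0 ?(ltW s0)//.
apply: wick_walks_le => [x y|x|y].
- case: x y => [i|i] [j|j]; rewrite /B /= ?mulr0 ?lexx ?ler01// mxE.
  by rewrite mulr_ge0 ?invr_ge0 ?(ltW s0)//= mulrC ler_pdivrMr// mul1r le_sigmastar.
- apply: le_trans HM; case: x => i; last first.
    by rewrite big1 ?sqr_ge0// => y _; rewrite /B mulr0 expr0n.
  rewrite big_sumType /= big1 => [|j _]; last by rewrite mulr0 expr0n.
  rewrite add0r exprMn exprVn mulrC.
  under eq_bigr do rewrite mxE exprMn exprVn.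
  by rewrite -mulr_sumr ler_wpM2l ?invr_ge0 ?sqr_ge0// sum_row_le_sigma2.
- apply: le_trans HN; case: y => j.
    by rewrite big1 ?sqr_ge0// => x _; case: x => k; rewrite /B mulr0 expr0n.
  rewrite big_sumType /= [X in _ + X]big1 => [|k _]; last by rewrite mulr0 expr0n.
  rewrite addr0 exprMn exprVn mulrC.
  under eq_bigr do rewrite mxE exprMn exprVn.
  by rewrite -mulr_sumr ler_wpM2l ?invr_ge0 ?sqr_ge0// sum_col_le_sigma1.
Qed.

Lemma spectral_norm_tail (t : R) : 0 < t ->
  (P [set w | (spectral_norm (X w) > sigma1 b + sigma2 b + s * (1 + t))%R] <=
   (2 * n%:R * expR (- (t ^+ 2 / 2)))%:E)%E.
Proof.
move=> t0; set c := _ + _; set E := [set w | _].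
have [N [N0 HN sN]] : exists N : nat, [/\ (0 < N)%N, (sigma1 b / s) ^+ 2 <= N%:R &
    Num.sqrt N%:R <= sigma1 b / s + 1 / 2].
  by apply: sqrt_roundup; rewrite ler_pdivlMr// mul1r sigmastar_le1.
have [M [M0 HM sM]] : exists M : nat, [/\ (0 < M)%N, (sigma2 b / s) ^+ 2 <= M%:R &
    Num.sqrt M%:R <= sigma2 b / s + 1 / 2].
  by apply: sqrt_roundup; rewrite ler_pdivlMr// mul1r sigmastar_le2.
have c0 : 0 <= c.
  by rewrite !addr_ge0 ?sqrtr_ge0// mulr_ge0 ?(ltW s0)//; lra.
have mE : measurable E by exact: measurable_spectral_norm_gt.
(* The [1] in [1 + t] absorbs the two rounding losses of [1 / 2]. *)
have cs : Num.sqrt N%:R + Num.sqrt M%:R + t <= c / s.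
  have -> : c / s = sigma1 b / s + sigma2 b / s + (1 + t) by rewrite /c mulrDl [s * _ / s]mulrAC divff ?gt_eqF// mul1r mulrDl.
  lra.
set nu := Num.sqrt N%:R + Num.sqrt M%:R in cs *.
pose K : R := n%:R * expR (t * nu + t ^+ 2 / 2).
have PE : P E = (fine (P E))%:E by rewrite fineK// fin_num_measure.
have key k : (\sum_(0 <= p < k) (t * (c / s)) ^+ (2 * p) / (2 * p)`!%:R) * fine (P E) <= K.
  rewrite -lee_fin EFinM -PE.
  pose coef p : R := (t / s) ^+ (2 * p) / (2 * p)`!%:R.
  have coef0 p : 0 <= coef p.
    by rewrite divr_ge0// exprn_ge0// divr_ge0 ?(ltW t0) ?(ltW s0).
  apply: (@mean_le_markov _ _ _ P E _
    (fun w => \sum_(0 <= p < k) coef p * \sum_i ((X w *m (X w)^T) ^+ p) i i)) => //.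
  - by apply: sumr_ge0 => p _; rewrite divr_ge0// exprn_ge0// mulr_ge0 ?(ltW t0)// divr_ge0// ltW.
  - by move=> w; apply: sumr_ge0 => p _; rewrite mulr_ge0// trace_gram_ge0.
  - move=> w wE; apply: ler_sum => p _.
    have -> : (t * (c / s)) ^+ (2 * p) / (2 * p)`!%:R = coef p * c ^+ (2 * p).
      by rewrite /coef [RHS]mulrAC -exprMn; congr (_ ^+ _ / _); ring.
    by rewrite ler_wpM2l// spectral_norm_trace.
  - apply: (mean_le_trans (g := \sum_(0 <= p < k) coef p *
        \sum_i wick_walks (bip_entry (\matrix_(i, j) b i j)) p (inl i))).
      by apply: mean_le_sum => p; apply: mean_leZ => //; exact: mean_trace.
    (* The factor [s ^+ (2 * p)] from rescaling the weights turns the parameter [t / s] into [t];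
       each of the [n] starting rows has the same bound. *)
    have := @wick_series_le R N M (Ordinal N0) (Ordinal M0) t k t0.
    rewrite -/nu => /(ler_wpM2l (ler0n R n)); apply: le_trans.
    rewrite mulr_sumr; apply: ler_sum => p _.
    apply: (@le_trans _ _ (coef p * \sum_(i < n) (s ^+ (2 * p) * wick_walks (@complete_bip R N M) p (inl (Ordinal N0))))).
      rewrite ler_wpM2l//; apply: ler_sum => i _; exact: wick_walks_le_complete.
    rewrite sumr_const card_ord -[X in _ * X <= _]mulr_natl /coef expr_div_n.
    rewrite le_eqVlt; apply/orP; left; apply/eqP.
    by field; rewrite ?expf_eq0 ?gt_eqF ?andbF//= ltr0n fact_gt0.
have cv := @cosh_series_cvg R (t * (c / s)).
have lim : (expR (t * (c / s)) + expR (- (t * (c / s)))) / 2 * fine (P E) <= K.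
  have cv2 : (\sum_(0 <= p < k) (t * (c / s)) ^+ (2 * p) / (2 * p)`!%:R) * fine (P E) @[k --> \oo] -->
      (expR (t * (c / s)) + expR (- (t * (c / s)))) / 2 * fine (P E).
    by apply: cvgM; [exact: cv|exact: cvg_cst].
  rewrite -(cvg_lim _ cv2)//; apply: limr_le; first by apply/cvg_ex; eexists; exact: cv2.
  by apply: nearW.
rewrite PE lee_fin.
have p0 : 0 <= fine (P E) by rewrite fine_ge0.
(* The threshold contributes [t * nu + t ^ 2] against [t * nu + t ^ 2 / 2] in [K], which leaves
   [- t ^ 2 / 2]. Dropping the negative exponential from the hyperbolic cosine costs the factor
   2. *)
have e1 : expR (t * nu + t ^+ 2) <= expR (t * (c / s)).
  by rewrite ler_expR; move: cs; nra.
have e2 : expR (t * nu + t ^+ 2) * fine (P E) <= 2 * K.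
  have := ler_wpM2r p0 e1; have := mulr_ge0 (expR_ge0 (- (t * (c / s)))) p0; lra.
rewrite -(ler_pM2l (expR_gt0 (t * nu + t ^+ 2))); apply: le_trans e2 _.
have -> : K = n%:R * expR ((t * nu + t ^+ 2) + - (t ^+ 2 / 2)).
  by rewrite /K; congr (_ * expR _); field.
rewrite expRD; lra.
Qed.

End Tail.

Unset Implicit Arguments.

Theorem theorem1p6 (R : realType) (d : measure_display) (T : measurableType d)
    (P : probability T R) (n m : nat) (n_gt0 : (0 < n)%N) (le_nm : (n <= m)%N)
    (b : 'I_n -> 'I_m -> R) (b_ge0 : forall i j, 0 <= b i j)
    (xi : 'I_n -> 'I_m -> {RV P >-> R})
    (xi_indep : mutually_independent (fun k : 'I_n * 'I_m => xi k.1 k.2))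
    (xi_sym : forall i j, symmetric_law (xi i j))
    (xi_moments : forall i j (p : nat),
      ('E_P[(fun w => xi i j w ^+ (2 * p))%R] <=
       'E_(normal_prob (0 : R)%R 1%R)[(fun x : R => x ^+ (2 * p))%R])%E)
    (t : R) (t_ge0 : 0 <= t) :
  (P [set w | (spectral_norm (weighted_matrix b (fun i j => xi i j) w) >
                sigma1 b + sigma2 b + sigmastar b * (1 + t))%R] <=
   (2 * n%:R * expR (- (t ^+ 2 / 2)))%:E)%E.
Proof.
have m_gt0 : (0 < m)%N := leq_trans n_gt0 le_nm.
have xi_mom i j p : (\int[P]_w (xi i j w ^+ (2 * p))%:E <= (gmom (2 * p))%:R%:E)%E.
  by have := xi_moments i j p; rewrite unlock => /le_trans; apply; exact: normal_moment_le.
(* The parameter [t / sigmastar] requires both quantities to be positive. At [t = 0] the right-hand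
   side is [2 * n >= 1]; when [sigmastar] is 0 the matrix vanishes and the event is empty. *)
have [t0|t0] := ltP 0 t; last first.
  have -> : t = 0 by apply/eqP; rewrite eq_le t0.
  apply: (@le_trans _ _ 1%E).
    apply: probability_le1; apply: measurable_spectral_norm_gt => //.
    by rewrite addr0 mulr1 !addr_ge0 ?sqrtr_ge0.
  by rewrite lee_fin expr0n /= mul0r oppr0 expR0 mulr1 -natrM ler1n muln_gt0.
have [s0|s0] := ltP 0 (sigmastar b); first exact: spectral_norm_tail.
have b0 i j : b i j = 0.
  by apply/eqP; rewrite eq_le b_ge0 (le_trans (le_sigmastar b_ge0 i j)).
have X0 w : weighted_matrix b (fun i j => xi i j) w = 0.
  by apply/matrixP => i j; rewrite !mxE b0 mul0r.
rewrite (_ : [set w | _] = set0); first by rewrite measure0 lee_fin !mulr_ge0 ?expR_ge0.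
apply/seteqP; split => // w /=; rewrite X0.
move=> H; have /(spectral_norm_gtP 0 m_gt0 (lexx 0))[v] : 0 < spectral_norm (0 : 'M[R]_(n, m)).
  by apply: le_lt_trans H; rewrite !addr_ge0 ?mulr_ge0 ?sqrtr_ge0// addr_ge0.
by rewrite trmx0 mulmx0 !dot0l expr0n mul0r ltxx.
Qed.
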